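(* Let $(\mathbb X,\mathcal X)$ be a measurable space such that $\{x\}\in\mathcal X$ for every $x\in\mathbb X$. Let $\sigma$ be a finite, nonzero, diffuse (i.e., atomless) measure on $(\mathbb X,\mathcal X)$, and set $\beta:=\sigma\mathbb X=\sigma(\mathbb X)$. Then, for any random measure $\eta$ over $\mathbb X$, the following statements are equivalent: (i) $\eta$ is a Dirichlet--Ferguson process on $\mathbb X$ with intensity $\sigma$; (ii) for every measurable function $G\colon \mathbf M\to[0,\infty)$, $$\mathbb E\big[\eta\mathbb X\; G(\eta)\big]=\int_{\mathbb X}\int_0^1 \mathbb E\big[G\big((1-t)\eta+t\delta_x\big)\big](1-t)^{\beta-1}\,dt\,d\sigma(x).$$ Moreover, if $\eta$ is a Dirichlet--Ferguson process on $\mathbb X$ with intensity $\sigma$, then for every non-negative (or bounded) measurable function $F\colon\mathscr P\times\mathbb X\to\mathbb R$, $$\mathbb E\left[\int_{\mathbb X} F(\eta,x)\,d\eta(x)\right]=\int_{\mathbb X}\int_0^1\mathbb E\big[F\big((1-t)\eta+t\delta_x,x\big)\big](1-t)^{\beta-1}\,dt\,d\sigma(x),$$ and for every non-negative (or bounded) measurable function $R\colon\mathscr P\times\mathbb X\times[0,1]\to\mathbb R$, $$\mathbb E\left[\int_{\mathbb X} R\big(\eta,x,\eta(x)\big)\,d\eta(x)\right]=\int_{\mathbb X}\int_0^1\mathbb E\big[R\big((1-t)\eta+t\delta_x,x,t\big)\big](1-t)^{\beta-1}\,dt\,d\sigma(x),$$ where $\eta(x):=\eta(\{x\})$.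
   Context: Notation: for a measure $\mu$ and a set $B$ or function $f$, $\mu B:=\mu(B)$ and $\mu f:=\int f\,d\mu$. $\mathbf M$ is the set of all measures on $(\mathbb X,\mathcal X)$ with values in $[0,+\infty]$, endowed with the coarsest $\sigma$-algebra $\mathcal M$ making all maps $\mu\mapsto\mu B\in[0,+\infty]$, $B\in\mathcal X$, measurable. $\mathscr P\subset\mathbf M$ is the subset of probability measures, with the trace $\sigma$-algebra. Products carry product $\sigma$-algebras. $\delta_x$ is the Dirac measure at $x$. The convention $0\cdot\infty=0$ is used. A random measure over $\mathbb X$ is an $(\mathbf M,\mathcal M)$-valued random element (measurable map from a probability space); a random probability measure is a random measure that is almost surely an element of $\mathscr P$. Dirichlet distribution: for an integer $k\ge2$ let $\Delta^{k-1}:=\{(y_1,\dots,y_k): y_i\ge0,\ y_1+\dots+y_k=1\}$. For $\boldsymbol\alpha=(\alpha_1,\dots,\alpha_k)\in(0,\infty)^k$, the Dirichlet distribution $D_{\boldsymbol\alpha}$ is the probability measure on $\Delta^{k-1}$ with density $\frac{1}{\mathrm B(\boldsymbol\alpha)}\prod_{i=1}^k y_i^{\alpha_i-1}$ with respect to Lebesgue measure $dy_1\cdots dy_{k-1}$ in the first $k-1$ coordinates (with $y_k=1-y_1-\dots-y_{k-1}$), where $\mathrm B(\boldsymbol\alpha)=\prod_i\Gamma(\alpha_i)/\Gamma(\sum_i\alpha_i)$. Dirichlet--Ferguson process: a Dirichlet--Ferguson process with intensity $\sigma$ is a random probability measure $\eta$ over $\mathbb X$ such that (a) for each $B\in\mathcal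 X$ with $\sigma B=0$, $\eta B=0$ almost surely; and (b) for each integer $k\ge2$ and each ordered partition $(X_1,\dots,X_k)$ of $\mathbb X$ into pairwise disjoint, non-empty sets $X_i\in\mathcal X$ with $\sigma X_i>0$ for all $i\le k$, the random vector $(\eta X_1,\dots,\eta X_k)$ has distribution $D_{(\sigma X_1,\dots,\sigma X_k)}$. These conditions determine the law of $\eta$ uniquely.
   Formalization: In the last identity (for R), the map (μ,x) ↦ R(μ,x,μ({x})) is additionally assumed measurable on 𝒫×𝕏; this is automatic if 𝒳 is countably generated, and without it the identity can fail on general measurable spaces. *)

(* Defs.v *)
From HB Require Import structures.
From mathcomp Require Import all_boot all_order all_algebra.
From mathcomp Require Import all_classical all_reals all_analysis.
From mathcomp Require Import measurable_realfun.

Set Implicit Arguments.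
Unset Strict Implicit.
Unset Printing Implicit Defensive.

Import Order.TTheory GRing.Theory Num.Theory.
Import numFieldNormedType.Exports.

Local Open Scope classical_set_scope.
Local Open Scope ring_scope.

Section measures.
Context (d : measure_display) (X : measurableType d) (R : realType).

(* A library measure is a set function on all subsets of X that is a measure on
   the measurable ones.  The sigma-algebra below only involves measurable sets,
   so it does not separate set functions agreeing on those. *)
Definition measures : Type := {measure set X -> \bar R}.

HB.instance Definition _ := gen_eqMixin measures.
HB.instance Definition _ := gen_choiceMixin measures.
HB.instance Definition _ := isPointed.Build measures mzero.

Definition measures_ev (B : set X) (mu : measures) : \bar R := mu B.

Definition measures_measurable : set (set measures) :=
  <<s \bigcup_(B in measurable)
        preimage_set_system [set: measures] (measures_ev B) measurable >>.

Let measures_measurable0 : measures_measurable set0.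
Proof. exact: sigma_algebra0. Qed.

Let measures_measurableC (U : set measures) :
  measures_measurable U -> measures_measurable (~` U).
Proof. exact: sigma_algebraC. Qed.

Let measures_measurableU (F : (set measures)^nat) :
  (forall i, measures_measurable (F i)) -> measures_measurable (\bigcup_i F i).
Proof. exact: sigma_algebra_bigcup. Qed.

Definition measures_display : measure_display.
Proof. by constructor. Qed.

HB.instance Definition _ :=
  @isMeasurable.Build measures_display measures measures_measurable
    measures_measurable0 measures_measurableC measures_measurableU.

Definition prob_measures : set measures := [set mu | mu setT = 1%E].

Fact max0_ge0 (r : R) : 0 <= Num.max 0 r.
Proof. by rewrite le_max lexx. Qed.

(* (1 - t) mu + t delta_x for 0 <= t <= 1; the truncations at 0 only serve to
   make the coefficients non-negative for every t. *)
Definition mixture (t : R) (mu : measures) (x : X) : measures :=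
  measure_add (mscale (NngNum (max0_ge0 (1 - t))) mu)
              (mscale (NngNum (max0_ge0 t)) \d_x).

End measures.
Arguments prob_measures {d X R}.

Section lebesgue_tuple.
Context (R : realType).
Local Notation RT := (measurableTypeR R).

Section step.
Context (n : nat) (m : {sigma_finite_measure set (n.-tuple RT) -> \bar R}).

Definition tuple_cons (p : RT * n.-tuple RT) : n.+1.-tuple RT :=
  [tuple of p.1 :: p.2].

Lemma measurable_tuple_cons : measurable_fun setT tuple_cons.
Proof. exact: measurable_cons measurable_fst measurable_snd. Qed.

Definition lebesgue_tuple_step : set (n.+1.-tuple RT) -> \bar R :=
  pushforward (@lebesgue_measure R \x m)%E tuple_cons.

Let step0 : lebesgue_tuple_step set0 = 0%E.
Proof. by rewrite /lebesgue_tuple_step /pushforward preimage_set0 measure0. Qed.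

Let step_ge0 A : (0 <= lebesgue_tuple_step A)%E.
Proof. by rewrite /lebesgue_tuple_step /pushforward measure_ge0. Qed.

Let step_sigma_additive : semi_sigma_additive lebesgue_tuple_step.
Proof.
move=> F mF tF mUF; rewrite /lebesgue_tuple_step /pushforward preimage_bigcup.
apply: measure_semi_sigma_additive.
- by move=> k; rewrite -[X in measurable X]setTI; exact: measurable_tuple_cons.
- apply/trivIsetP => /= i j _ _ ij; rewrite -preimage_setI.
  by move/trivIsetP : tF => /(_ _ _ _ _ ij) ->//; rewrite preimage_set0.
- rewrite -preimage_bigcup -[X in measurable X]setTI.
  exact: measurable_tuple_cons.
Qed.

HB.instance Definition _ := isMeasure.Build _ _ _
  lebesgue_tuple_step step0 step_ge0 step_sigma_additive.

Let step_sigma_finite : sigma_finite setT lebesgue_tuple_step.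
Proof.
have /sigma_finiteP[F [FT ndF Foo]] := sigma_finiteT (@lebesgue_measure R).
have /sigma_finiteP[G [GT ndG Goo]] := sigma_finiteT m.
pose g (y : n.+1.-tuple RT) : RT * n.-tuple RT :=
  (tnth y ord0, [tuple of behead y]).
have mg : measurable_fun setT g.
  by apply: measurable_fun_pair;
    [exact: measurable_tnth|exact: measurable_behead].
have gK p : g (tuple_cons p) = p.
  by case: p => a y; congr pair; exact: val_inj.
exists (fun k => g @^-1` (F k `*` G k)).
  rewrite -preimage_bigcup (_ : \bigcup_k _ = setT) ?preimage_setT//.
  rewrite -subTset => -[x y] _.
  have [k _ Fx] : (\bigcup_k F k) x by rewrite -FT.
  have [l _ Gy] : (\bigcup_k G k) y by rewrite -GT.
  exists (maxn k l) => //; split => /=.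
  - by move: Fx; apply/subsetPset/ndF/leq_maxl.
  - by move: Gy; apply/subsetPset/ndG/leq_maxr.
move=> k; have [mF Fk] := Foo k; have [mG Gk] := Goo k; split.
  by rewrite -[X in measurable X]setTI; apply: mg => //; exact: measurableX.
rewrite /lebesgue_tuple_step /pushforward -comp_preimage.
rewrite (_ : g \o tuple_cons = id); last by apply/funext => p; exact: gK.
by rewrite preimage_id product_measure1E// lte_mul_pinfty// ge0_fin_numE.
Qed.

HB.instance Definition _ := Measure_isSigmaFinite.Build _ _ _
  lebesgue_tuple_step step_sigma_finite.

End step.

(* Lebesgue measure on R^n: the point mass for n = 0, and the product of the
   Lebesgue measure on the first coordinate and of that on R^(n-1) otherwise. *)
Fixpoint lebesgue_tuple (n : nat) :
    {sigma_finite_measure set (n.-tuple RT) -> \bar R} :=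
  match n with
  | 0 => \d_([tuple] : 0.-tuple RT)
  | n'.+1 => lebesgue_tuple_step (lebesgue_tuple n')
  end.

End lebesgue_tuple.

Section dirichlet.
Context (R : realType).

Definition Gamma (a : R) : R :=
  \int[lebesgue_measure]_(x in `]0, +oo[) (x `^ (a - 1) * expR (- x)).

Context (n : nat).

Definition multi_beta (alpha : 'I_n.+1 -> R) : R :=
  (\prod_i Gamma (alpha i)) / Gamma (\sum_i alpha i).

Definition simplex : set (n.+1.-tuple R) :=
  [set y | (forall i, 0 <= tnth y i) /\ \sum_i tnth y i = 1].

Definition add_last_coord (y : n.-tuple R) : n.+1.-tuple R :=
  [tuple of rcons y (1 - \sum_(i < n) tnth y i)].

Definition dirichlet_density (alpha : 'I_n.+1 -> R) (y : n.+1.-tuple R) : R :=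
  (multi_beta alpha)^-1 * \prod_i tnth y i `^ (alpha i - 1).

Definition dirichlet (alpha : 'I_n.+1 -> R) (A : set (n.+1.-tuple R)) : \bar R :=
  (\int[lebesgue_tuple R n]_(y in add_last_coord @^-1` (simplex `&` A))
     (dirichlet_density alpha (add_last_coord y))%:E)%E.

End dirichlet.

Section dirichlet_ferguson.
Context (d dO : measure_display) (X : measurableType d) (R : realType)
  (Omega : measurableType dO) (P : probability Omega R).

(* The number k >= 2 of cells is written n.+1 with n >= 1.  Under the first
   condition the masses of the cells are almost surely finite, so that taking
   real parts with [fine] only matters on a null event. *)
Definition dirichlet_ferguson (sigma : {finite_measure set X -> \bar R})
    (eta : {RV P >-> measures X R}) : Prop :=
  [/\ {ae P, forall w, prob_measures (eta w)},
      forall B : set X, measurable B -> sigma B = 0%E ->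
        {ae P, forall w, eta w B = 0%E}
    & forall (n : nat) (C : 'I_n.+1 -> set X), (1 <= n)%N ->
        (forall i, measurable (C i)) ->
        (forall i, C i !=set0) ->
        trivIset setT C ->
        \bigcup_i C i = setT ->
        (forall i, 0 < sigma (C i))%E ->
        forall A : set (n.+1.-tuple R), measurable A ->
          pushforward P (fun w => [tuple fine (eta w (C i)) | i < n.+1]) A
            = dirichlet (fun i => fine (sigma (C i))) A].

End dirichlet_ferguson.

(* Main.v *)
(* For a partition C of X into sigma-positive cells, the Mecke equation for the
   Dirichlet vector (eta C_i) is a change of variables: in
   [a_i * \int_0^1 (1 - t)^(beta - 1) E[f ((1 - t) Y + t e_i)] dt] substitute
   z = (1 - t) y + t e_i in Lebesgue measure, exchange the integrals and use
   [\int_0^u (u - t)^(a_i - 1) dt = u^a_i / a_i]; this gives E[Z_i f(Z)].  Any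
   finite family of measurable sets is, up to a sigma-null set, made of cells
   of such a partition, so that the Mecke equation holds for the products of a
   cylinder set of measures and a measurable set, and a pi-lambda argument gives
   it for all non-negative F.
   Conversely, G = 1 and G(mu) = mu(X) give E[eta X] = E[(eta X)^2] = 1, so eta is
   almost surely a probability measure, and G(mu) = mu(B) gives
   E[eta B] = beta / (beta + 1) E[eta B] = 0 for sigma B = 0.  Taking for G a
   function of the cell masses, their law m satisfies
   [m(f) = \sum_i a_i \int_0^1 m(f((1 - t) . + t e_i)) (1 - t)^(beta - 1) dt].
   This equation has at most one solution: its right-hand side contracts the
   Wasserstein distance by the factor beta / (beta + 1).
   The formula for R is that for F(mu, x) = R(mu, x, mu{x}), as eta{x} = 0 almost
   surely when sigma is diffuse. *)
Require Import Defs.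
From HB Require Import structures.
From mathcomp Require Import all_boot all_order all_algebra.
From mathcomp Require Import all_classical all_reals all_analysis.
From mathcomp Require Import measurable_realfun.
From mathcomp Require Import zify ring lra.

Set Implicit Arguments.
Unset Strict Implicit.
Unset Printing Implicit Defensive.

Import Order.TTheory GRing.Theory Num.Theory.
Import numFieldNormedType.Exports.

Local Open Scope classical_set_scope.
Local Open Scope ring_scope.

(** * Mixtures of measures *)

(** On a null event eta w may be any measure, even one that is not sigma-finite, so w |-> eta w is
    not a kernel to which Fubini arguments apply directly. Both sides of the Mecke equation are
    therefore realised as integrals against genuine measures on pairs (mu, x), the left one after
    replacing eta w by the zero measure whenever its total mass is not 1. Only then does agreement
    on rectangles extend to all non-negative functions. In the change of variables the normalising
    constant is common to both sides and cancels. Its value matters where a Dirichlet law must have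
    mass one, in the uniqueness argument and for a partition with a single cell; the gamma integrals
    serve this purpose. The contraction comes from using the same t and i for both laws: z |-> (1 -
    t) z + t e_i shrinks l1 distances by 1 - t. The iteration can start because the simplex has l1
    diameter 2. *)

Section kernel_mixture.
Context d1 d2 (S : measurableType d1) (T : measurableType d2) (R : realType).
Local Open Scope ereal_scope.
Import HBNNSimple.

(** The kernel [l] carries no finiteness assumption, so the identity is derived directly: it holds
    for indicators by the definition of m, for simple functions by linearity, and in general by
    monotone convergence. *)
Lemma kernel_mixture (mu : {measure set S -> \bar R})
    (l : S -> {measure set T -> \bar R}) :
  (forall U, measurable U -> measurable_fun setT (l ^~ U)) ->
  exists m : {measure set T -> \bar R}, forall f : T -> \bar R,
    measurable_fun setT f -> (forall y, 0 <= f y) ->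
    \int[m]_y f y = \int[mu]_s \int[l s]_y f y.
Proof.
move=> ml; pose m (U : set T) := \int[mu]_s l s U.
have m0 : m set0 = 0.
  by apply: integral0_eq => s _; rewrite measure0.
have m_ge0 U : 0 <= m U by apply: integral_ge0 => s _.
have m_sigma : semi_sigma_additive m.
  move=> F mF tF mUF.
  rewrite [X in _ --> X](_ : _ = \sum_(0 <= i <oo) m (F i)).
    by apply: is_cvg_nneseries => n _ _; exact: m_ge0.
  rewrite /m -integral_nneseries//; last by move=> n; exact: ml.
  apply: eq_integral => s _.
  by apply/esym/cvg_lim => //; exact: (measure_semi_sigma_additive F).
pose mm : {measure set T -> \bar R} :=
  HB.pack m (isMeasure.Build _ _ _ m m0 m_ge0 m_sigma).
exists mm => f mf f0.
have lZ (r : R) (U : set T) s : measurable U -> (r < 0 -> U = set0)%R ->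
    \int[l s]_y (r * \1_U y)%:E = r%:E * l s U.
  move=> mU U0; rewrite (integralZl_indic _ (fun=> U))//.
  by rewrite integral_indic// setIT.
have nnsfunE (g : {nnsfun T >-> R}) (n : {measure set T -> \bar R}) :
    \int[n]_y (g y)%:E =
    \sum_(r \in range g) r%:E * n (g @^-1` [set r]).
  under eq_integral do rewrite fimfunE -fsumEFin//.
  rewrite ge0_integral_fsum//; last 2 first.
  - by move=> r; exact/measurable_EFinP/measurableT_comp.
  - by move=> r z _; rewrite EFinM nnfun_muleindic_ge0.
  apply: eq_fsbigr => r _; rewrite (integralZl_indic _ (fun r => g @^-1` [set r]))//.
    by rewrite integral_indic// setIT.
  by move=> r0; rewrite preimage_nnfun0.
pose f_ := nnsfun_approx measurableT mf.
have limE (n : {measure set T -> \bar R}) :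
    \int[n]_y f y = limn (fun k => \int[n]_y (f_ k y)%:E).
  rewrite -monotone_convergence//; last 3 first.
  - by move=> k; exact/measurable_EFinP.
  - by move=> k z _; rewrite lee_fin.
  - by move=> z _ a b ab; rewrite lee_fin; exact/lefP/nd_nnsfun_approx.
  apply: eq_integral => z _; apply/esym/cvg_lim => //=.
  exact: cvg_nnsfun_approx.
rewrite limE; under [RHS]eq_integral do rewrite limE.
have mint k : measurable_fun setT (fun s => \int[l s]_y (f_ k y)%:E).
  under eq_fun do rewrite nnsfunE.
  by apply: emeasurable_fsum => // r; apply: measurable_funeM; exact: ml.
rewrite monotone_convergence//; last 2 first.
- by move=> k s _; apply: integral_ge0 => y _; rewrite lee_fin.
- move=> s _ a b ab; apply: ge0_le_integral => //.
  + by move=> z _; rewrite lee_fin.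
  + exact/measurable_EFinP.
  + exact/measurable_EFinP.
  + by move=> z _; rewrite lee_fin; exact/lefP/nd_nnsfun_approx.
congr (limn _); apply/funext => k; rewrite nnsfunE.
under [RHS]eq_integral do rewrite nnsfunE.
rewrite ge0_integral_fsum//.
(* For r < 0 the level set of the non-negative approximation is empty, which replaces the sign
   condition of [ge0_integralZl]. *)
- apply: eq_fsbigr => r _; have [r0|r0] := leP 0%R r.
    by rewrite ge0_integralZl//; exact: ml.
  rewrite preimage_nnfun0// measure0 mule0 integral0_eq// => s _.
  by rewrite measure0 mule0.
- by move=> r; apply: measurable_funeM; exact: ml.
- by move=> r s _; have [r0|r0] := leP 0%R r;
    [exact: mule_ge0|rewrite preimage_nnfun0// measure0 mule0].
Qed.

(** The scaled Dirac masses at [phi s] with weight [h s] form a kernel, and [kernel_mixture]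
    applies. With [phi] a parametrisation of the simplex and [h] a density this produces the
    Dirichlet laws. *)
Lemma weighted_image_measure (mu : {measure set S -> \bar R}) (phi : S -> T)
    (h : S -> R) :
  measurable_fun setT phi -> measurable_fun setT h -> (forall s, 0 <= h s)%R ->
  exists m : {measure set T -> \bar R}, forall f : T -> \bar R,
    measurable_fun setT f -> (forall y, 0 <= f y) ->
    \int[m]_y f y = \int[mu]_s ((h s)%:E * f (phi s)).
Proof.
move=> mphi mh h0.
pose l s : {measure set T -> \bar R} := mscale (NngNum (h0 s)) \d_(phi s).
have [|m mE] := @kernel_mixture mu l.
  move=> U mU; rewrite /l/= /mscale/=.
  apply: emeasurable_funM; first exact/measurable_EFinP.
  have -> : (fun s => \d_(phi s) U) = (EFin \o \1_U) \o phi :> (S -> \bar R).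
    by apply/funext => s; rewrite /= diracE indicE.
  by apply: measurableT_comp => //; exact/measurable_EFinP.
exists m => f mf f0; rewrite mE//; apply: eq_integral => s _.
by rewrite ge0_integral_mscale// integral_dirac// diracT mul1e.
Qed.

(** Integrals only depend on the values on measurable sets, where [m] agrees with the measure of
    [weighted_image_measure]. *)
Lemma ge0_integral_density (mu : {measure set S -> \bar R}) (phi : S -> T)
    (h : S -> R) (m : {measure set T -> \bar R}) :
  measurable_fun setT phi -> measurable_fun setT h -> (forall s, 0 <= h s)%R ->
  (forall A, measurable A -> m A = \int[mu]_s ((h s)%:E * (\1_A (phi s))%:E)) ->
  forall f : T -> \bar R, measurable_fun setT f -> (forall y, 0 <= f y) ->
  \int[m]_y f y = \int[mu]_s ((h s)%:E * f (phi s)).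
Proof.
move=> mphi mh h0 mA f mf f0.
have [m' m'E] := weighted_image_measure mu mphi mh h0.
rewrite -m'E//; apply: eq_measure_integral => A mA' _.
rewrite mA// -(m'E (EFin \o \1_A))//.
- by rewrite integral_indic// setIT.
- exact/measurable_EFinP.
- by move=> y; rewrite lee_fin.
Qed.

End kernel_mixture.

Lemma measurable_fun_integral2 d1 d2 (S : measurableType d1)
    (T : measurableType d2) (R : realType)
    (m : {sigma_finite_measure set T -> \bar R}) (f : S -> T -> \bar R) :
  measurable_fun setT (fun p : S * T => f p.1 p.2) ->
  (forall x y, 0 <= f x y)%E ->
  measurable_fun setT (fun x => \int[m]_y f x y)%E.
Proof.
move=> mf f0.
exact: (measurable_fun_fubini_tonelli_F (m2 := m) (fun p => f p.1 p.2) mf).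
Qed.

(** Here [m] is a bare measure whose finiteness is a hypothesis; restricting it to [setT] by
    [mfrestr] gives the same measure with the structure that Tonelli's theorem asks for. *)
Lemma measurable_fun_integral2_finite d1 d2 (S : measurableType d1)
    (T : measurableType d2) (R : realType)
    (m : {measure set T -> \bar R}) (f : S -> T -> \bar R) :
  (m setT < +oo)%E ->
  measurable_fun setT (fun p : S * T => f p.1 p.2) ->
  (forall x y, 0 <= f x y)%E ->
  measurable_fun setT (fun x => \int[m]_y f x y)%E.
Proof.
move=> moo mf f0.
rewrite (_ : (fun _ => _) = fun x => \int[mfrestr measurableT moo]_y f x y)%E.
  exact: measurable_fun_integral2.
apply/funext => x; apply: eq_measure_integral => A mA _.
by rewrite /= /mfrestr /mrestr setIT.
Qed.

(** * Lebesgue measure and gamma integrals *)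

Section lebesgue_affine.
Context (R : realType).
Local Notation RT := (measurableTypeR R).
Local Notation leb := (@lebesgue_measure R).
Local Open Scope ereal_scope.

(** The image of Lebesgue measure under x |-> c x + b, multiplied by c, gives []u, v]] the mass v -
    u, hence is Lebesgue measure by uniqueness. *)
Lemma ge0_integral_affine (c b : R) (f : RT -> \bar R) : (0 < c)%R ->
  measurable_fun setT f -> (forall x, 0 <= f x) ->
  \int[leb]_x f x = c%:E * \int[leb]_x f (c * x + b)%R.
Proof.
move=> c0 mf f0.
have mphi : measurable_fun setT (fun x : RT => c * x + b : RT)%R.
  by apply: measurable_funD => //; exact: measurable_funM.
pose push := (pushforward leb (fun x : RT => c * x + b : RT)%R : {measure set RT -> \bar R}).
pose m : {measure set RT -> \bar R} := mscale (NngNum (ltW c0)) (push mphi).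
transitivity (\int[m]_x f x); last first.
  by rewrite ge0_integral_mscale// ge0_integral_pushforward.
apply: eq_measure_integral => A mA _.
apply: (@lebesgue_measure_unique R m) => // _ [[u v]] _ <- /=.
rewrite /m /= /mscale /= /pushforward /=.
have -> : (fun x : RT => c * x + b)%R @^-1` `]u, v] =
    `]((u - b) / c)%R, ((v - b) / c)%R]%classic.
  apply/seteqP; split => x /=; rewrite !in_itv/= ltr_pdivrMr// ler_pdivlMr//;
  by rewrite ltrBlDr lerBrDr mulrC.
rewrite !lebesgue_measure_itv/= !lte_fin ltr_pM2r ?invr_gt0// ltrD2r.
case: ifPn => _; last by rewrite mule0.
rewrite -!EFinB -EFinM; congr EFin.
by field; exact: lt0r_neq0.
Qed.

Lemma ge0_integral_lebesgue_tupleS n (f : n.+1.-tuple RT -> \bar R) :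
  measurable_fun setT f -> (forall y, 0 <= f y) ->
  \int[lebesgue_tuple R n.+1]_y f y =
  \int[leb]_x \int[lebesgue_tuple R n]_y f [tuple of x :: y].
Proof.
move=> mf f0 /=.
rewrite [LHS](@ge0_integral_pushforward _ _ _ _ _ _ (@measurable_tuple_cons R n)
  (leb \x lebesgue_tuple R n)%E)//.
rewrite preimage_setT fubini_tonelli1//=.
by apply: measurableT_comp => //; exact: measurable_tuple_cons.
Qed.

Lemma ge0_integral_lebesgue_tuple0 (f : 0.-tuple RT -> \bar R) :
  measurable_fun setT f ->
  \int[lebesgue_tuple R 0]_y f y = f [tuple].
Proof. by move=> mf; rewrite /= integral_dirac// diracT mul1e. Qed.

Lemma measurable_tuple_affine n (c : R) (b : 'I_n -> R) : measurable_fun setT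
  (fun y : n.-tuple RT => [tuple c * tnth y i + b i | i < n]%R : n.-tuple RT).
Proof.
apply/measurable_fun_tnthP => i /=.
rewrite (_ : _ \o _ = (fun y => c * tnth y i + b i)%R); last first.
  by apply/funext => y /=; rewrite tnth_mktuple.
apply: measurable_funD => //; apply: measurable_funM => //.
exact: measurable_tnth.
Qed.

(** Tonelli peels off one coordinate at a time, each contributing a factor c. One common scale with
    a shift per coordinate is the shape of z |-> (1 - t) z + t e_i. *)
Lemma ge0_integral_lebesgue_tuple_affine n (c : R) (b : 'I_n -> R)
    (f : n.-tuple RT -> \bar R) : (0 < c)%R ->
  measurable_fun setT f -> (forall y, 0 <= f y) ->
  \int[lebesgue_tuple R n]_y f y =
  (c ^+ n)%:E * \int[lebesgue_tuple R n]_y f [tuple c * tnth y i + b i | i < n]%R.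
Proof.
move=> c0; elim: n => [|n ih] in b f *.
  move=> mf f0; rewrite expr0 mul1e.
  by apply: eq_integral => y _; congr f; rewrite [LHS]tuple0 [RHS]tuple0.
move=> mf f0.
have maff := measurable_tuple_affine c.
have mfx (x : R) : measurable_fun setT (fun y : n.-tuple RT => f [tuple of x :: y]).
  by apply: measurableT_comp => //; exact: measurable_cons.
rewrite ge0_integral_lebesgue_tupleS//.
rewrite (@ge0_integral_affine c (b ord0))//; last 2 first.
- apply: (measurable_fun_fubini_tonelli_F (fun p : RT * n.-tuple RT => f [tuple of p.1 :: p.2])).
    by apply: measurableT_comp => //; exact: measurable_tuple_cons.
  by move=> p; exact: f0.
- by move=> x; exact: integral_ge0.
rewrite ge0_integral_lebesgue_tupleS//; last by apply: measurableT_comp => //; exact: maff.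
rewrite exprS EFinM -muleA; congr (_ * _).
under eq_integral => x _ do
  rewrite (ih (fun i => b (lift ord0 i)) (fun y => f [tuple of (c * x + b ord0)%R :: y]))//.
rewrite ge0_integralZl//; last 3 first.
- apply: measurable_fun_integral2; last by move=> *; exact: f0.
   apply: measurableT_comp => //; apply: measurable_cons.
      by apply: measurable_funD => //; apply: measurable_funM.
  exact: (measurableT_comp (maff n _) measurable_snd).
- by move=> x _; exact: integral_ge0.
- by rewrite lee_fin exprn_ge0// ltW.
congr (_ * _); apply: eq_integral => x _; apply: eq_integral => y _; congr f.
apply: eq_from_tnth => i; rewrite tnth_mktuple.
case: (unliftP ord0 i) => [j ->|->].
  by rewrite !tnthS tnth_mktuple.
by rewrite !tnth0.
Qed.

End lebesgue_affine.

Section gamma.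
Context (R : realType).
Local Notation RT := (measurableTypeR R).
Local Notation leb := (@lebesgue_measure R).
Local Open Scope ereal_scope.

Lemma ge0_integral_reflect (b : R) (f : RT -> \bar R) :
  measurable_fun setT f -> (forall x, 0 <= f x) ->
  \int[leb]_x f x = \int[leb]_x f (b - x)%R.
Proof.
move=> mf f0.
have mN : measurable_fun setT (-%R : RT -> RT) by [].
rewrite [RHS](@ge0_integral_affine R 1 b)//; last first.
  by apply: measurableT_comp => //; exact: measurable_funB.
rewrite mul1e; transitivity (\int[leb]_x f (- x)%R); last first.
  by apply: eq_integral => x _; congr f; ring.
rewrite -(@ge0_integral_pushforward _ _ _ _ _ _ mN leb setT)//.
by apply: eq_measure_integral => A mA _; exact/esym/lebesgue_measureN.
Qed.

(** For a < 1 the integrand is unbounded at 0, so the fundamental theorem of calculus is applied on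
    [v k, u] and monotone convergence lets [v k] decrease to 0. *)
Lemma integral_powR (a u : R) : (0 < a)%R -> (0 < u)%R ->
  \int[leb]_(s in `]0%R, u]) (s `^ (a - 1))%:E = (u `^ a / a)%:E.
Proof.
move=> a0 u0.
(* The denominator k + 2, rather than k + 1, keeps [v k] strictly below u. *)
pose v k : R := (u / k.+2%:R)%R.
have v0 k : (0 < v k)%R by rewrite divr_gt0.
have vu k : (v k < u)%R by rewrite ltr_pdivrMr// ltr_pMr// ltr1n.
have vdec m k : (m <= k)%N -> (v k <= v m)%R.
  by move=> mk; rewrite ler_pM2l// lef_pV2 ?posrE// ler_nat !ltnS.
have vcvg : v k @[k --> \oo] --> (0 : R)%R.
  rewrite -(mulr0 u)%R; apply: cvgMr.
  have := @cvg_harmonic R; rewrite -cvg_shiftS; exact.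
have part k : \int[leb]_(s in `[v k, u]) (s `^ (a - 1))%:E =
    (u `^ a / a - v k `^ a / a)%:E.
  have dF (x : R) : (0 < x)%R -> is_derive x (1 : R)%R (fun x : R => x `^ a / a)%R (x `^ (a - 1))%R.
    move=> x0; have dx := @is_derive1_powR R a x x0.
    have -> : (fun x : R => x `^ a / a)%R = ((a^-1)%R \*: (fun y : R => y `^ a)%R)%R.
      by apply/funext => y; rewrite /= mulrC.
    rewrite [X in is_derive _ _ _ X](_ : _ = a^-1 *: (a * x `^ (a - 1)))%R; last first.
      by rewrite /GRing.scale/= mulrA mulVf ?gt_eqF// mul1r.
    exact: is_deriveZ.
  have cF (x : R) : (0 < x)%R -> {for x, continuous (fun x : R => x `^ a / a)%R}.
    move=> x0; apply: differentiable_continuous; apply/derivable1_diffP.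
    by have [] := dF _ x0.
  rewrite (@continuous_FTC2 _ _ (fun x => x `^ a / a)%R)//.
  - apply: continuous_in_subspaceT => x; rewrite inE/= in_itv/= => /andP[vx _].
    apply: differentiable_continuous; apply/derivable1_diffP.
    apply: derivable_powR; rewrite in_itv/= andbT.
    exact: lt_le_trans vx.
  - split.
    + move=> x; rewrite in_itv/= => /andP[vx _].
      by have [] := dF x (lt_trans (v0 k) vx).
    + by apply: cvg_at_right_filter; exact: cF.
    + by apply: cvg_at_left_filter; exact: cF.
  - move=> x; rewrite in_itv/= => /andP[vx _]; rewrite derive1E.
    by have [_] := dF x (lt_trans (v0 k) vx).
have <- : \bigcup_k `[v k, u]%classic = `]0%R, u]%classic.
  apply/seteqP; split => [x [k _] /=|x /=]; rewrite !in_itv/=.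
    by move=> /andP[vx ->]; rewrite (lt_le_trans _ vx).
  move=> /andP[x0 xu].
  have : \forall k \near \oo, (v k < x)%R.
    by have /cvgrPdist_lt/(_ x x0) := vcvg; apply: filterS => k;
      rewrite sub0r normrN gtr0_norm.
  by move=> [k _ /(_ k (leqnn _)) vkx]; exists k => //=; rewrite in_itv/= xu ltW.
have c1 : \int[leb]_(s in `[v k, u]) (s `^ (a - 1))%:E @[k --> \oo] -->
    \int[leb]_(s in \bigcup_k `[v k, u]%classic) (s `^ (a - 1))%:E.
  apply: ge0_nondecreasing_set_cvg_integral.
  - move=> m k mk; apply/subsetPset => x /=; rewrite !in_itv/= => /andP[vx ->].
    by rewrite (le_trans _ vx)// vdec.
  - by [].
  - move=> k; apply/measurable_EFinP; apply: measurable_funTS.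
    exact: measurable_powR.
  - by move=> k x _; rewrite lee_fin powR_ge0.
have c2 : \int[leb]_(s in `[v k, u]) (s `^ (a - 1))%:E @[k --> \oo] --> (u `^ a / a)%:E.
  under eq_fun do rewrite part.
  apply: cvg_EFin; first exact: nearW.
  rewrite -[X in _ --> X]subr0; apply: cvgB; first exact: cvg_cst.
  rewrite -(mul0r a^-1)%R; apply: cvgMl.
  by have /cvg_at_rightP := @powR_cvg0 R a a0; apply.
by rewrite (cvg_unique _ c1 c2).
Qed.

Lemma integral_powR_onem (a u : R) : (0 < a)%R -> (0 <= u)%R ->
  \int[leb]_(t in `[0%R, u]) ((u - t) `^ (a - 1))%:E = (u `^ a / a)%:E.
Proof.
move=> a0; rewrite le_eqVlt => /predU1P[<-|u0].
  by rewrite set_itv1 integral_set1 powR0 ?mul0r// gt_eqF.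
have mf : measurable_fun setT (fun t : RT => ((u - t) `^ (a - 1))%:E).
  apply/measurable_EFinP; apply: (measurableT_comp (measurable_powR (a - 1)%R)).
  exact: measurable_funB.
rewrite -integral_itv_bndo_bndc; last exact: measurable_funTS.
rewrite -integral_powR// integral_mkcond [RHS]integral_mkcond.
rewrite [RHS](ge0_integral_reflect u); last 2 first.
- apply/(measurable_restrictT _ _).1 => //.
  by apply/measurable_EFinP; apply: measurable_funTS; exact: measurable_powR.
- by move=> x; rewrite patchE; case: ifPn => // _; rewrite lee_fin powR_ge0.
apply: eq_integral => t _; rewrite !patchE; congr (if _ then _ else _).
by apply/idP/idP; rewrite !inE/= !in_itv/=; lra.
Qed.

(* [x `^ a] is 1 for x < 0, hence the indicator, here and in [ppower]. *)
Definition gamma_density (a x : R) : R := (0 <= x)%R%:R * (x `^ (a - 1) * expR (- x)).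

Lemma gamma_density_ge0 a x : (0 <= gamma_density a x)%R.
Proof. by rewrite /gamma_density !mulr_ge0// ?powR_ge0// expR_ge0. Qed.

Lemma measurable_gamma_density a : measurable_fun setT (gamma_density a : RT -> R).
Proof.
apply: measurable_funM.
  rewrite (_ : (fun _ => _) = \1_`[0%R, +oo[%classic).
    exact: measurable_indic.
  by apply/funext => x; rewrite indicE mem_setE in_itv/= andbT.
apply: measurable_funM; first exact: measurable_powR.
by apply: measurableT_comp.
Qed.

Let gamma_densityE a : \int[leb]_x (gamma_density a x)%:E =
  \int[leb]_(x in `]0%R, +oo[) (x `^ (a - 1) * expR (- x))%:E.
Proof.
rewrite integral_itv_obnd_cbnd; last first.
  apply: measurable_funTS; apply/measurable_EFinP.
  apply: measurable_funM; first exact: measurable_powR.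
  exact: measurableT_comp.
rewrite [RHS]integral_mkcond; apply: eq_integral => x _.
rewrite patchE /gamma_density mem_setE in_itv/= andbT.
by case: ifPn => _; rewrite ?mul1r ?mul0r.
Qed.

(** The integrand is dominated by x^(a - 1) on ]0, 1] and by a multiple of the exponential density
    of rate 1/2 beyond 1. *)
Let gamma_density_lty (a : R) : (0 < a)%R -> \int[leb]_x (gamma_density a x)%:E < +oo.
Proof.
move=> a0; rewrite gamma_densityE.
(* The factor (2 a)^a comes from raising x / (2 a) <= exp(x / (2 a)) to the power a; the factor 2
   cancels the rate 1/2 in front of the exponential density. *)
pose C : R := ((2 * a) `^ a * 2)%R.
have C0 : (0 <= C)%R by rewrite mulr_ge0// powR_ge0.
have mp : measurable_fun setT (fun x : RT => (x `^ (a - 1))%:E).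
  by apply/measurable_EFinP; exact: measurable_powR.
have me : measurable_fun setT (fun x : RT => (exponential_pdf (2^-1) x)%:E).
  by apply/measurable_EFinP; exact: measurable_exponential_pdf.
have e0 (x : R) : (0 <= exponential_pdf (2^-1) x)%R by exact: exponential_pdf_ge0.
apply: (@le_lt_trans _ _ (\int[leb]_(x in `]0%R, 1%R]) (x `^ (a - 1))%:E +
   \int[leb]_x (C * exponential_pdf (2^-1) x)%:E)); last first.
  rewrite integral_powR//.
  under eq_integral do rewrite EFinM.
  rewrite ge0_integralZl//; last by move=> x _; rewrite lee_fin.
  by rewrite integral_exponential_pdf// mule1 -EFinD ltry.
rewrite integral_mkcond [X in _ <= X + _]integral_mkcond -ge0_integralD//=; last 4 first.
- by move=> x _; rewrite patchE; case: ifPn => // _; rewrite lee_fin powR_ge0.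
- by apply/(measurable_restrictT _ _).1 => //; exact: measurable_funTS.
- by move=> x _; rewrite lee_fin mulr_ge0.
- by under eq_fun do rewrite EFinM; exact: measurable_funeM.
apply: ge0_le_integral => //.
- by move=> x _; rewrite patchE; case: ifPn => // _; rewrite lee_fin mulr_ge0// ?powR_ge0 ?expR_ge0.
- apply/(measurable_restrictT _ _).1 => //; apply: measurable_funTS; apply/measurable_EFinP.
  apply: measurable_funM; first exact: measurable_powR.
  exact: measurableT_comp.
- apply: emeasurable_funD; last by under eq_fun do rewrite EFinM; exact: measurable_funeM.
  by apply/(measurable_restrictT _ _).1 => //; exact: measurable_funTS.
move=> x _; rewrite !patchE !mem_setE !in_itv/= andbT.
have [x0|x0] := ltP 0%R x; last by rewrite add0e lee_fin mulr_ge0.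
have [x1|x1] := leP x 1%R; rewrite /=.
  rewrite -EFinD lee_fin -[leLHS]addr0 lerD//; last by rewrite mulr_ge0.
  by rewrite ler_piMr ?powR_ge0// expR_le1; lra.
rewrite add0e lee_fin (exponential_pdfE _ (ltW x0)) /C.
have xa : (x `^ a <= (2 * a) `^ a * expR (x / 2))%R.
  have -> : (x / 2 = x / (2 * a) * a)%R by field; rewrite gt_eqF.
  rewrite expRM -powRM ?expR_ge0//; last by lra.
  apply: ge0_ler_powR; rewrite ?nnegrE ?(ltW a0) ?(ltW x0)//.
    by rewrite mulr_ge0 ?expR_ge0//; lra.
  rewrite mulrC -ler_pdivrMr; last by lra.
  by apply: le_trans (expR_ge1Dx _); rewrite lerDr.
apply: (@le_trans _ _ (x `^ a * expR (- x))%R).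
  by rewrite ler_wpM2r ?expR_ge0// ler_powR; lra.
apply: (@le_trans _ _ ((2 * a) `^ a * expR (x / 2) * expR (- x))%R).
  by rewrite ler_wpM2r ?expR_ge0.
rewrite -!mulrA mulVKf// -expRD.
by rewrite ler_wpM2l ?powR_ge0// ler_expR; lra.
Qed.

(** [Gamma] is only the real part of this integral, so the identity rests on its finiteness. *)
Lemma integral_gamma_density (a : R) : (0 < a)%R ->
  \int[leb]_x (gamma_density a x)%:E = (Gamma a)%:E.
Proof.
move=> a0; rewrite /Gamma /Rintegral fineK -gamma_densityE//.
by rewrite ge0_fin_numE ?gamma_density_lty// integral_ge0// => x _;
  rewrite lee_fin gamma_density_ge0.
Qed.

(** A zero integral would force the integrand, positive on all of ]0, +oo[, to vanish almost
    everywhere on this set of infinite measure. *)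
Lemma Gamma_gt0 (a : R) : (0 < a)%R -> (0 < Gamma a)%R.
Proof.
move=> a0; rewrite -lte_fin -integral_gamma_density// lt0e.
apply/andP; split; last first.
  by apply: integral_ge0 => x _; rewrite lee_fin gamma_density_ge0.
apply/negP; rewrite gamma_densityE => /eqP.
pose f (x : RT) := (x `^ (a - 1) * expR (- x))%:E.
have f0 x : 0 <= f x by rewrite lee_fin mulr_ge0 ?powR_ge0 ?expR_ge0.
have mf : measurable_fun (`]0%R, +oo[%classic : set RT) f.
  apply: measurable_funTS; apply/measurable_EFinP.
  apply: measurable_funM; first exact: measurable_powR.
  exact: measurableT_comp.
rewrite (_ : \int[leb]_(x in _) _ = \int[leb]_(x in `]0%R, +oo[) `|f x|); last first.
  by apply: eq_integral => x _; rewrite gee0_abs.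
move/(ae_eq_integral_abs leb (measurable_itv _) mf).
move=> [N [mN N0 sub]].
have : leb `]0%R, +oo[%classic <= leb N.
  apply: le_measure; rewrite ?inE// => x /= x0; apply: sub => /= /(_ x0) /eqP.
  move: x0; rewrite in_itv/= andbT => x0.
  by rewrite eqe mulf_eq0 !gt_eqF ?expR_gt0// powR_gt0.
by rewrite N0 lebesgue_measure_itv/= ltry.
Qed.

End gamma.

(** * Dirichlet distributions *)

Section simplex_mix.
Context (R : realType).
Local Notation RT := (measurableTypeR R).

Lemma tnth_add_last_coord_lift n (y : n.-tuple R) (j : 'I_n) :
  tnth (add_last_coord y) (lift ord_max j) = tnth y j.
Proof.
by rewrite (tnth_nth 0) lift_max nth_rcons size_tuple ltn_ord -tnth_nth.
Qed.

Lemma tnth_add_last_coord_max n (y : n.-tuple R) :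
  tnth (add_last_coord y) ord_max = 1 - \sum_(i < n) tnth y i.
Proof. by rewrite (tnth_nth 0) /= nth_rcons size_tuple ltnn eqxx. Qed.

Lemma sum_add_last_coord n (y : n.-tuple R) :
  \sum_i tnth (add_last_coord y) i = 1.
Proof.
rewrite (bigD1_ord ord_max)//= tnth_add_last_coord_max.
by under eq_bigr do rewrite tnth_add_last_coord_lift; rewrite subrK.
Qed.

Lemma measurable_add_last_coord n :
  measurable_fun setT (@add_last_coord R n : n.-tuple RT -> n.+1.-tuple R).
Proof.
apply/measurable_fun_tnthP => i; case: (unliftP ord_max i) => [j|] ->.
  rewrite (_ : _ \o _ = (@tnth n R)^~ j); first exact: measurable_tnth.
  by apply/funext => y /=; rewrite tnth_add_last_coord_lift.
rewrite (_ : _ \o _ = fun y => 1 - \sum_(i < n) tnth y i); last first.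
  by apply/funext => y /=; rewrite tnth_add_last_coord_max.
apply: measurable_funB => //; apply: measurable_sum => j.
exact: measurable_tnth.
Qed.

(** The effect on the vector of cell masses of passing from mu to [mixture t mu x] with x in the
    cell i; see [cell_masses_mixture]. *)
Definition tuple_mix n (t : R) (i : 'I_n.+1) (z : n.+1.-tuple R) :=
  [tuple (1 - t) * tnth z j + t * (j == i)%:R | j < n.+1].

Lemma measurable_tuple_mix n i :
  measurable_fun setT (fun p : R * n.+1.-tuple R => tuple_mix p.1 i p.2).
Proof.
apply/measurable_fun_tnthP => j.
rewrite (_ : _ \o _ =
    fun p : R * n.+1.-tuple R => (1 - p.1) * tnth p.2 j + p.1 * (j == i)%:R).
  apply: measurable_funD; last exact: measurable_funM.
  apply: measurable_funM; first exact: measurable_funB.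
  by apply: (measurableT_comp (measurable_tnth j)).
by apply/funext => p /=; rewrite tnth_mktuple.
Qed.

Lemma sum_indicator_ord n (i : 'I_n) : \sum_(j < n) ((j == i)%:R : R) = 1.
Proof.
by rewrite (bigD1 i)//= eqxx big1 ?addr0// => j /negbTE ->.
Qed.

Lemma sum_tuple_mix n t (i : 'I_n.+1) (z : n.+1.-tuple R) :
  \sum_j tnth (tuple_mix t i z) j = (1 - t) * \sum_j tnth z j + t.
Proof.
under eq_bigr do rewrite tnth_mktuple.
by rewrite big_split/= -!mulr_sumr sum_indicator_ord mulr1.
Qed.

(** Mixing preserves the total 1, so it is determined by its action on the first n coordinates,
    which is affine with the single factor 1 - t. When i is the last index these coordinates are
    merely scaled. *)
Lemma tuple_mix_add_last_coord n t (i : 'I_n.+1) (y : n.-tuple R) :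
  tuple_mix t i (add_last_coord y) =
  add_last_coord
    [tuple (1 - t) * tnth y j + t * (lift ord_max j == i)%:R | j < n].
Proof.
have lifted j : tnth (tuple_mix t i (add_last_coord y)) (lift ord_max j) =
    (1 - t) * tnth y j + t * (lift ord_max j == i)%:R.
  by rewrite tnth_mktuple tnth_add_last_coord_lift.
apply: eq_from_tnth => k; case: (unliftP ord_max k) => [j|] ->.
  by rewrite lifted tnth_add_last_coord_lift tnth_mktuple.
rewrite tnth_add_last_coord_max; apply/eqP; rewrite eq_sym subr_eq; apply/eqP.
have sum1 : \sum_j tnth (tuple_mix t i (add_last_coord y)) j = 1.
  by rewrite sum_tuple_mix sum_add_last_coord mulr1 subrK.
rewrite -[LHS]sum1.
rewrite (bigD1_ord ord_max)//=; congr (_ + _).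
by apply: eq_bigr => j _; rewrite lifted tnth_mktuple.
Qed.

Definition ppower (a x : R) : R := (0 <= x)%R%:R * x `^ (a - 1).

Lemma ppower_ge0 a x : 0 <= ppower a x.
Proof. by rewrite mulr_ge0// powR_ge0. Qed.

Lemma measurable_ppower a : measurable_fun setT (ppower a).
Proof.
apply: measurable_funM; last exact: measurable_powR.
rewrite (_ : (fun _ => _) = \1_`[0%R, +oo[%classic).
  exact: measurable_indic.
by apply/funext => x; rewrite indicE mem_setE in_itv/= andbT.
Qed.

Lemma ppowerM a c x : 0 < c -> ppower a (c * x) = c `^ (a - 1) * ppower a x.
Proof.
move=> c0; rewrite /ppower pmulr_rge0//.
have [x0|x0] := leP 0 x; last by rewrite !mul0r mulr0.
by rewrite !mul1r powRM// ltW.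
Qed.

Lemma mul_ppower a x : 0 < a -> x * ppower a x = (0 <= x)%R%:R * x `^ a.
Proof.
move=> a0; rewrite /ppower; have [x0|x0] := leP 0 x; last by rewrite !mul0r mulr0.
by rewrite !mul1r mulr_powRB1.
Qed.

(** The unnormalised Dirichlet density. It vanishes as soon as one coordinate is negative, so that
    integrals over the simplex become integrals over all of R^n. *)
Definition dirichlet_weight n (a : 'I_n -> R) (z : n.-tuple R) : R :=
  \prod_i ppower (a i) (tnth z i).

Lemma dirichlet_weight_ge0 n (a : 'I_n -> R) z : 0 <= dirichlet_weight a z.
Proof. by apply: prodr_ge0 => i _; exact: ppower_ge0. Qed.

Lemma measurable_dirichlet_weight n (a : 'I_n -> R) :
  measurable_fun setT (dirichlet_weight a).
Proof.
apply: measurable_prod => i _.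
exact: (measurableT_comp (measurable_ppower _) (measurable_tnth i)).
Qed.

Lemma prod_powR n (c : R) (e : 'I_n -> R) : 0 < c ->
  \prod_i c `^ e i = c `^ (\sum_i e i).
Proof.
move=> c0; rewrite /powR gt_eqF// mulr_suml expR_sum.
by apply: eq_bigr => i _.
Qed.

(** There are n + 1 exponents a_i - 1 but only n free coordinates, whence the Jacobian c^n and the
    total exponent n + \sum_i (a_i - 1) = \sum_i a_i - 1. With c = 1 - t this is the source of the
    power of 1 - t in the Mecke equation. *)
Lemma dirichlet_weightM n (a : 'I_n.+1 -> R) c (z : n.+1.-tuple R) : 0 < c ->
  c ^+ n * dirichlet_weight a [tuple c * tnth z i | i < n.+1] =
  c `^ (\sum_i a i - 1) * dirichlet_weight a z.
Proof.
move=> c0; rewrite /dirichlet_weight.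
under eq_bigr do rewrite tnth_mktuple ppowerM//.
rewrite big_split/= prod_powR// mulrA -powR_mulrn ?ltW//.
rewrite -powRD; last by rewrite (gt_eqF c0) implybT.
congr (_ `^ _ * _); rewrite sumrB sumr_const card_ord -natr1; ring.
Qed.

End simplex_mix.

(** * The Mecke identity for unnormalised Dirichlet integrals *)

Section dirichlet_mecke.
Context (R : realType).
Local Notation RT := (measurableTypeR R).
Local Notation leb := (@lebesgue_measure R).
Local Open Scope ereal_scope.

Definition dirichlet_integral n (a : 'I_n.+1 -> R)
    (f : n.+1.-tuple R -> \bar R) : \bar R :=
  \int[lebesgue_tuple R n]_y
    ((dirichlet_weight a (add_last_coord y))%:E * f (add_last_coord y)).

(** For z = (1 - t) y + t e_i the shifted point z - t e_i is (1 - t) y. Not dividing by 1 - t leaves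
    a dependence on t in the coordinate i alone, so that the integral over t is one-dimensional. *)
Let shifted_weight n (a : 'I_n.+1 -> R) (i : 'I_n.+1) (t : R)
    (z : n.+1.-tuple R) : R :=
  (\prod_j ppower (a j) (tnth z j - t * (j == i)%:R))%R.

Let shifted_weight_ge0 n (a : 'I_n.+1 -> R) i t z :
  (0 <= shifted_weight a i t z)%R.
Proof. by apply: prodr_ge0 => j _; exact: ppower_ge0. Qed.

Let measurable_shifted_weight n (a : 'I_n.+1 -> R) i :
  measurable_fun setT
    (fun p : RT * n.+1.-tuple R => shifted_weight a i p.1 p.2).
Proof.
apply: measurable_prod => j _; apply: (measurableT_comp (measurable_ppower _)).
apply: measurable_funB; last exact: measurable_funM.
exact: (measurableT_comp (measurable_tnth j) measurable_snd).
Qed.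

Let shifted_weightE n (a : 'I_n.+1 -> R) i t z : (t < 1)%R ->
  ((1 - t) ^+ n * shifted_weight a i t (tuple_mix t i z) =
   (1 - t) `^ (\sum_j a j - 1) * dirichlet_weight a z)%R.
Proof.
move=> t1; rewrite -dirichlet_weightM ?subr_gt0//; congr (_ * _)%R.
by apply: eq_bigr => j _; rewrite !tnth_mktuple addrK.
Qed.

(** The Jacobian (1 - t)^n of the substitution combines with the homogeneity of the weight, by
    [shifted_weightE]. At t = 1 the map is constant, which is why t < 1. *)
Let integral_tuple_mix n (a : 'I_n.+1 -> R) i t
    (f : n.+1.-tuple R -> \bar R) : (t < 1)%R ->
  measurable_fun setT f -> (forall z, 0 <= f z) ->
  ((1 - t) `^ (\sum_j a j - 1))%:E * dirichlet_integral a (f \o tuple_mix t i)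
  = \int[lebesgue_tuple R n]_y
     ((shifted_weight a i t (add_last_coord y))%:E * f (add_last_coord y)).
Proof.
move=> t1 mf f0; have t1' : (0 < 1 - t)%R by rewrite subr_gt0.
have mz := @measurable_add_last_coord R n.
have mmix : measurable_fun setT (tuple_mix t i : n.+1.-tuple R -> n.+1.-tuple R).
  exact: (measurable_fun_pair2 t (measurable_tuple_mix i)).
have ms : measurable_fun setT (shifted_weight a i t).
  exact: (measurable_fun_pair2 (t : RT) (measurable_shifted_weight a i)).
pose g (z : n.+1.-tuple R) := (shifted_weight a i t z)%:E * f z.
have g0 z : 0 <= g z by rewrite mule_ge0// lee_fin.
have mg : measurable_fun setT g.
  by apply: emeasurable_funM => //; exact/measurable_EFinP.
have := @ge0_integral_lebesgue_tuple_affine R n (1 - t)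
  (fun j => t * (lift ord_max j == i)%:R)%R (g \o @add_last_coord R n) t1'
  (measurableT_comp mg mz) (fun y => g0 _).
rewrite /= => ->; rewrite /dirichlet_integral.
under [in RHS]eq_integral do rewrite -tuple_mix_add_last_coord.
rewrite -ge0_integralZl//; last 2 first.
- exact: (measurableT_comp mg (measurableT_comp mmix mz)).
- by rewrite lee_fin exprn_ge0// ltW.
rewrite -ge0_integralZl; last 4 first.
- exact: measurableT.
- apply: emeasurable_funM.
    apply/measurable_EFinP.
    exact: (measurableT_comp (measurable_dirichlet_weight a) mz).
  exact: (measurableT_comp mf (measurableT_comp mmix mz)).
- by move=> y _; apply: mule_ge0; [rewrite lee_fin; exact: dirichlet_weight_ge0|exact: f0].
- by rewrite lee_fin; exact: powR_ge0.
apply: eq_integral => y _; rewrite /g /= !muleA -!EFinM.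
by rewrite shifted_weightE.
Qed.

(** [ppower] cuts the integrand off at t = u, and u <= 1 keeps all of [0, u] inside the range of
    integration. For u < 0 both sides vanish. *)
Let integral_ppower_onem (a u : R) : (0 < a)%R -> (u <= 1)%R ->
  a%:E * \int[leb]_(t in `[0%R, 1%R]) (ppower a (u - t))%:E =
  (u * ppower a u)%:E.
Proof.
move=> a0 u1; rewrite mul_ppower//.
have [u0|u0] := leP 0%R u; last first.
  rewrite mul0r integral0_eq ?mule0// => t; rewrite /= in_itv/= => /andP[t0 _].
  by rewrite /ppower leNgt (_ : (u - t < 0)%R) ?mul0r//; lra.
transitivity (a%:E * (u `^ a / a)%:E); last first.
  by rewrite -EFinM mul1r mulrC divfK// gt_eqF.
congr (_ * _); rewrite -integral_powR_onem// integral_mkcond.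
rewrite [RHS]integral_mkcond; apply: eq_integral => t _; rewrite !patchE.
rewrite !mem_setE !in_itv/= /ppower subr_ge0.
have [t0|] := leP 0%R t; last by [].
have [tu|tu] := leP t u; rewrite /=.
  by rewrite (le_trans tu u1) mul1r.
by rewrite mul0r if_same.
Qed.

Lemma dirichlet_integral_mecke n (a : 'I_n.+1 -> R) i
    (f : n.+1.-tuple R -> \bar R) : (forall j, 0 < a j)%R ->
  measurable_fun setT f -> (forall z, 0 <= f z) ->
  (a i)%:E * \int[leb]_(t in `[0%R, 1%R])
     (((1 - t) `^ (\sum_j a j - 1))%:E *
      dirichlet_integral a (f \o tuple_mix t i)) =
  dirichlet_integral a (fun z => (tnth z i)%:E * f z).
Proof.
move=> a0 mf f0.
have mz := @measurable_add_last_coord R n.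
pose K (t : RT) (y : n.-tuple RT) : \bar R :=
  (\1_`[0%R, 1%R] t * shifted_weight a i t (add_last_coord y))%:E *
  f (add_last_coord y).
have K0 t y : 0 <= K t y by rewrite mule_ge0// lee_fin mulr_ge0.
have mpair : measurable_fun setT
    (fun p : RT * n.-tuple RT => (p.1, add_last_coord p.2)).
  apply: measurable_fun_pair; first exact: measurable_fst.
  exact: (measurableT_comp mz measurable_snd).
have mK : measurable_fun setT (fun p : RT * n.-tuple RT => K p.1 p.2).
  apply: emeasurable_funM.
    apply/measurable_EFinP; apply: measurable_funM.
      by apply: measurableT_comp => //; exact: measurable_indic.
    exact: (measurableT_comp (measurable_shifted_weight a i) mpair).
  exact: (measurableT_comp mf (measurableT_comp mz measurable_snd)).
transitivity ((a i)%:E * \int[leb]_t \int[lebesgue_tuple R n]_y K t y).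
  congr (_ * _).
  have mK1 : measurable_fun setT (fun t => \int[lebesgue_tuple R n]_y K t y).
    exact: measurable_fun_integral2.
  (* The endpoint t = 1, where [integral_tuple_mix] does not apply, is null and is removed from both
     integrals. *)
  transitivity (\int[leb]_(t in `[0%R, 1%R[) \int[lebesgue_tuple R n]_y K t y); last first.
    rewrite integral_itv_bndo_bndc; last exact: measurable_funTS.
    rewrite integral_mkcond; apply: eq_integral => t _.
    rewrite patchE; case: ifPn => // t01; apply/esym/integral0_eq => y _.
    by rewrite /K indicE (negbTE t01) mul0r mul0e.
  rewrite -integral_itv_bndo_bndc; last first.
    apply: (eq_measurable_fun (fun t => \int[lebesgue_tuple R n]_y K t y)).
      move=> t; rewrite inE/= in_itv/= => /andP[t0 t1].
      rewrite integral_tuple_mix//; apply: eq_integral => y _.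
      by rewrite /K indicE mem_set ?mul1r//= in_itv/= t0 ltW.
    exact: measurable_funTS.
  apply: eq_integral => t; rewrite inE/= in_itv/= => /andP[t0 t1].
  rewrite integral_tuple_mix//; apply: eq_integral => y _.
  by rewrite /K indicE mem_set ?mul1r//= in_itv/= t0 ltW.
rewrite (fubini_tonelli (fun p => K p.1 p.2))//=.
have mK2 : measurable_fun setT (fun y => \int[leb]_t K t y).
  apply: measurable_fun_integral2 => //.
  exact: (measurableT_comp mK (measurable_fun_pair measurable_snd measurable_fst)).
rewrite -ge0_integralZl//; last 2 first.
- by move=> y _; exact: integral_ge0.
- by rewrite lee_fin ltW.
apply: eq_integral => y _; set z := add_last_coord y.
pose rest := (\prod_(j | j != i) ppower (a j) (tnth z j))%R.
have rest0 : (0 <= rest)%R by apply: prodr_ge0 => j _; exact: ppower_ge0.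
have KE t : K t y = (rest%:E * f z) *
    (\1_`[0%R, 1%R] t * ppower (a i) (tnth z i - t))%:E.
  rewrite /K -/z /shifted_weight (bigD1 i)//= eqxx mulr1 muleC mulrA mulrC EFinM.
  rewrite -muleA muleC -!muleA; congr (_ * _).
    congr EFin; apply: eq_bigr => j /negbTE ->.
    by rewrite mulr0 subr0.
  by rewrite muleC.
under eq_integral do rewrite KE.
have mp : measurable_fun setT (fun t : RT => ppower (a i) (tnth z i - t)).
  apply: (measurableT_comp (measurable_ppower _)).
  exact: measurable_funB.
rewrite ge0_integralZl//; last 3 first.
- by apply/measurable_EFinP; apply: measurable_funM.
- by move=> t _; rewrite lee_fin mulr_ge0// ppower_ge0.
- by rewrite mule_ge0// lee_fin.
have -> : \int[leb]_t (\1_`[0%R, 1%R] t * ppower (a i) (tnth z i - t))%:E =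
    \int[leb]_(t in `[0%R, 1%R]) (ppower (a i) (tnth z i - t))%:E.
  rewrite [RHS]integral_mkcond; apply: eq_integral => t _.
  by rewrite patchE indicE; case: ifPn; rewrite ?mul1r ?mul0r.
rewrite muleCA.
(* If a coordinate other than i is negative, both sides are 0. Otherwise z_i <= 1, because the
   coordinates sum to 1; this is what [integral_ppower_onem] requires. *)
have [neg|pos] := pselect (exists j, (j != i) && (tnth z j < 0)%R).
  case: neg => j /andP[ji zj].
  have r0 : rest = 0%R.
    by rewrite /rest (bigD1 j)//= {1}/ppower leNgt zj !mul0r.
  have w0 : dirichlet_weight a z = 0%R.
    by rewrite /dirichlet_weight (bigD1 j)//= {1}/ppower leNgt zj !mul0r.
  by rewrite r0 w0 !mul0e.
have zpos j : j != i -> (0 <= tnth z j)%R.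
  by move=> ji; rewrite leNgt; apply/negP => zj; apply: pos; exists j; rewrite ji.
have zi1 : (tnth z i <= 1)%R.
  rewrite -(sum_add_last_coord y) (bigD1 i)//= lerDl.
  by apply: sumr_ge0 => j; exact: zpos.
rewrite integral_ppower_onem// /dirichlet_weight (bigD1 i)//= -/rest.
rewrite muleAC muleA -!EFinM; congr (_%:E * _); ring.
Qed.

End dirichlet_mecke.

Section dirichlet_mass.
Context (R : realType).
Local Notation RT := (measurableTypeR R).
Local Notation leb := (@lebesgue_measure R).
Local Open Scope ereal_scope.

Lemma gamma_densityE (a x : R) : (gamma_density a x = ppower a x * expR (- x))%R.
Proof. by rewrite /gamma_density mulrA. Qed.

Let measurable_prod_gamma n (a : 'I_n -> R) : measurable_fun setT
  (fun y : n.-tuple RT => \prod_i gamma_density (a i) (tnth y i))%R.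
Proof.
apply: measurable_prod => i _.
exact: (measurableT_comp (measurable_gamma_density _) (measurable_tnth i)).
Qed.

Let prod_gamma_ge0 n (a : 'I_n -> R) (y : n.-tuple R) :
  (0 <= \prod_i gamma_density (a i) (tnth y i))%R.
Proof. by apply: prodr_ge0 => i _; exact: gamma_density_ge0. Qed.

Lemma integral_prod_gamma n (a : 'I_n -> R) : (forall i, 0 < a i)%R ->
  \int[lebesgue_tuple R n]_y (\prod_i gamma_density (a i) (tnth y i))%:E =
  (\prod_i Gamma (a i))%:E.
Proof.
elim: n => [|n ih] in a * => a0.
  rewrite ge0_integral_lebesgue_tuple0; last first.
    by apply/measurable_EFinP; exact: measurable_prod_gamma.
  by rewrite !big_ord0.
rewrite ge0_integral_lebesgue_tupleS; last 2 first.
- by apply/measurable_EFinP; exact: measurable_prod_gamma.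
- by move=> y; rewrite lee_fin.
transitivity (\int[leb]_x ((gamma_density (a ord0) x)%:E *
    (\prod_i Gamma (a (lift ord0 i)))%:E)); last first.
  rewrite ge0_integralZr//; last 3 first.
  - by apply/measurable_EFinP; exact: measurable_gamma_density.
  - by move=> x _; rewrite lee_fin gamma_density_ge0.
  - by rewrite lee_fin prodr_ge0// => i _; rewrite ltW// Gamma_gt0.
  by rewrite integral_gamma_density// -EFinM big_ord_recl.
apply: eq_integral => x _.
rewrite -(ih (fun i => a (lift ord0 i)))// -ge0_integralZl; last 4 first.
- exact: measurableT.
- by apply/measurable_EFinP; exact: measurable_prod_gamma.
- by move=> y _; rewrite lee_fin.
- by rewrite lee_fin gamma_density_ge0.
apply: eq_integral => y _; rewrite -EFinM big_ord_recl tnth0.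
by congr (_ * _)%:E; apply: eq_bigr => i _; rewrite tnthS.
Qed.

(* Gamma variables with parameters a_i have mass \prod_i Gamma (a i), computed
   by integrating first over the simplex of given total s. *)
Lemma dirichlet_integral_cst1 n (a : 'I_n.+1 -> R) : (forall i, 0 < a i)%R ->
  (Gamma (\sum_i a i))%:E * dirichlet_integral a (cst 1) =
  (\prod_i Gamma (a i))%:E.
Proof.
move=> a0; set b := (\sum_i a i)%R.
have b0 : (0 < b)%R.
  rewrite /b (bigD1 ord0)//= ltr_wpDr// sumr_ge0// => i _.
  exact: ltW.
have mz := @measurable_add_last_coord R n.
have mw := measurable_dirichlet_weight a.
pose I := dirichlet_integral a (cst 1).
have I0 : 0 <= I.
  by apply: integral_ge0 => y _; rewrite mule1 lee_fin dirichlet_weight_ge0.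
pose q (y : n.-tuple RT) : R :=
  (\prod_(j < n) gamma_density (a (lift ord_max j)) (tnth y j))%R.
have q0 y : (0 <= q y)%R by exact: prod_gamma_ge0.
have mq : measurable_fun setT q by exact: measurable_prod_gamma.
pose S (y : n.-tuple RT) : R := (\sum_(j < n) tnth y j)%R.
have mS : measurable_fun setT S.
  by apply: measurable_sum => j; exact: measurable_tnth.
(* Up to normalisation, the joint density of the total s and the first n of n + 1 independent gamma
   variables; the last variable is s - S y. *)
pose h (s : RT) (y : n.-tuple RT) : \bar R :=
  (q y * gamma_density (a ord_max) (s - S y))%:E.
have h0 s y : 0 <= h s y by rewrite lee_fin mulr_ge0// gamma_density_ge0.
have mh : measurable_fun setT (fun p : RT * n.-tuple RT => h p.1 p.2).
  apply/measurable_EFinP; apply: measurable_funM.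
    exact: (measurableT_comp mq measurable_snd).
  apply: (measurableT_comp (measurable_gamma_density _)).
  apply: measurable_funB; first exact: measurable_fst.
  exact: (measurableT_comp mS measurable_snd).
pose H (s : RT) := \int[lebesgue_tuple R n]_y h s y.
have mH : measurable_fun setT H by exact: measurable_fun_integral2.
transitivity (\int[leb]_s H s); last first.
  rewrite /H (fubini_tonelli (fun p => h p.1 p.2))//=.
  transitivity (\int[lebesgue_tuple R n]_y ((q y)%:E * (Gamma (a ord_max))%:E)).
    apply: eq_integral => y _; rewrite -integral_gamma_density//.
    have mg : measurable_fun setT (fun x : RT => (gamma_density (a ord_max) x)%:E).
      by apply/measurable_EFinP; exact: measurable_gamma_density.
    have maff : measurable_fun setT (fun s : RT => 1 * s + - S y : RT)%R.
      by apply: measurable_funD => //; exact: measurable_funM.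
    rewrite (@ge0_integral_affine R 1 (- S y)%R _ _ mg); last 2 first.
    - exact: ltr01.
    - by move=> x; rewrite lee_fin gamma_density_ge0.
    rewrite mul1e -ge0_integralZl; last 4 first.
    - exact: measurableT.
    - exact: (measurableT_comp mg maff).
    - by move=> x _; rewrite lee_fin gamma_density_ge0.
    - by rewrite lee_fin.
    by apply: eq_integral => s _; rewrite /h EFinM mul1r.
  rewrite ge0_integralZr//; last 3 first.
  - exact/measurable_EFinP.
  - by move=> y _; rewrite lee_fin.
  - by rewrite lee_fin ltW// Gamma_gt0.
  by rewrite integral_prod_gamma// -EFinM (bigD1_ord ord_max)//= mulrC.
have Hneg s : (s < 0)%R -> H s = 0.
  move=> s0; apply: integral0_eq => y _; rewrite /h.
  have [[j yj]|pos] := pselect (exists j, (tnth y j < 0)%R).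
    rewrite /q (bigD1 j)//= {1}/gamma_density leNgt yj.
    by rewrite !mul0r.
  rewrite {1}/gamma_density leNgt (_ : (s - S y < 0)%R) ?mul0r ?mulr0//.
  rewrite subr_lt0 (lt_le_trans s0)//; apply: sumr_ge0 => j _.
  by rewrite leNgt; apply/negP => yj; apply: pos; exists j.
(* Replacing y by s y splits off the total: the powers of s collect to s^(b - 1) by
   [dirichlet_weightM], and the exponentials multiply to exp(- s). *)
have Hpos s : (0 < s)%R -> H s = (gamma_density b s)%:E * I.
  move=> s0; rewrite /H.
  rewrite (@ge0_integral_lebesgue_tuple_affine R n s (fun=> 0%R) (h s))//; last first.
    exact: (measurable_fun_pair2 s mh).
  rewrite /I /dirichlet_integral -ge0_integralZl; last 4 first.
  - exact: measurableT.
  - exact: (measurableT_comp (measurable_fun_pair2 s mh)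
      (measurable_tuple_affine s (fun=> 0%R))).
  - by move=> y _; exact: h0.
  - by rewrite lee_fin exprn_ge0// ltW.
  rewrite -ge0_integralZl; last 4 first.
  - exact: measurableT.
  - under eq_fun do rewrite mule1.
    by apply/measurable_EFinP; exact: (measurableT_comp mw mz).
  - by move=> y _; rewrite mule1 lee_fin dirichlet_weight_ge0.
  - by rewrite lee_fin gamma_density_ge0.
  apply: eq_integral => y _; rewrite mule1 -!EFinM; congr EFin.
  set z := add_last_coord y.
  have -> : (gamma_density b s = s `^ (b - 1) * expR (- s))%R.
    by rewrite /gamma_density ltW// mul1r.
  rewrite mulrAC -dirichlet_weightM// -mulrA; congr (_ * _)%R.
  pose w := (\prod_(j < n) ppower (a (lift ord_max j)) (s * tnth y j))%R.
  have qE : q [tuple (s * tnth y i + 0)%R | i < n] = (w * expR (- (s * S y)))%R.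
    rewrite /S mulr_sumr -sumrN expR_sum /w -big_split/=.
    by apply: eq_bigr => j _; rewrite tnth_mktuple addr0 gamma_densityE.
  have SE : (s - S [tuple (s * tnth y i + 0)%R | i < n] = s * (1 - S y))%R.
    rewrite /S mulrBr mulr1 mulr_sumr; congr (_ - _)%R.
    by apply: eq_bigr => j _; rewrite tnth_mktuple addr0.
  rewrite qE SE gamma_densityE /dirichlet_weight (bigD1_ord ord_max)//=.
  rewrite tnth_mktuple tnth_add_last_coord_max -/(S y).
  under [in RHS]eq_bigr do rewrite tnth_mktuple tnth_add_last_coord_lift.
  rewrite -/w (_ : - s = - (s * S y) + - (s * (1 - S y)))%R; last by ring.
  by rewrite expRD; ring.
transitivity (\int[leb]_(s in `]0%R, +oo[) ((gamma_density b s)%:E * I)).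
  rewrite -integral_gamma_density// -ge0_integralZr//; last 2 first.
  - by apply/measurable_EFinP; exact: measurable_gamma_density.
  - by move=> s _; rewrite lee_fin gamma_density_ge0.
  rewrite integral_itv_obnd_cbnd; last first.
    apply: measurable_funTS; apply: emeasurable_funM => //.
    by apply/measurable_EFinP; exact: measurable_gamma_density.
  rewrite [RHS]integral_mkcond; apply: eq_integral => s _.
  rewrite patchE mem_setE in_itv/= andbT; case: ifPn => //.
  by rewrite /gamma_density => /negbTE ->; rewrite mul0r mul0e.
transitivity (\int[leb]_(s in `]0%R, +oo[) H s).
  apply: eq_integral => s; rewrite inE/= in_itv/= andbT => s0.
  by rewrite Hpos.
rewrite integral_itv_obnd_cbnd; last exact: measurable_funTS.
rewrite integral_mkcond; apply: eq_integral => s _.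
rewrite patchE mem_setE in_itv/= andbT; case: ifPn => //.
by rewrite -ltNge => s0; rewrite Hneg.
Qed.

End dirichlet_mass.

Section dirichlet_law.
Context (R : realType).
Local Notation RT := (measurableTypeR R).
Local Notation leb := (@lebesgue_measure R).
Local Open Scope ereal_scope.

Lemma multi_beta_gt0 n (a : 'I_n.+1 -> R) : (forall i, 0 < a i)%R ->
  (0 < multi_beta a)%R.
Proof.
move=> a0; rewrite divr_gt0 ?prodr_gt0// => [i _|]; first exact: Gamma_gt0.
by apply: Gamma_gt0; rewrite (bigD1 ord0)//= ltr_wpDr// sumr_ge0// => i _;
  exact: ltW.
Qed.

(** The coordinates of [add_last_coord y] always sum to 1, so off the simplex one of them is
    negative and the weight is 0. *)
Lemma dirichletE n (a : 'I_n.+1 -> R) (A : set (n.+1.-tuple R)) :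
  dirichlet a A = \int[lebesgue_tuple R n]_y
    (((multi_beta a)^-1 * dirichlet_weight a (add_last_coord y))%:E *
     (\1_A (add_last_coord y))%:E).
Proof.
rewrite /dirichlet integral_mkcond; apply: eq_integral => y _.
rewrite patchE; set z := add_last_coord y.
case: ifPn => [|]; rewrite ?inE ?notin_setE /= => zA.
  case: zA => -[z0 _] Az; rewrite indicE mem_set// mule1 /dirichlet_density.
  congr (_ * _)%:E; apply: eq_bigr => i _.
  by rewrite /ppower z0 mul1r.
have [Az|] := pselect (A z); last by move=> Az; rewrite indicE memNset// mule0.
have [j zj] : exists j, (tnth z j < 0)%R.
  apply: contrapT => H; apply: zA; split => //; split => [i|].
    by rewrite leNgt; apply/negP => zi; apply: H; exists i.
  exact: sum_add_last_coord.
by rewrite /dirichlet_weight (bigD1 j)//= /ppower leNgt zj !mul0r mulr0 mul0e.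
Qed.

Let measurable_density n (a : 'I_n.+1 -> R) : measurable_fun setT
  (fun y : n.-tuple RT =>
    (multi_beta a)^-1 * dirichlet_weight a (add_last_coord y))%R.
Proof.
apply: measurable_funM => //; apply: (measurableT_comp
  (measurable_dirichlet_weight a) (@measurable_add_last_coord R n)).
Qed.

Let density_ge0 n (a : 'I_n.+1 -> R) y : (forall i, 0 < a i)%R ->
  (0 <= (multi_beta a)^-1 * dirichlet_weight a (add_last_coord y))%R.
Proof.
move=> a0; rewrite mulr_ge0 ?dirichlet_weight_ge0// invr_ge0 ltW//.
exact: multi_beta_gt0.
Qed.

Lemma dirichlet_measure n (a : 'I_n.+1 -> R) : (forall i, 0 < a i)%R ->
  exists m : {measure set (n.+1.-tuple R) -> \bar R},
    forall A, measurable A -> m A = dirichlet a A.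
Proof.
move=> a0.
have [m mE] := weighted_image_measure (lebesgue_tuple R n)
  (@measurable_add_last_coord R n) (measurable_density a) (fun y => density_ge0 y a0).
exists m => A mA; rewrite dirichletE -[LHS]mul1e.
rewrite -(mE (EFin \o \1_A)).
- by rewrite integral_indic// setIT mul1e.
- exact/measurable_EFinP.
- by move=> z; rewrite lee_fin.
Qed.

Lemma integral_dirichlet n (a : 'I_n.+1 -> R)
    (m : {measure set (n.+1.-tuple R) -> \bar R})
    (f : n.+1.-tuple R -> \bar R) : (forall i, 0 < a i)%R ->
  (forall A, measurable A -> m A = dirichlet a A) ->
  measurable_fun setT f -> (forall z, 0 <= f z) ->
  \int[m]_z f z = (multi_beta a)^-1%:E * dirichlet_integral a f.
Proof.
move=> a0 mA mf f0.
rewrite (ge0_integral_density (mu := lebesgue_tuple R n) (@measurable_add_last_coord R n)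
  (measurable_density a) (fun y => density_ge0 y a0) _ mf f0); last first.
  by move=> A mA'; rewrite mA// dirichletE.
rewrite /dirichlet_integral -ge0_integralZl; last 4 first.
- exact: measurableT.
- apply: emeasurable_funM.
    apply/measurable_EFinP.
    exact: (measurableT_comp (measurable_dirichlet_weight a)
      (@measurable_add_last_coord R n)).
  exact: (measurableT_comp mf (@measurable_add_last_coord R n)).
- by move=> y _; apply: mule_ge0; [rewrite lee_fin; exact: dirichlet_weight_ge0|exact: f0].
- by rewrite lee_fin invr_ge0 ltW// multi_beta_gt0.
by apply: eq_integral => y _; rewrite EFinM muleA.
Qed.

Lemma dirichlet_setT n (a : 'I_n.+1 -> R) : (forall i, 0 < a i)%R ->
  dirichlet a setT = 1.
Proof.
move=> a0; have [m mA] := dirichlet_measure a0.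
rewrite -mA// -[LHS]mul1e -integral_cst// (integral_dirichlet a0 mA)//.
have := dirichlet_integral_cst1 a0.
have Gs : (0 < Gamma (\sum_i a i))%R.
  by apply: Gamma_gt0; rewrite (bigD1 ord0)//= ltr_wpDr// sumr_ge0// => i _;
    exact: ltW.
have Gp : (0 < \prod_i Gamma (a i))%R.
  by apply: prodr_gt0 => i _; exact: Gamma_gt0.
(* An infinite value would stay infinite after multiplication by the positive number
   [Gamma (\sum_i a i)], against [dirichlet_integral_cst1]. *)
case: (dirichlet_integral a (cst 1)) => [r| |].
- rewrite -!EFinM => -[E]; congr EFin; rewrite /multi_beta -E.
  have r0 : (r != 0)%R by apply: contraTneq Gp => r0; rewrite -E r0 mulr0 ltxx.
  by field; rewrite r0 gt_eqF.
- by rewrite gt0_muley ?lte_fin.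
- by rewrite gt0_muleNy ?lte_fin.
Qed.

(* The absolute value makes the integrand non-negative off the simplex. *)
Lemma dirichlet_mecke n (a : 'I_n.+1 -> R)
    (m : {measure set (n.+1.-tuple R) -> \bar R}) (i : 'I_n.+1)
    (f : n.+1.-tuple R -> \bar R) : (forall j, 0 < a j)%R ->
  (forall A, measurable A -> m A = dirichlet a A) ->
  measurable_fun setT f -> (forall z, 0 <= f z) ->
  \int[m]_z (`|tnth z i|%:E * f z) =
  (a i)%:E * \int[leb]_(t in `[0%R, 1%R])
    ((\int[m]_z f (tuple_mix t i z)) * ((1 - t) `^ (\sum_j a j - 1))%:E).
Proof.
move=> a0 mA mf f0.
have mn : measurable_fun setT (fun z : n.+1.-tuple R => `|tnth z i|%R).
  by apply: measurableT_comp => //; exact: measurable_tnth.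
rewrite (integral_dirichlet a0 mA); last 2 first.
- by apply: emeasurable_funM => //; exact/measurable_EFinP.
- by move=> z; rewrite mule_ge0// lee_fin.
transitivity ((multi_beta a)^-1%:E *
    dirichlet_integral a (fun z => (tnth z i)%:E * f z)).
  congr (_ * _); apply: eq_integral => y _.
  have [z0|z0] := leP 0%R (tnth (add_last_coord y) i); first by rewrite ger0_norm.
  by rewrite /dirichlet_weight (bigD1 i)//= /ppower leNgt z0 !mul0r !mul0e.
rewrite -dirichlet_integral_mecke// muleCA; congr (_ * _).
have mix0 t : measurable_fun setT (fun z => f (tuple_mix t i z)).
  exact: (measurableT_comp mf (measurable_fun_pair2 t (measurable_tuple_mix i))).
have mI : measurable_fun setT (fun t : RT => dirichlet_integral a (f \o tuple_mix t i)).
  apply: (@measurable_fun_integral2 _ _ _ _ _ (lebesgue_tuple R n) (fun (t : RT) y =>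
    ((dirichlet_weight a (add_last_coord y))%:E *
     (f \o tuple_mix t i) (add_last_coord y)))); last first.
    by move=> t y; apply: mule_ge0; [rewrite lee_fin; exact: dirichlet_weight_ge0|exact: f0].
  apply: emeasurable_funM.
    apply/measurable_EFinP; exact: (measurableT_comp
     (measurableT_comp (measurable_dirichlet_weight a)
      (@measurable_add_last_coord R n)) measurable_snd).
  have mp : measurable_fun setT
      (fun p : RT * n.-tuple RT => (p.1, add_last_coord p.2)).
    apply: measurable_fun_pair; first exact: measurable_fst.
    exact: (measurableT_comp (@measurable_add_last_coord R n) measurable_snd).
  exact: (measurableT_comp mf (measurableT_comp (measurable_tuple_mix i) mp)).
rewrite -ge0_integralZl; last 4 first.
- exact: measurable_itv.
- apply: measurable_funTS; apply: emeasurable_funM => //.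
  apply/measurable_EFinP; apply: (measurableT_comp (measurable_powR _)).
  exact: measurable_funB.
- move=> t _; apply: mule_ge0; first by rewrite lee_fin powR_ge0.
  by apply: integral_ge0 => y _; apply: mule_ge0;
    [rewrite lee_fin; exact: dirichlet_weight_ge0|exact: f0].
- by rewrite lee_fin invr_ge0 ltW// multi_beta_gt0.
apply: eq_integral => t _; rewrite (integral_dirichlet a0 mA)//.
by rewrite -muleA; congr (_ * _); rewrite muleC.
Qed.

End dirichlet_law.

(** * The stick-breaking equation *)

Section lipschitz_determining.
Context (R : realType).
Local Open Scope ereal_scope.

Definition l1_lipschitz n (L : R) (f : n.-tuple R -> R) :=
  forall y z, (`|f y - f z| <= L * \sum_i `|tnth y i - tnth z i|)%R.

Definition open_orthant n (b : 'I_n -> R) : set (n.-tuple R) :=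
  [set z | forall i, tnth z i < b i]%R.

Lemma open_orthantE n (b : 'I_n -> R) :
  open_orthant b = \bigcap_(i in setT) ((@tnth n R)^~ i @^-1` `]-oo, b i[).
Proof.
by apply/seteqP; split => z /= zb i; [move=> _|]; have := zb i; rewrite /= in_itv/=; [|exact].
Qed.

Lemma measurable_open_orthant n (b : 'I_n -> R) : measurable (open_orthant b).
Proof.
rewrite open_orthantE; apply: fin_bigcap_measurable => // i _.
by rewrite -[X in measurable X]setTI; exact: measurable_tnth.
Qed.

Lemma open_orthantI n (b c : 'I_n -> R) :
  open_orthant b `&` open_orthant c =
  open_orthant (fun i => Num.min (b i) (c i)).
Proof.
apply/seteqP; split => z /=.
  by move=> [zb zc] i; rewrite lt_min zb zc.
by move=> zbc; split => i; have := zbc i; rewrite lt_min => /andP[].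
Qed.

Lemma open_orthant_cover n :
  \bigcup_k open_orthant (fun=> k%:R : R) = [set: n.-tuple R].
Proof.
apply/seteqP; split => // z _.
have : \forall k \near \oo, forall i : 'I_n, (tnth z i < k%:R :> R)%R.
  apply: filter_forall => i; exact: nbhs_infty_gtr.
by move=> [k _ /(_ k (leqnn _)) zk]; exists k.
Qed.

(** A condition z_i < x on one coordinate is the union over k of the orthants with bound x at i and
    bound k elsewhere. *)
Lemma measurable_open_orthant_generated n :
  @measurable _ (n.-tuple R) `<=` <<s range (@open_orthant n) >>.
Proof.
pose G := range (@open_orthant n).
pose T := g_sigma_algebraType G.
have mid : measurable_fun setT (id : T -> n.-tuple R).
  apply/measurable_fun_tnthP => i.
  apply: (measurability _ (RGenInftyO.measurableE R)) => _ [_ [x ->] <-].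
  rewrite setTI.
  rewrite (_ : _ @^-1` _ = \bigcup_k
      open_orthant (fun j => if j == i then x else k%:R)).
    apply: bigcupT_measurable => k; apply: sub_sigma_algebra.
    by eexists; last reflexivity.
  apply/seteqP; split => [z|z [k _ zk]] /=; rewrite in_itv/=; last first.
    by have := zk i; rewrite eqxx.
  move=> zx; have [k _ zk] : (\bigcup_k open_orthant (fun=> k%:R : R)) z.
    by rewrite open_orthant_cover.
  by exists k => // j; case: eqP => [->//|_]; exact: zk.
by move=> A mA; have := mid measurableT A mA; rewrite setTI preimage_id.
Qed.

Let ramp (x : R) : R := (Num.min 1 (Num.max 0 x))%R.

Let rampE x : ramp x = (if x <= 0 then 0 else if 1 <= x then 1 else x)%R.
Proof.
rewrite /ramp; have [x0|x0] := leP x 0%R; first by rewrite min_r.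
by have [|] := leP 1%R x.
Qed.

Let ramp_itv x : (0 <= ramp x <= 1)%R.
Proof.
by rewrite rampE; have [|x0] := leP x 0%R; [|have [|] := leP 1%R x]; lra.
Qed.

Let ramp_lip x y : (`|ramp x - ramp y| <= `|x - y|)%R.
Proof.
rewrite ler_norml.
have /andP[] : (- `|x - y| <= x - y <= `|x - y|)%R by rewrite -ler_norml.
have := normr_ge0 (x - y)%R; move: `|x - y|%R => d; rewrite !rampE.
have [x0|x0] := leP x 0%R; [|have [x1|x1] := leP 1%R x];
  (have [y0|y0] := leP y 0%R; [|have [y1|y1] := leP 1%R y]); lra.
Qed.

Let ramp_le x y : (x <= y -> ramp x <= ramp y)%R.
Proof.
rewrite !rampE.
have [x0|x0] := leP x 0%R; [|have [x1|x1] := leP 1%R x];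
  (have [y0|y0] := leP y 0%R; [|have [y1|y1] := leP 1%R y]); lra.
Qed.

Let prod_lip n (p q : 'I_n -> R) :
  (forall i, 0 <= p i <= 1)%R -> (forall i, 0 <= q i <= 1)%R ->
  (`|\prod_i p i - \prod_i q i| <= \sum_i `|p i - q i|)%R.
Proof.
move=> p01 q01; elim: (index_enum _) => [|i s ih].
  by rewrite !big_nil subrr normr0.
rewrite !big_cons.
have P01 : (0 <= \prod_(j <- s) p j <= 1)%R.
  by rewrite prodr_ge0 ?prodr_ile1// => j _; have /andP[] := p01 j.
set P := (\prod_(j <- s) p j)%R in P01 ih *.
set Q := (\prod_(j <- s) q j)%R in ih *.
rewrite (_ : p i * P - q i * Q = (p i - q i) * P + q i * (P - Q))%R; last by ring.
apply: (le_trans (ler_normD _ _)); rewrite !normrM lerD//.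
  rewrite -[leRHS]mulr1 ler_wpM2l// ger0_norm; first by case/andP: P01.
  by case/andP: P01.
apply: le_trans ih; rewrite -[leRHS]mul1r ler_wpM2r// ger0_norm.
  by have /andP[] := q01 i.
by have /andP[] := q01 i.
Qed.

(** Lipschitz functions increasing to the indicator of the orthant: a factor is 0 whenever z_i >=
    b_i, and is 1 as soon as k (b_i - z_i) >= 1. *)
Let orthant_bump n (b : 'I_n -> R) (k : nat) (z : n.-tuple R) : R :=
  (\prod_i ramp (k%:R * (b i - tnth z i)))%R.

Let orthant_bump_ge0 n (b : 'I_n -> R) k z : (0 <= orthant_bump b k z)%R.
Proof. by apply: prodr_ge0 => i _; case/andP: (ramp_itv (k%:R * (b i - tnth z i))%R). Qed.

Let measurable_orthant_bump n (b : 'I_n -> R) k : measurable_fun setT (orthant_bump b k).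
Proof.
apply: measurable_prod => i _.
apply: measurable_minr; first exact: measurable_cst.
apply: measurable_maxr; first exact: measurable_cst.
apply: measurable_funM => //; apply: measurable_funB => //.
exact: measurable_tnth.
Qed.

Let orthant_bump_lip n (b : 'I_n -> R) k : l1_lipschitz k%:R (orthant_bump b k).
Proof.
move=> y z; apply: (le_trans (prod_lip (fun=> ramp_itv _) (fun=> ramp_itv _))).
rewrite mulr_sumr; apply: ler_sum => i _.
apply: le_trans (ramp_lip _ _) _.
rewrite -mulrBr normrM ger0_norm//; apply: ler_wpM2l => //.
rewrite (_ : b i - tnth y i - (b i - tnth z i) = - (tnth y i - tnth z i))%R.
  by rewrite normrN.
ring.
Qed.

Let orthant_bump_cvg n (b : 'I_n -> R) z :
  (orthant_bump b k z)%:E @[k --> \oo] --> (\1_(open_orthant b) z)%:E.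
Proof.
apply: cvg_near_cst; rewrite indicE.
have [zb|zb] := pselect (open_orthant b z).
  rewrite mem_set//.
  have : \forall k \near \oo, forall i : 'I_n, ((b i - tnth z i)^-1 <= k%:R :> R)%R.
    by apply: filter_forall => i; exact: nbhs_infty_ger.
  apply: filterS => k kb; rewrite /orthant_bump big1// => i _.
  have bz : (0 < b i - tnth z i)%R by rewrite subr_gt0.
  have := kb i; rewrite -(ler_pM2r bz) mulVf ?gt_eqF// => kbz.
  by rewrite /ramp max_r ?min_l//; lra.
rewrite memNset//; apply: nearW => k; congr EFin.
have [i zi] : exists i, (b i <= tnth z i)%R.
  apply: contrapT => H; apply: zb => i; rewrite ltNge; apply/negP => bi.
  by apply: H; exists i.
rewrite /orthant_bump (bigD1 i)//= (_ : ramp _ = 0%R) ?mul0r//.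
by rewrite /ramp max_l ?min_r// mulr_ge0_le0// subr_le0.
Qed.

(** Open orthants are a generating pi-system, and their indicators are increasing limits of
    non-negative Lipschitz functions. *)
Lemma lipschitz_determining n (m1 m2 : {measure set (n.-tuple R) -> \bar R}) :
  m1 setT < +oo ->
  (forall (L : R) (f : n.-tuple R -> R), (0 <= L)%R ->
    measurable_fun setT f -> (forall z, 0 <= f z)%R -> l1_lipschitz L f ->
    \int[m1]_z (f z)%:E = \int[m2]_z (f z)%:E) ->
  forall A, measurable A -> m1 A = m2 A.
Proof.
move=> m1oo m12 A mA.
apply: (g_sigma_algebra_measure_unique (range (@open_orthant n)) _
  (fun k => open_orthant (fun=> k%:R : R))).
- by move=> _ [b _ <-]; exact: measurable_open_orthant.
- by move=> k; eexists; last reflexivity.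
- exact: open_orthant_cover.
- move=> _ _ [b _ <-] [c _ <-]; rewrite open_orthantI.
  by eexists; last reflexivity.
- move=> _ [b _ <-].
  have intE (m : {measure set (n.-tuple R) -> \bar R}) :
      m (open_orthant b) = limn (fun k => \int[m]_z (orthant_bump b k z)%:E).
    rewrite -[open_orthant b]setIT -integral_indic//; last exact: measurable_open_orthant.
    rewrite -monotone_convergence//.
    + apply: eq_integral => z _; apply/esym/cvg_lim => //; exact: orthant_bump_cvg.
    + by move=> k; apply/measurable_EFinP; exact: measurable_orthant_bump.
    + by move=> k z _; rewrite lee_fin.
    + move=> z _ k l kl; rewrite lee_fin; apply: ler_prod => i _.
      have /andP[-> _] := ramp_itv (k%:R * (b i - tnth z i))%R.
      have [bz|bz] := leP 0%R (b i - tnth z i)%R.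
        by apply: ramp_le; rewrite ler_wpM2r// ler_nat.
      rewrite {1}/ramp max_l ?min_r//; first by case/andP: (ramp_itv (l%:R * (b i - tnth z i))%R).
      by rewrite mulr_ge0_le0// ltW.
  rewrite !intE; congr (limn _); apply/funext => k.
  by apply: (m12 k%:R) => //; exact: measurable_orthant_bump.
- move=> k; apply: le_lt_trans m1oo; apply: le_measure; rewrite ?inE//.
  exact: measurable_open_orthant.
- exact: measurable_open_orthant_generated.
Qed.

End lipschitz_determining.

Section stick_breaking.
Context (R : realType).
Local Notation RT := (measurableTypeR R).
Local Notation leb := (@lebesgue_measure R).
Local Open Scope ereal_scope.

(* If (V, i) is distributed as (Beta(1, b), a_i / b), where b = \sum_i a_i, and
   is independent of Z, with law m, this says that (1 - V) Z + V e_i has law m. *)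
Definition stick_breaking n (a : 'I_n.+1 -> R)
    (m : {measure set (n.+1.-tuple R) -> \bar R}) :=
  forall f : n.+1.-tuple R -> R, measurable_fun setT f -> (forall z, 0 <= f z)%R ->
  \int[m]_z (f z)%:E = \sum_i (a i)%:E * \int[leb]_(t in `[0%R, 1%R])
    ((\int[m]_z (f (tuple_mix t i z))%:E) * ((1 - t) `^ (\sum_j a j - 1))%:E).

Let dist_simplex n (y z : n.+1.-tuple R) : simplex y -> simplex z ->
  (\sum_i `|tnth y i - tnth z i| <= 2)%R.
Proof.
move=> [y0 y1] [z0 z1]; apply: (@le_trans _ _ (\sum_i (tnth y i + tnth z i))%R).
  apply: ler_sum => i _; apply: (le_trans (ler_normB _ _)).
  by rewrite !ger0_norm.
by rewrite big_split/= y1 z1; lra.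
Qed.

Let lipschitz_tuple_mix n (f : n.+1.-tuple R -> R) L t i : (0 <= t <= 1)%R ->
  l1_lipschitz L f -> l1_lipschitz ((1 - t) * L)%R (f \o tuple_mix t i).
Proof.
move=> /andP[t0 t1] fL y z /=; apply: (le_trans (fL _ _)).
rewrite -mulrA mulrCA le_eqVlt; apply/orP; left; apply/eqP; congr (_ * _)%R.
rewrite mulr_sumr; apply: eq_bigr => j _; rewrite !tnth_mktuple.
rewrite (_ : _ - _ = (1 - t) * (tnth y j - tnth z j))%R; last by ring.
by rewrite normrM ger0_norm// subr_ge0.
Qed.

(** Up to the factor b this is the mean of 1 - t under the beta (1, b) law. It gives the contraction
    ratio, and in the converse the factor by which E[eta B] is multiplied for a null set B. *)
Lemma integral_onem_mul (b : R) : (0 < b)%R ->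
  \int[leb]_(t in `[0%R, 1%R]) ((1 - t) * (1 - t) `^ (b - 1))%:E =
  (b + 1)^-1%:E.
Proof.
move=> b0; have b10 : (0 < b + 1)%R by rewrite addr_gt0.
have := integral_powR_onem b10 (@ler01 R); rewrite powR1 div1r => <-.
apply: eq_integral => t; rewrite inE/= in_itv/= => /andP[_ t1].
by rewrite mulr_powRB1 ?addrK// subr_ge0.
Qed.

Section comparison.
Context (n : nat) (a : 'I_n.+1 -> R) (a0 : forall i, (0 < a i)%R)
  (m1 m2 : {measure set (n.+1.-tuple R) -> \bar R})
  (m1T : m1 setT = 1) (m2T : m2 setT = 1)
  (m1simplex : {ae m1, forall z, simplex z})
  (m2simplex : {ae m2, forall z, simplex z})
  (m1E : stick_breaking a m1) (m2E : stick_breaking a m2).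

Let b : R := (\sum_i a i)%R.

Let b0 : (0 < b)%R.
Proof.
by rewrite /b (bigD1 ord0)//= ltr_wpDr// sumr_ge0// => i _; exact: ltW.
Qed.

(** One half of the dual description of an l1-Wasserstein distance at most M. A one-sided inequality
    avoids subtracting extended reals; the other half follows by exchanging [m1] and [m2]. *)
Let close (M : R) := forall (L : R) (f : n.+1.-tuple R -> R), (0 <= L)%R ->
  measurable_fun setT f -> (forall z, 0 <= f z)%R -> l1_lipschitz L f ->
  \int[m1]_z (f z)%:E <= \int[m2]_z (f z)%:E + (M * L)%:E.

Let integral_cstD (m : {measure set (n.+1.-tuple R) -> \bar R})
    (f : n.+1.-tuple R -> R) (c : R) : m setT = 1 -> (0 <= c)%R ->
  measurable_fun setT f -> (forall z, 0 <= f z)%R ->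
  \int[m]_z (f z + c)%:E = \int[m]_z (f z)%:E + c%:E.
Proof.
move=> mT c0 mf f0.
rewrite -[X in _ + X](_ : \int[m]_z (cst c%:E) z = c%:E); last first.
  by rewrite integral_cst// mT mule1.
by rewrite -ge0_integralD//; [move=> z _; rewrite lee_fin|exact/measurable_EFinP].
Qed.

(** Two points of the simplex have l1 distance at most 2, so f y <= f z + 2 L almost everywhere;
    integrate in z under [m2], then in y under [m1]. *)
Let close2 : close 2.
Proof.
move=> L f L0 mf f0 fL.
have bound y : simplex y -> (f y)%:E <= \int[m2]_z (f z)%:E + (2 * L)%:E.
  move=> ys; rewrite -integral_cstD// ?mulr_ge0//.
  have -> : (f y)%:E = \int[m2]_z (cst (f y)%:E) z by rewrite integral_cst// m2T mule1.
  apply: ae_ge0_le_integral => //.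
  - by move=> z _; rewrite lee_fin.
  - by move=> z _; rewrite lee_fin addr_ge0// mulr_ge0.
  - by apply/measurable_EFinP; exact: measurable_funD.
  apply: filterS m2simplex => z zs _; rewrite lee_fin.
  have := fL y z; rewrite ler_norml => /andP[_]; rewrite lerBlDl => /le_trans; apply.
  by rewrite lerD2l mulrC ler_wpM2r// dist_simplex.
rewrite -[leRHS]mule1 -m1T -integral_cst//.
apply: ae_ge0_le_integral => //.
- by move=> z _; rewrite lee_fin.
- exact/measurable_EFinP.
- move=> z _; apply: adde_ge0; first by apply: integral_ge0 => y _; rewrite lee_fin.
  by rewrite lee_fin mulr_ge0.
- by apply: filterS m1simplex => z zs _; exact: bound.
Qed.

(* The maps [tuple_mix t i] multiply Lipschitz constants by 1 - t, whose mean
   under the beta (1, b) law is b / (b + 1). *)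
Let close_contract (M : R) : (0 <= M)%R -> close M -> close (M * (b / (b + 1))).
Proof.
move=> M0 cM L f L0 mf f0 fL; rewrite m1E// m2E// -/b.
have mmix t i : measurable_fun setT (f \o tuple_mix t i).
  exact: (measurableT_comp mf (measurable_fun_pair2 t (measurable_tuple_mix i))).
have mI (m : {measure set (n.+1.-tuple R) -> \bar R}) i : m setT = 1 ->
    measurable_fun setT (fun t : RT => \int[m]_z (f (tuple_mix t i z))%:E).
  move=> mT; apply: measurable_fun_integral2_finite.
  - by rewrite mT ltry.
  - by apply/measurable_EFinP; exact: (measurableT_comp mf (measurable_tuple_mix i)).
  - by move=> t z; rewrite lee_fin.
have mw : measurable_fun setT (fun t : RT => ((1 - t) `^ (b - 1))%:E).
  apply/measurable_EFinP; apply: (measurableT_comp (measurable_powR _)).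
  exact: measurable_funB.
have I0 (m : {measure set (n.+1.-tuple R) -> \bar R}) i t :
    0 <= \int[m]_z (f (tuple_mix t i z))%:E.
  by apply: integral_ge0 => z _; rewrite lee_fin.
have step i : \int[leb]_(t in `[0%R, 1%R])
      ((\int[m1]_z (f (tuple_mix t i z))%:E) * ((1 - t) `^ (b - 1))%:E) <=
    \int[leb]_(t in `[0%R, 1%R])
      ((\int[m2]_z (f (tuple_mix t i z))%:E) * ((1 - t) `^ (b - 1))%:E) +
    (M * L * (b + 1)^-1)%:E.
  rewrite EFinM -integral_onem_mul// -ge0_integralZl//; last 3 first.
  - apply: measurable_funTS; apply/measurable_EFinP; apply: measurable_funM.
      exact: measurable_funB.
    exact/measurable_EFinP.
  - move=> t; rewrite /= in_itv/= => /andP[_ t1].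
    by rewrite lee_fin mulr_ge0 ?powR_ge0// subr_ge0.
  - by rewrite lee_fin mulr_ge0.
  rewrite -ge0_integralD//; last 4 first.
  - by move=> t _; rewrite mule_ge0// lee_fin powR_ge0.
  - by apply: measurable_funTS; apply: emeasurable_funM => //; exact: mI.
  - move=> t; rewrite /= in_itv/= => /andP[_ t1].
    by rewrite mule_ge0// lee_fin mulr_ge0 ?powR_ge0// subr_ge0.
  - apply: measurable_funTS; apply: measurable_funeM.
    apply/measurable_EFinP; apply: measurable_funM.
      exact: measurable_funB.
    exact/measurable_EFinP.
  apply: ge0_le_integral => //.
  - by move=> t _; rewrite mule_ge0// lee_fin powR_ge0.
  - by apply: measurable_funTS; apply: emeasurable_funM => //; exact: mI.
  - apply: measurable_funTS; apply: emeasurable_funD.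
      by apply: emeasurable_funM => //; exact: mI.
    apply: measurable_funeM; apply/measurable_EFinP; apply: measurable_funM.
      exact: measurable_funB.
    exact/measurable_EFinP.
  move=> t; rewrite /= in_itv/= => t01; have /andP[_ t1] := t01.
  have w0 : (0 <= (1 - t) `^ (b - 1))%R by exact: powR_ge0.
  have t0' : (0 <= 1 - t)%R by rewrite subr_ge0.
  apply: (@le_trans _ _ ((\int[m2]_z (f (tuple_mix t i z))%:E +
      (M * ((1 - t) * L))%:E) * ((1 - t) `^ (b - 1))%:E)).
    rewrite lee_wpmul2r ?lee_fin//.
    exact: (cM _ (f \o tuple_mix t i) (mulr_ge0 t0' L0) (mmix t i)
      (fun=> f0 _) (lipschitz_tuple_mix i t01 fL)).
  rewrite ge0_muleDl//; last by rewrite lee_fin !mulr_ge0.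
  rewrite leeD2l// -!EFinM lee_fin le_eqVlt; apply/orP; left; apply/eqP; ring.
apply: (@le_trans _ _ (\sum_i ((a i)%:E * (\int[leb]_(t in `[0%R, 1%R])
      ((\int[m2]_z (f (tuple_mix t i z))%:E) * ((1 - t) `^ (b - 1))%:E)) +
    (a i * (M * L * (b + 1)^-1))%:E))).
  apply: lee_sum => i _; rewrite EFinM -ge0_muleDr//; last 2 first.
  - by apply: integral_ge0 => t _; rewrite mule_ge0// lee_fin powR_ge0.
  - by rewrite lee_fin !mulr_ge0// invr_ge0 addr_ge0// ltW.
  by rewrite lee_wpmul2l// lee_fin ltW.
rewrite big_split/= leeD2l// sumEFin lee_fin -mulr_suml -/b.
by rewrite le_eqVlt; apply/orP; left; apply/eqP; ring.
Qed.

Let close_exp k : close (2 * (b / (b + 1)) ^+ k).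
Proof.
elim: k => [|k ih]; first by rewrite expr0 mulr1; exact: close2.
rewrite exprSr mulrA; apply: close_contract => //.
by rewrite mulr_ge0// exprn_ge0// divr_ge0// ?addr_ge0// ltW.
Qed.

Lemma stick_breaking_le (L : R) (f : n.+1.-tuple R -> R) : (0 <= L)%R ->
  measurable_fun setT f -> (forall z, 0 <= f z)%R -> l1_lipschitz L f ->
  \int[m1]_z (f z)%:E <= \int[m2]_z (f z)%:E.
Proof.
move=> L0 mf f0 fL; apply/lee_addgt0Pr => e e0.
have c1 : (`|b / (b + 1)| < 1)%R.
  rewrite ger0_norm; last by rewrite divr_ge0// ?addr_ge0// ltW.
  by rewrite ltr_pdivrMr ?addr_gt0// mul1r ltrDl.
have : (2 * (b / (b + 1)) ^+ k * L)%R @[k --> \oo] --> (0 : R)%R.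
  rewrite -(mul0r L) -(mulr0 2)%R; apply: cvgMl; apply: cvgMr; exact: cvg_expr.
move=> /cvgrPdist_lt/(_ e e0)[k _ /(_ k (leqnn _))].
rewrite sub0r normrN => ke; apply: le_trans (close_exp k L0 mf f0 fL) _.
by rewrite leeD2l// lee_fin (le_trans (ler_norm _))// ltW.
Qed.

End comparison.

Lemma stick_breaking_unique n (a : 'I_n.+1 -> R)
    (m1 m2 : {measure set (n.+1.-tuple R) -> \bar R}) :
  (forall i, 0 < a i)%R -> m1 setT = 1 -> m2 setT = 1 ->
  {ae m1, forall z, simplex z} -> {ae m2, forall z, simplex z} ->
  stick_breaking a m1 -> stick_breaking a m2 ->
  forall A, measurable A -> m1 A = m2 A.
Proof.
move=> a0 m1T m2T s1 s2 m1E m2E; apply: lipschitz_determining.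
  by rewrite m1T ltry.
move=> L f L0 mf f0 fL; apply/eqP; rewrite eq_le; apply/andP; split.
  exact: (stick_breaking_le a0 m1T m2T s1 s2 m1E m2E L0).
exact: (stick_breaking_le a0 m2T m1T s2 s1 m2E m1E L0).
Qed.

End stick_breaking.

Section dirichlet_stick_breaking.
Context (R : realType).
Local Open Scope ereal_scope.

Lemma measurable_simplex n : measurable (@simplex R n).
Proof.
have -> : @simplex R n =
    (\bigcap_(i in setT) ((@tnth n.+1 R)^~ i @^-1` `[0%R, +oo[)) `&`
    ((fun z : n.+1.-tuple R => \sum_i tnth z i)%R @^-1` [set 1%R]).
  apply/seteqP; split => z /= [z0 z1]; split => // i.
    by move=> _; rewrite /= in_itv/= z0.
  by have := z0 i I; rewrite /= ?in_itv/= ?andbT.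
apply: measurableI.
  apply: fin_bigcap_measurable => // i _.
  by rewrite -[X in measurable X]setTI; exact: measurable_tnth.
rewrite -[X in measurable X]setTI.
have msum : measurable_fun setT (fun z : n.+1.-tuple R => \sum_i tnth z i)%R.
  by apply: measurable_sum => i; exact: measurable_tnth.
by apply: msum => //; exact: measurable_set1.
Qed.

Lemma dirichlet_ae_simplex n (a : 'I_n.+1 -> R)
    (m : {measure set (n.+1.-tuple R) -> \bar R}) :
  (forall A, measurable A -> m A = dirichlet a A) ->
  {ae m, forall z, simplex z}.
Proof.
move=> mA; have mS := @measurable_simplex n.
exists (~` @simplex R n); split => //; first exact: measurableC.
rewrite mA; last exact: measurableC.
by rewrite /dirichlet setICr preimage_set0 integral_set0.
Qed.

(** Add the identities [dirichlet_mecke] over i and use \sum_i z_i = 1 on the simplex. *)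
Lemma dirichlet_stick_breaking n (a : 'I_n.+1 -> R)
    (m : {measure set (n.+1.-tuple R) -> \bar R}) : (forall i, 0 < a i)%R ->
  (forall A, measurable A -> m A = dirichlet a A) -> stick_breaking a m.
Proof.
move=> a0 mA f mf f0.
have mF : measurable_fun setT (fun z => (f z)%:E) by exact/measurable_EFinP.
under eq_bigr do rewrite -(dirichlet_mecke _ a0 mA mF f0).
have mn i : measurable_fun setT (fun z : n.+1.-tuple R => `|tnth z i|%:E * (f z)%:E).
  apply: emeasurable_funM => //; apply/measurable_EFinP.
  by apply: measurableT_comp => //; exact: measurable_tnth.
rewrite -ge0_integral_sum//; last by move=> i z _; rewrite mule_ge0// lee_fin.
apply: ge0_ae_eq_integral => //.
- by apply: emeasurable_sum.
- by move=> z _; rewrite lee_fin.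
- by move=> z _; apply: sume_ge0 => i _; rewrite mule_ge0// lee_fin.
apply: filterS (dirichlet_ae_simplex mA) => z [z0 z1] _.
under eq_bigr do rewrite -EFinM.
rewrite sumEFin -mulr_suml (eq_bigr (tnth z)) ?z1 ?mul1r// => i _.
by rewrite ger0_norm.
Qed.

End dirichlet_stick_breaking.

(** * Random measures *)

Section random_measure.
Context (d : measure_display) (X : measurableType d) (R : realType).
Local Open Scope ereal_scope.

Lemma measurable_measures_ev (B : set X) : measurable B ->
  measurable_fun setT (fun mu : measures X R => mu B).
Proof.
move=> mB _ A mA; rewrite setTI; apply: sub_sigma_algebra.
by exists B => //; exists A => //; rewrite setTI.
Qed.

Lemma measurable_fun_measures d' (T : measurableType d') (f : T -> measures X R) :
  (forall B, measurable B -> measurable_fun setT (fun t => f t B)) ->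
  measurable_fun setT f.
Proof.
move=> mf; apply: (@measurability _ _ _ (measures X R) setT f
  (\bigcup_(B in measurable)
     preimage_set_system [set: measures X R] (measures_ev B) measurable)) => //.
move=> _ [_ [B mB [A mA <-]] <-].
by rewrite !setTI -comp_preimage -[X in measurable X]setTI; exact: mf.
Qed.

Lemma measurable_prob_measures : measurable (@prob_measures d X R).
Proof.
rewrite -[X in measurable X]setTI.
by apply: (measurable_measures_ev measurableT measurableT (Y := [set 1%E]));
  exact: emeasurable_set1.
Qed.

Let mixture_maxE (t : R) (mu : measures X R) x B :
  mixture t mu x B =
  (Num.max 0 (1 - t))%:E * mu B + (Num.max 0 t)%:E * (\1_B x)%:E.
Proof. by rewrite [LHS]measure_addE. Qed.

Lemma mixtureE (t : R) (mu : measures X R) x B : (0 <= t <= 1)%R ->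
  mixture t mu x B = (1 - t)%:E * mu B + t%:E * (\1_B x)%:E.
Proof.
by move=> /andP[t0 t1]; rewrite mixture_maxE !max_r// subr_ge0.
Qed.

Lemma prob_mixture (t : R) (mu : measures X R) x : (0 <= t <= 1)%R ->
  prob_measures mu -> prob_measures (mixture t mu x).
Proof.
move=> t01 mu1; rewrite /prob_measures /= mixtureE// mu1 indicT.
by rewrite !mule1 -EFinD subrK.
Qed.

Lemma measurable_mixture dO (Omega : measurableType dO)
    (eta : Omega -> measures X R) : measurable_fun setT eta ->
  measurable_fun setT
    (fun p : X * R * Omega => mixture p.1.2 (eta p.2) p.1.1).
Proof.
move=> meta; apply: measurable_fun_measures => B mB.
have mt : measurable_fun setT (fun p : X * R * Omega => p.1.2).
  exact: (measurableT_comp measurable_snd measurable_fst).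
rewrite [X in measurable_fun _ X](_ : _ = fun p : X * R * Omega =>
    (Num.max 0 (1 - p.1.2))%:E * eta p.2 B +
    (Num.max 0 p.1.2)%:E * (\1_B p.1.1)%:E); last first.
  by apply/funext => p; exact: mixture_maxE.
apply: emeasurable_funD; apply: emeasurable_funM.
- apply/measurable_EFinP; apply: measurable_maxr; first exact: measurable_cst.
  exact: measurable_funB.
- exact: (measurableT_comp (measurableT_comp (measurable_measures_ev mB) meta)
    measurable_snd).
- by apply/measurable_EFinP; apply: measurable_maxr; first exact: measurable_cst.
- apply/measurable_EFinP; apply: (measurableT_comp (measurable_indic _)) => //.
  exact: (measurableT_comp measurable_fst measurable_fst).
Qed.

End random_measure.

Section prob_subkernel.
Context (d dO : measure_display) (X : measurableType d) (R : realType)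
  (Omega : measurableType dO) (eta : {mfun Omega >-> measures X R}).
Local Open Scope ereal_scope.

Let meta : measurable_fun setT (eta : Omega -> measures X R) :=
  measurable_funPT eta.

(* The library's kernel theory needs finite kernels, which w |-> eta w is not. *)
Definition prob_subkernel (w : Omega) : {measure set X -> \bar R} :=
  if eta w setT == 1 then eta w else mzero.

Lemma prob_subkernelE w : prob_measures (eta w) -> prob_subkernel w = eta w.
Proof. by rewrite /prob_subkernel /prob_measures /= => ->; rewrite eqxx. Qed.

Lemma measurable_prob_measures_preimage : measurable (eta @^-1` prob_measures).
Proof.
rewrite -[X in measurable X]setTI; apply: meta => //.
exact: measurable_prob_measures.
Qed.

Let measurable_prob_subkernel U : measurable U ->
  measurable_fun setT (prob_subkernel ^~ U).
Proof.
move=> mU.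
rewrite (_ : prob_subkernel ^~ U =
    fun w => if eta w setT == 1 then eta w U else cst 0 w).
  apply: measurable_fun_if => //.
  - apply: (measurable_fun_bool true); rewrite setTI.
    rewrite (_ : _ @^-1` _ = eta @^-1` prob_measures).
      exact: measurable_prob_measures_preimage.
    by apply/seteqP; split => w /=; rewrite /prob_measures /= => /eqP.
  - apply: measurable_funTS.
    exact: (measurableT_comp (measurable_measures_ev mU) meta).
by apply/funext => w; rewrite /prob_subkernel; case: ifP.
Qed.

HB.instance Definition _ := isKernel.Build _ _ _ _ _ prob_subkernel
  measurable_prob_subkernel.

Let prob_subkernel_uub : measure_fam_uub prob_subkernel.
Proof.
exists 2%R => w; rewrite /prob_subkernel.
by case: ifPn => [/eqP ->|_]; rewrite ?lte_fin ?ltr1n// /mzero lte_fin.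
Qed.

HB.instance Definition _ := Kernel_isFinite.Build _ _ _ _ _ prob_subkernel
  prob_subkernel_uub.

Let measurable_graph :
  measurable_fun setT (fun p : Omega * X => (eta p.1, p.2)).
Proof.
apply: measurable_fun_pair; last exact: measurable_snd.
exact: (measurableT_comp meta measurable_fst).
Qed.

(** This is the Campbell measure of the random measure: the joint law of eta w and a point x drawn
    from it, restricted to the event that eta w is a probability measure. *)
Lemma prob_subkernel_integral_measure (P : {measure set Omega -> \bar R}) :
  exists m : {measure set (measures X R * X) -> \bar R},
  forall f : measures X R * X -> \bar R,
    measurable_fun setT f -> (forall p, 0 <= f p) ->
    \int[m]_p f p = \int[P]_w \int[prob_subkernel w]_x f (eta w, x).
Proof.
have mpair w : measurable_fun setT (fun x : X => (eta w, x)).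
  exact: pair1_measurable.
pose l w := (pushforward (prob_subkernel w) (fun x : X => (eta w, x))
  : {measure set (measures X R * X) -> \bar R}).
have [|m mE] := @kernel_mixture _ _ Omega (measures X R * X)%type R P
    (l mpair).
  move=> U mU.
  pose V := (fun p : Omega * X => (eta p.1, p.2)) @^-1` U.
  have mV : measurable V.
    by rewrite -[X in measurable X]setTI; exact: measurable_graph.
  rewrite (_ : (fun _ => _) = fun w => prob_subkernel w (xsection V w)).
    by apply: measurable_fun_xsection_finite_kernel; rewrite inE.
  by apply/funext => w; rewrite xsectionE.
exists m => f mf f0; rewrite mE//; apply: eq_integral => w _.
by rewrite ge0_integral_pushforward.
Qed.

Lemma measurable_prob_subkernel_integral (f : measures X R * X -> \bar R) :
  measurable_fun setT f -> (forall p, 0 <= f p) ->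
  measurable_fun setT (fun w => \int[prob_subkernel w]_x f (eta w, x)).
Proof.
move=> mf f0.
apply: (measurable_fun_integral_finite_kernel
  (fun p : Omega * X => f (eta p.1, p.2)) prob_subkernel) => //.
exact: (measurableT_comp mf measurable_graph).
Qed.

End prob_subkernel.

Section mixture_integral.
Context (d dO : measure_display) (X : measurableType d) (R : realType)
  (Omega : measurableType dO) (P : probability Omega R)
  (eta : {mfun Omega >-> measures X R})
  (sigma : {finite_measure set X -> \bar R}) (beta : R).
Local Notation RT := (measurableTypeR R).
Local Notation leb := (@lebesgue_measure R).
Local Open Scope ereal_scope.

Let meta : measurable_fun setT (eta : Omega -> measures X R) :=
  measurable_funPT eta.

(** The right-hand side of the Mecke equation, for f depending on the measure and on the point. *)
Definition mixture_integral (f : measures X R * X -> \bar R) : \bar R :=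
  \int[sigma]_x \int[leb]_(t in `[0%R, 1%R])
    ((\int[P]_w f (mixture t (eta w) x, x)) * ((1 - t) `^ (beta - 1))%:E).

Lemma measurable_mixture_pair : measurable_fun setT
  (fun p : X * RT * Omega => (mixture p.1.2 (eta p.2) p.1.1, p.1.1)).
Proof.
apply: measurable_fun_pair; first exact: measurable_mixture.
exact: (measurableT_comp measurable_fst measurable_fst).
Qed.

Lemma measurable_integral_mixture (f : measures X R * X -> \bar R) :
  measurable_fun setT f -> (forall p, 0 <= f p) ->
  measurable_fun setT
    (fun p : X * RT => \int[P]_w f (mixture p.2 (eta w) p.1, p.1)).
Proof.
move=> mf f0; apply: (@measurable_fun_integral2 _ _ _ _ _ P
  (fun (p : X * RT) w => f (mixture p.2 (eta w) p.1, p.1))) => //.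
exact: (measurableT_comp mf measurable_mixture_pair).
Qed.

Lemma measurable_onem_powR : measurable_fun setT
  (fun t : RT => (1 - t) `^ (beta - 1))%R.
Proof.
apply: (measurableT_comp (measurable_powR _)); exact: measurable_funB.
Qed.

Lemma measurable_mixture_integrand (f : measures X R * X -> \bar R) :
  measurable_fun setT f -> (forall p, 0 <= f p) ->
  measurable_fun setT (fun x => \int[leb]_(t in `[0%R, 1%R])
    ((\int[P]_w f (mixture t (eta w) x, x)) * ((1 - t) `^ (beta - 1))%:E)).
Proof.
move=> mf f0; under eq_fun do rewrite integral_mkcond.
apply: (@measurable_fun_integral2 _ _ _ _ _ leb) => [|x t]; last first.
  rewrite patchE; case: ifPn => // _.
  by rewrite mule_ge0 ?lee_fin ?powR_ge0// integral_ge0.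
rewrite (_ : (fun _ => _) = fun p : X * RT => (\1_`[0%R, 1%R] p.2)%:E *
    ((\int[P]_w f (mixture p.2 (eta w) p.1, p.1)) * ((1 - p.2) `^ (beta - 1))%:E)).
  apply: emeasurable_funM.
    apply/measurable_EFinP; apply: (measurableT_comp _ measurable_snd).
    exact: measurable_indic.
  apply: emeasurable_funM; first exact: measurable_integral_mixture.
  apply/measurable_EFinP.
  exact: (measurableT_comp measurable_onem_powR measurable_snd).
apply/funext => p; rewrite patchE indicE.
by case: ifPn; rewrite ?mul1e ?mul0e.
Qed.

(** For fixed x and t, the law of (mixture t (eta w) x, x), weighted by (1 - t)^(beta - 1) on
    [0, 1], is a kernel over the product of [sigma] and Lebesgue measure. [kernel_mixture]
    integrates it, and Tonelli restores the iterated form. *)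
Lemma mixture_integral_measure :
  exists m : {measure set (measures X R * X) -> \bar R},
  forall f : measures X R * X -> \bar R,
    measurable_fun setT f -> (forall p, 0 <= f p) ->
    \int[m]_p f p = mixture_integral f.
Proof.
pose h (p : X * RT) : R := (\1_`[0%R, 1%R] p.2 * (1 - p.2) `^ (beta - 1))%R.
have h0 p : (0 <= h p)%R by rewrite mulr_ge0// powR_ge0.
have mh : measurable_fun setT h.
  apply: measurable_funM.
    apply: (measurableT_comp _ measurable_snd); exact: measurable_indic.
  exact: (measurableT_comp measurable_onem_powR measurable_snd).
have mphi (p : X * RT) : measurable_fun setT
    (fun w => (mixture p.2 (eta w) p.1, p.1)).
  exact: (measurable_fun_pair2 p measurable_mixture_pair).
pose push := (fun p : X * RT =>
  pushforward P (fun w => (mixture p.2 (eta w) p.1, p.1))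
    : {measure set (measures X R * X) -> \bar R}).
pose l p : {measure set (measures X R * X) -> \bar R} :=
  mscale (NngNum (h0 p)) (push mphi p).
have lE p f : measurable_fun setT f -> (forall q, 0 <= f q) ->
    \int[l p]_q f q = (h p)%:E * \int[P]_w f (mixture p.2 (eta w) p.1, p.1).
  by move=> mf f0; rewrite ge0_integral_mscale// ge0_integral_pushforward.
have [|m mE] := @kernel_mixture _ _ _ _ _ (sigma \x leb) l.
  move=> U mU.
  rewrite (_ : l ^~ U = fun p => (h p)%:E *
      \int[P]_w (\1_U (mixture p.2 (eta w) p.1, p.1))%:E).
    apply: emeasurable_funM; first exact/measurable_EFinP.
    apply: (measurable_integral_mixture (f := fun q => (\1_U q)%:E)) => [|q].
      exact/measurable_EFinP.
    by rewrite lee_fin.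
  apply/funext => p; rewrite -(lE p (EFin \o \1_U)).
  - by rewrite integral_indic// setIT.
  - exact/measurable_EFinP.
  - by move=> q; rewrite lee_fin.
exists m => f mf f0; rewrite mE//.
have mint := measurable_integral_mixture mf f0.
transitivity (\int[sigma \x leb]_p ((\1_`[0%R, 1%R] p.2)%:E *
    ((\int[P]_w f (mixture p.2 (eta w) p.1, p.1)) * ((1 - p.2) `^ (beta - 1))%:E))).
  apply: eq_integral => p _; rewrite lE// /h EFinM -muleA; congr (_ * _).
  by rewrite muleC.
have mleft : measurable_fun setT (fun p : X * RT => (\1_`[0%R, 1%R] p.2)%:E *
    ((\int[P]_w f (mixture p.2 (eta w) p.1, p.1)) * ((1 - p.2) `^ (beta - 1))%:E)).
  apply: emeasurable_funM.
    apply/measurable_EFinP; apply: (measurableT_comp _ measurable_snd).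
    exact: measurable_indic.
  apply: emeasurable_funM => //; apply/measurable_EFinP.
  exact: (measurableT_comp measurable_onem_powR measurable_snd).
rewrite fubini_tonelli1//; last first.
  move=> p; rewrite mule_ge0 ?lee_fin// mule_ge0 ?lee_fin ?powR_ge0//.
  exact: integral_ge0.
apply: eq_integral => x _; rewrite /fubini_F /= [RHS]integral_mkcond.
apply: eq_integral => t _; rewrite patchE indicE.
by case: ifPn; rewrite ?mul1e ?mul0e.
Qed.

End mixture_integral.

Section cells.
Context (d : measure_display) (X : measurableType d) (R : realType).
Local Open Scope ereal_scope.

Lemma sum_cells k (C : 'I_k -> set X) (F : 'I_k -> \bar R) x i :
  trivIset setT C -> C i x -> \sum_j F j * (\1_(C j) x)%:E = F i.
Proof.
move=> tC Cix; rewrite (bigD1 i)//= indicE mem_set// mule1 big1 ?adde0// => j ji.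
rewrite indicE memNset ?mule0// => Cjx; move/eqP: ji; apply.
by apply: tC => //; exists x.
Qed.

Lemma measure_cells k (C : 'I_k -> set X) (J : 'I_k -> bool) (B : set X)
    (mu : {measure set X -> \bar R}) :
  (forall i, measurable (C i)) -> trivIset setT C -> measurable B ->
  (forall i x, C i x -> B x <-> J i) -> mu (~` \bigcup_i C i) = 0 ->
  mu B = \sum_i (J i)%:R%:E * mu (C i).
Proof.
move=> mC tC mB BJ N0.
have mU : measurable (\bigcup_i C i) by exact: fin_bigcup_measurable.
have mterm i : measurable_fun setT (fun x => (J i)%:R%:E * (\1_(C i) x)%:E : \bar R).
  by apply: emeasurable_funM => //; exact/measurable_EFinP.
transitivity (\sum_i \int[mu]_x ((J i)%:R%:E * (\1_(C i) x)%:E)); last first.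
  apply: eq_bigr => i _; rewrite ge0_integralZl ?integral_indic ?setIT//.
    exact/measurable_EFinP.
rewrite -[B]setIT -integral_indic//.
rewrite -ge0_integral_sum//.
apply: ge0_ae_eq_integral => //.
- exact/measurable_EFinP.
- exact: emeasurable_sum.
- by move=> x _; apply: sume_ge0 => i _; rewrite mule_ge0// lee_fin.
exists (~` \bigcup_i C i); split => //; first exact: measurableC.
move=> x /=; apply: contra_not => -[i _ Cix] _.
rewrite (sum_cells (fun i => (J i)%:R%:E) tC Cix) indicE.
have := BJ i x Cix; case: (J i) => -[BJ1 BJ2].
  by rewrite mem_set ?mule1//; exact: BJ2.
by rewrite memNset// => /BJ1.
Qed.

(** The cells are the atoms of the finite algebra generated by the sets B j, indexed by membership
    patterns. Null atoms are discarded; at least one remains, since otherwise X would be null. *)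
Lemma separating_cells (sigma : {measure set X -> \bar R}) m (B : 'I_m -> set X) :
  sigma setT != 0 -> (forall j, measurable (B j)) ->
  exists k (C : 'I_k.+1 -> set X) (J : 'I_m -> 'I_k.+1 -> bool),
  [/\ forall i, measurable (C i), trivIset setT C,
      forall i, 0 < sigma (C i), sigma (~` \bigcup_i C i) = 0 &
      forall j i x, C i x -> B j x <-> J j i].
Proof.
move=> sT mB.
pose A (s : {ffun 'I_m -> bool}) : set X := [set x | forall j, B j x <-> s j].
have mA s : measurable (A s).
  rewrite (_ : A s = \bigcap_(j in setT) (if s j then B j else ~` B j)).
    apply: fin_bigcap_measurable => [|j _]; first exact: finite_finset.
    by case: (s j) => //; exact: measurableC.
  apply/seteqP; split => x /= Ax j.
    move=> _; have [Bs sB] := Ax j; case: (s j) Bs sB => [_|+ _].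
      exact.
    by move=> Bs /Bs.
  by have := Ax j I; case: (s j).
have tA s s' x : A s x -> A s' x -> s = s'.
  move=> As As'; apply/ffunP => j; apply/idP/idP => sj.
    by apply/(As' j)/(As j).
  by apply/(As j)/(As' j).
have cover x : exists s, A s x.
  by exists [ffun j => `[< B j x >]] => j; rewrite ffunE; split=> /asboolP.
pose I := [pred s | 0 < sigma (A s)].
pose N := \big[setU/set0]_(s | ~~ I s) A s.
have Nnull : sigma.-negligible N.
  rewrite /N; elim/big_ind: _ => [||s];
    [exact: negligible_set0|exact: negligibleU|rewrite /= -leNgt => As].
  by apply/negligibleP => //; apply/eqP; rewrite -measure_le0.
have Nsub x : (forall s, I s -> ~ A s x) -> N x.
  move=> notI; have [s As] := cover x.
  by rewrite /N (bigD1 s)/=; [left|apply/negP => /notI].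
have I0 : (0 < #|I|)%N.
  rewrite lt0n; apply: contra sT => /eqP /card0_eq I0.
  apply/eqP/negligibleP => //; apply: negligibleS Nnull => x _.
  by apply: Nsub => s; rewrite -[I s]/(s \in I) I0.
pose k := #|I|.-1; have kE : k.+1 = #|I| by rewrite prednK.
pose e (i : 'I_k.+1) : {ffun 'I_m -> bool} := enum_val (cast_ord kE i).
exists k, (fun i => A (e i)), (fun j i => e i j); split => //.
- move=> i i' _ _ [x [Ai Ai']]; have := tA _ _ _ Ai Ai'.
  by move=> /enum_val_inj/cast_ord_inj.
- by move=> i; have := enum_valP (cast_ord kE i).
- have mU : measurable (\bigcup_i A (e i)) by exact: fin_bigcup_measurable.
  apply/negligibleP; first exact: measurableC.
  apply: negligibleS Nnull => x nx; apply: Nsub => s Is As; apply: nx.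
  exists (cast_ord (esym kE) (enum_rank_in Is s)) => //.
  by rewrite /e cast_ordKV enum_rankK_in.
Qed.

End cells.

Section cell_masses.
Context (d dO : measure_display) (X : measurableType d) (R : realType)
  (Omega : measurableType dO) (P : probability Omega R)
  (eta : {RV P >-> measures X R})
  (sigma : {finite_measure set X -> \bar R}).
Local Open Scope ereal_scope.

Let meta : measurable_fun setT (eta : Omega -> measures X R) :=
  measurable_funPT eta.

Definition cell_masses k (C : 'I_k -> set X) (mu : measures X R) : k.-tuple R :=
  [tuple fine (mu (C i)) | i < k].

Lemma measurable_cell_masses k (C : 'I_k -> set X) :
  (forall i, measurable (C i)) -> measurable_fun setT (cell_masses C).
Proof.
move=> mC; apply/measurable_fun_tnthP => i.
rewrite (_ : _ \o _ = fun mu : measures X R => fine (mu (C i))).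
  have mfine : measurable_fun setT (@fine R) by [].
  exact: (measurableT_comp mfine (measurable_measures_ev (mC i))).
by apply/funext => mu /=; rewrite tnth_mktuple.
Qed.

Lemma prob_fin_num (mu : measures X R) B : prob_measures mu -> measurable B ->
  mu B \is a fin_num.
Proof.
move=> mu1 mB; rewrite ge0_fin_numE//; apply: (@le_lt_trans _ _ (mu setT)).
  by apply: le_measure; rewrite ?inE.
by rewrite mu1 ltry.
Qed.

Lemma cell_masses_simplex k (C : 'I_k.+1 -> set X) (mu : measures X R) :
  (forall i, measurable (C i)) -> trivIset setT C ->
  mu (~` \bigcup_i C i) = 0 -> prob_measures mu -> simplex (cell_masses C mu).
Proof.
move=> mC tC N0 mu1; split => [i|]; first by rewrite tnth_mktuple fine_ge0.
have := @measure_cells _ _ _ _ C xpredT setT mu mC tC measurableT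
  (fun _ _ _ => conj (fun _ => erefl) (fun _ => I)) N0.
under eq_bigr do rewrite mul1e.
rewrite mu1 => E; apply/EFin_inj; rewrite E -sumEFin; apply: eq_bigr => i _.
by rewrite tnth_mktuple fineK// prob_fin_num.
Qed.

(** The cells cover X only up to a null set, whereas [dirichlet_ferguson] speaks of exact
    partitions. The remainder is added to the first cell, which does not change the masses under
    [sigma] and changes those under eta only on a null event. *)
Lemma dirichlet_ferguson_law k (C : 'I_k.+1 -> set X) :
  dirichlet_ferguson sigma eta ->
  (forall i, measurable (C i)) -> trivIset setT C ->
  (forall i, 0 < sigma (C i)) -> sigma (~` \bigcup_i C i) = 0 ->
  forall A, measurable A ->
  P ((cell_masses C \o eta) @^-1` A) = dirichlet (fun i => fine (sigma (C i))) A.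
Proof.
move=> [eta1 eta0 etaD] mC tC C0 N0 A mA.
have a0 i : (0 < fine (sigma (C i)))%R.
  by rewrite fine_gt0// C0/= ltey_eq fin_num_measure.
set N := ~` \bigcup_i C i in N0 *.
have mU : measurable (\bigcup_i C i) by exact: fin_bigcup_measurable.
have mN : measurable N by exact: measurableC.
have aeN := eta0 _ mN N0.
have PE (f g : Omega -> k.+1.-tuple R) : measurable_fun setT f ->
    measurable_fun setT g -> {ae P, forall w, f w = g w} ->
    P (f @^-1` A) = P (g @^-1` A).
  have intE (h : Omega -> k.+1.-tuple R) : measurable_fun setT h ->
      P (h @^-1` A) = \int[P]_w (\1_A (h w))%:E.
    move=> mh; rewrite -[h @^-1` A]setIT -integral_indic//.
    by rewrite -[X in measurable X]setTI; exact: mh.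
  move=> mf mg fg; rewrite !intE//; apply: ge0_ae_eq_integral => //.
  - by apply/measurable_EFinP; exact: measurableT_comp.
  - by apply/measurable_EFinP; exact: measurableT_comp.
  by apply: filterS fg => w -> _.
have mY : measurable_fun setT (cell_masses C \o eta).
  exact: (measurableT_comp (measurable_cell_masses mC) meta).
(* A single cell is not covered by [dirichlet_ferguson]. *)
case: (posnP k) => k0.
  (* For k = 0 the simplex is a single point, and both laws are the point mass there. *)
  have one (z : k.+1.-tuple R) : simplex z -> z = [tuple 1%R | _ < k.+1].
    move=> [_ z1]; apply: eq_from_tnth => i; rewrite tnth_mktuple -z1.
    rewrite (bigD1 i)//= big1 ?addr0// => j /eqP[]; apply: val_inj => /=.
    by have := ltn_ord i; have := ltn_ord j; lia.
  rewrite (PE _ (cst [tuple 1%R | _ < k.+1]))//; last first.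
    by apply: filterS2 eta1 aeN => w w1 wN; apply/one/cell_masses_simplex.
  have [m mE] := dirichlet_measure a0.
  rewrite -mE// preimage_cst; have mT : m setT = 1 by rewrite mE// dirichlet_setT.
  have mS := dirichlet_ae_simplex mE.
  rewrite -[A in RHS]setIT -integral_indic//.
  transitivity (\int[m]_z (\1_A [tuple 1%R | _ < k.+1])%:E); last first.
    apply: ge0_ae_eq_integral => //.
    - exact/measurable_EFinP.
    by apply: filterS mS => z /one ->.
  rewrite integral_cst// mT mule1 indicE.
  by case: ifPn => _; rewrite ?probability_setT ?measure0.
pose C' i := if i == ord0 then C ord0 `|` N else C i.
have mC' i : measurable (C' i).
  by rewrite /C'; case: ifP => // _; exact: measurableU.
have CN i : C i `&` N = set0.
  by rewrite -subset0 => x [Cx]; apply; exists i.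
have muC' (mu : {measure set X -> \bar R}) i : mu N = 0 -> mu (C' i) = mu (C i).
  rewrite /C'; case: eqP => [->|//] muN.
  transitivity (mu (C ord0) + mu N); last by rewrite muN adde0.
  exact: measureU (mC ord0) mN (CN ord0).
have tC' : trivIset setT C'.
  apply/trivIsetP => i j _ _ ij; rewrite /C'.
  have Cij : C i `&` C j = set0 by move/trivIsetP : tC; apply.
  have [i0|i0] := eqVneq i ord0; have [j0|j0] := eqVneq j ord0 => //.
  - by move: ij; rewrite i0 j0 eqxx.
  - by rewrite setIUl -i0 Cij setIC CN setU0.
  - by rewrite setIUr -j0 Cij CN setU0.
have UC' : \bigcup_i C' i = setT.
  apply/seteqP; split => // x _; have [[i _ Cix]|nC] := pselect ((\bigcup_i C i) x).
    by exists i => //; rewrite /C'; case: eqP => // <-; left.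
  by exists ord0 => //; rewrite /C' eqxx; right.
have neC' i : C' i !=set0.
  have [x Cx] : C i !=set0.
    by apply/set0P; apply: contraTN (C0 i) => /eqP ->; rewrite measure0 ltxx.
  by exists x; rewrite /C'; case: eqP => [<-|//]; left.
have sC' i : sigma (C' i) = sigma (C i) by exact: (muC' sigma).
have C'0 i : 0 < sigma (C' i) by rewrite sC'.
have mY' : measurable_fun setT (cell_masses C' \o eta).
  exact: (measurableT_comp (measurable_cell_masses mC') meta).
have YE : {ae P, forall w, (cell_masses C \o eta) w = (cell_masses C' \o eta) w}.
  apply: filterS aeN => w wN; apply: eq_from_tnth => i.
  by rewrite !tnth_mktuple (muC' (eta w)).
rewrite (PE _ _ mY mY' YE).
have := etaD k C' k0 mC' neC' tC' UC' C'0 A mA.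
rewrite /pushforward => ->; congr (dirichlet _ _).
by apply/funext => i; rewrite sC'.
Qed.

End cell_masses.

(** * The Mecke equation *)

Section mecke_equation.
Context (d dO : measure_display) (X : measurableType d) (R : realType)
  (Omega : measurableType dO) (P : probability Omega R)
  (eta : {RV P >-> measures X R})
  (sigma : {finite_measure set X -> \bar R}).
Local Notation RT := (measurableTypeR R).
Local Notation leb := (@lebesgue_measure R).
Local Notation beta := (fine (sigma setT)).
Local Open Scope ereal_scope.

Let meta : measurable_fun setT (eta : Omega -> measures X R) :=
  measurable_funPT eta.

Lemma cell_masses_mixture k (C : 'I_k.+1 -> set X) t i x (mu : measures X R) :
  (forall i, measurable (C i)) -> trivIset setT C -> (0 <= t <= 1)%R ->
  prob_measures mu -> C i x ->
  cell_masses C (mixture t mu x) = tuple_mix t i (cell_masses C mu).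
Proof.
move=> mC tC t01 mu1 Cix; apply: eq_from_tnth => j.
rewrite !tnth_mktuple mixtureE// -(fineK (prob_fin_num mu1 (mC j))) /=.
congr (_ + t * _)%R; rewrite indicE; have [->|ji] := eqVneq j i.
  by rewrite mem_set.
rewrite memNset// => Cjx; move/eqP : ji; apply.
by apply: tC => //; exists x.
Qed.

Section cells.
Context k (C : 'I_k.+1 -> set X) (mC : forall i, measurable (C i))
  (tC : trivIset setT C) (C0 : forall i, 0 < sigma (C i))
  (N0 : sigma (~` \bigcup_i C i) = 0).

Let fine_sigma_gt0 i : (0 < fine (sigma (C i)))%R.
Proof. by rewrite fine_gt0// C0/= ltey_eq fin_num_measure. Qed.

Lemma sum_cells_sigma : (\sum_i fine (sigma (C i)))%R = beta.
Proof.
have := @measure_cells _ _ _ _ C xpredT setT sigma mC tC measurableT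
  (fun _ _ _ => conj (fun _ => erefl) (fun _ => I)) N0.
under eq_bigr do rewrite mul1e.
move=> ->; apply: EFin_inj; rewrite -sumEFin fineK.
  by apply: eq_bigr => i _; rewrite fineK// fin_num_measure.
by apply/sum_fin_numP => i _ _; rewrite fin_num_measure.
Qed.

Let mY : measurable_fun setT (cell_masses C \o eta).
Proof. exact: (measurableT_comp (measurable_cell_masses mC) meta). Qed.

Lemma mecke_cells (g : k.+1.-tuple R -> R) i :
  dirichlet_ferguson sigma eta ->
  measurable_fun setT g -> (forall z, 0 <= g z)%R ->
  \int[P]_w (eta w (C i) * (g (cell_masses C (eta w)))%:E) =
  sigma (C i) * \int[leb]_(t in `[0%R, 1%R])
    ((\int[P]_w (g (tuple_mix t i (cell_masses C (eta w))))%:E) *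
     ((1 - t) `^ (beta - 1))%:E).
Proof.
move=> DF mg g0; have [eta1 _ _] := DF.
pose push := (pushforward P (cell_masses C \o eta)
  : {measure set (k.+1.-tuple R) -> \bar R}).
pose m := push mY.
have mE A : measurable A -> m A = dirichlet (fun i => fine (sigma (C i))) A.
  exact: dirichlet_ferguson_law.
have mG : measurable_fun setT (EFin \o g) by exact/measurable_EFinP.
have G0 z : 0 <= (EFin \o g) z by rewrite lee_fin.
have mn : measurable_fun setT (fun z : k.+1.-tuple R => `|tnth z i|%:E * (g z)%:E).
  apply: emeasurable_funM => //; apply/measurable_EFinP.
  by apply: measurableT_comp => //; exact: measurable_tnth.
have pushE (f : k.+1.-tuple R -> \bar R) : measurable_fun setT f ->
    (forall z, 0 <= f z) -> \int[m]_z f z = \int[P]_w f (cell_masses C (eta w)).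
  by move=> mf f0; rewrite ge0_integral_pushforward.
transitivity (\int[m]_z (`|tnth z i|%:E * (g z)%:E)).
  rewrite pushE//; last by move=> z; rewrite mule_ge0// lee_fin.
  apply: ge0_ae_eq_integral => //.
  - apply: emeasurable_funM; last exact: (measurableT_comp mG mY).
    exact: (measurableT_comp (measurable_measures_ev (mC i)) meta).
  - exact: (measurableT_comp mn mY).
  - by move=> w _; rewrite mule_ge0// lee_fin.
  - by move=> w _; rewrite mule_ge0// lee_fin.
  apply: filterS eta1 => w w1 _; rewrite tnth_mktuple ger0_norm ?fine_ge0//.
  by rewrite fineK// prob_fin_num.
rewrite (dirichlet_mecke i fine_sigma_gt0 mE mG G0) sum_cells_sigma.
rewrite fineK ?fin_num_measure//; congr (_ * _).
apply: eq_integral => t _; rewrite pushE//.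
exact: (measurableT_comp mG (measurable_fun_pair2 t (measurable_tuple_mix i))).
Qed.

End cells.

Definition measures_cylinder : set (set (measures X R)) :=
  [set V | exists m (B : 'I_m -> set X) (A : 'I_m -> set (\bar R)),
    [/\ forall j, measurable (B j), forall j, measurable (A j) &
        V = [set mu : measures X R | forall j, A j (mu (B j))]]].

(* Both sides are sums over the cells of a partition separating the sets B0 and
   B j, on which the cylinder V is a condition on the cell masses. *)
Let cylinder_mixture m (B : 'I_m -> set X) (A : 'I_m -> set (\bar R)) (B0 : set X) :
  sigma setT != 0 -> dirichlet_ferguson sigma eta ->
  (forall j, measurable (B j)) -> (forall j, measurable (A j)) -> measurable B0 ->
  let V := [set mu : measures X R | forall j, A j (mu (B j))] in
  measurable V ->
  \int[P]_w (eta w B0 * (\1_V (eta w))%:E) =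
  mixture_integral P eta sigma beta (fun p => (\1_V p.1 * \1_B0 p.2)%:E).
Proof.
move=> sT DF mB mA mB0 V mV; have [eta1 eta0 _] := DF.
(* Index 0 is reserved for [B0] and the lifted indices for the sets defining V, so that one
   partition separates them all. *)
pose B' (j : 'I_m.+1) := if unlift ord0 j is Some j' then B j' else B0.
have mB' j : measurable (B' j) by rewrite /B'; case: unlift.
have [k [C [J [mC tC C0 N0 BJ]]]] := separating_cells sT mB'.
have mU : measurable (\bigcup_i C i) by exact: fin_bigcup_measurable.
have mN : measurable (~` \bigcup_i C i) by exact: measurableC.
have aeN := eta0 _ mN N0.
(* [s j] recovers the mass of B j from the cell masses, and [g] expresses membership in V through
   them. *)
pose s j (z : k.+1.-tuple R) := (\sum_i (J (lift ord0 j) i)%:R * tnth z i)%R.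
pose g : k.+1.-tuple R -> R := \1_[set z | forall j, A j (s j z)%:E].
have ms j : measurable_fun setT (fun z => (s j z)%:E).
  apply/measurable_EFinP; apply: measurable_sum => i.
  by apply: measurable_funM => //; exact: measurable_tnth.
have mg : measurable_fun setT g.
  apply: measurable_indic.
  rewrite (_ : [set z | _] = \bigcap_(j in setT) ((fun z => (s j z)%:E) @^-1` A j)).
    apply: fin_bigcap_measurable => [|j _]; first exact: finite_finset.
    by rewrite -[X in measurable X]setTI; exact: ms.
  by apply/seteqP; split => z /= zA j; [move=> _; exact: zA|exact: (zA j I)].
have g0 z : (0 <= g z)%R by [].
have mVfun : measurable_fun setT (fun w => (\1_V (eta w))%:E : \bar R).
  by apply/measurable_EFinP; apply: (measurableT_comp _ meta); exact: measurable_indic.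
have cellE (mu : measures X R) j : prob_measures mu ->
    mu (~` \bigcup_i C i) = 0 ->
    mu (B' j) = (\sum_i (J j i)%:R * tnth (cell_masses C mu) i)%:E.
  move=> mu1 muN; rewrite (measure_cells mC tC (mB' j) (BJ j) muN) -sumEFin.
  by apply: eq_bigr => i _; rewrite tnth_mktuple EFinM fineK// prob_fin_num.
have gE (mu : measures X R) : prob_measures mu ->
    mu (~` \bigcup_i C i) = 0 -> (\1_V mu = g (cell_masses C mu) :> R)%R.
  move=> mu1 muN; rewrite /g !indicE; congr (_%:R)%R; congr nat_of_bool.
  apply/idP/idP; rewrite !inE /= => H j; have := H j.
    by have := cellE mu (lift ord0 j) mu1 muN; rewrite /B' liftK => ->.
  by have := cellE mu (lift ord0 j) mu1 muN; rewrite /B' liftK => ->.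
(* Apart from the indicator of [B0], the inner integral on the right depends on x only through its
   cell; [Q i] is its value on C i. Both sides equal the sum of sigma (C i) * Q i over the cells
   inside [B0]. *)
pose Q i := \int[leb]_(t in `[0%R, 1%R])
    ((\int[P]_w (g (tuple_mix t i (cell_masses C (eta w))))%:E) *
     ((1 - t) `^ (beta - 1))%:E).
have Q0 i : 0 <= Q i.
  apply: integral_ge0 => t _; rewrite mule_ge0 ?lee_fin ?powR_ge0//.
  by apply: integral_ge0 => w _; rewrite lee_fin.
transitivity (\sum_i (J ord0 i)%:R%:E * (sigma (C i) * Q i)).
  have mY : measurable_fun setT (fun w => (g (cell_masses C (eta w)))%:E).
    apply/measurable_EFinP.
    exact: (measurableT_comp mg (measurableT_comp (measurable_cell_masses mC) meta)).
  have mCi i : measurable_fun setT (fun w => eta w (C i)).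
    exact: (measurableT_comp (measurable_measures_ev (mC i)) meta).
  have mterm i : measurable_fun setT
      (fun w => eta w (C i) * (g (cell_masses C (eta w)))%:E).
    exact: emeasurable_funM.
  have term0 i w : 0 <= eta w (C i) * (g (cell_masses C (eta w)))%:E.
    by rewrite mule_ge0// lee_fin.
  have mJterm i : measurable_fun setT (fun w => (J ord0 i)%:R%:E *
      (eta w (C i) * (g (cell_masses C (eta w)))%:E)).
    exact: measurable_funeM.
  have Jterm0 i w : 0 <= (J ord0 i)%:R%:E *
      (eta w (C i) * (g (cell_masses C (eta w)))%:E).
    by rewrite mule_ge0.
  transitivity (\int[P]_w \sum_i ((J ord0 i)%:R%:E *
      (eta w (C i) * (g (cell_masses C (eta w)))%:E))).
    apply: ge0_ae_eq_integral => [||||w _|].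
    - exact: measurableT.
    - apply: emeasurable_funM => //.
      exact: (measurableT_comp (measurable_measures_ev mB0) meta).
    - exact: emeasurable_sum.
    - by move=> w _; rewrite mule_ge0// lee_fin.
    - exact: sume_ge0.
    apply: filterS2 eta1 aeN => w w1 wN _; rewrite gE//.
    have := measure_cells mC tC (mB' ord0) (BJ ord0) wN.
    rewrite {1}/B' unlift_none => ->.
    rewrite ge0_sume_distrl; last by move=> i _; rewrite mule_ge0// lee_fin.
    by apply: eq_bigr => i _; rewrite muleA.
  rewrite ge0_integral_sum//.
  apply: eq_bigr => i _; rewrite ge0_integralZl//.
  by rewrite (mecke_cells mC tC C0 N0).
pose F (p : measures X R * X) : \bar R := (\1_V p.1 * \1_B0 p.2)%:E.
have mF : measurable_fun setT F.
  apply/measurable_EFinP; apply: measurable_funM.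
    by apply: (measurableT_comp _ measurable_fst); exact: measurable_indic.
  by apply: (measurableT_comp _ measurable_snd); exact: measurable_indic.
have F0 p : 0 <= F p by rewrite lee_fin mulr_ge0.
have mmix t x : measurable_fun setT (fun w => F (mixture t (eta w) x, x)).
  exact: (measurableT_comp mF
    (measurable_fun_pair2 (x, t) (measurable_mixture_pair eta))).
have mind i : measurable_fun setT (fun x => (\1_(C i) x)%:E : \bar R).
  by apply/measurable_EFinP; exact: measurable_indic.
have JQ0 i : 0 <= (J ord0 i)%:R%:E * Q i by rewrite mule_ge0.
have mJQ i : measurable_fun setT (fun x => (J ord0 i)%:R%:E * Q i * (\1_(C i) x)%:E).
  exact: measurable_funeM.
have JQ1 i x : 0 <= (J ord0 i)%:R%:E * Q i * (\1_(C i) x)%:E.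
  by rewrite mule_ge0// lee_fin.
transitivity (\int[sigma]_x \sum_i ((J ord0 i)%:R%:E * Q i) * (\1_(C i) x)%:E).
  rewrite ge0_integral_sum//.
  apply: eq_bigr => i _; rewrite ge0_integralZl//.
  by rewrite integral_indic// setIT -muleA [Q i * _]muleC.
apply: ge0_ae_eq_integral => [||||x _|].
- exact: measurableT.
- exact: emeasurable_sum.
- exact: (measurable_mixture_integrand P eta beta mF F0).
- by move=> x _; exact: sume_ge0.
- apply: integral_ge0 => t _; rewrite mule_ge0 ?lee_fin ?powR_ge0//.
  by apply: integral_ge0 => w _; exact: F0.
exists (~` \bigcup_i C i); split => // x /=; apply: contra_not => -[i _ Cix] _.
rewrite (sum_cells (fun i => (J ord0 i)%:R%:E * Q i) tC Cix).
have Q'0 t : 0 <= \int[P]_w (g (tuple_mix t i (cell_masses C (eta w))))%:E *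
    ((1 - t) `^ (beta - 1))%:E.
  by rewrite mule_ge0 ?lee_fin ?powR_ge0// integral_ge0// => w _; rewrite lee_fin.
have B0x : (\1_B0 x = (J ord0 i)%:R :> R)%R.
  rewrite indicE; have := BJ ord0 i x Cix; rewrite /B' unlift_none => -[h1 h2].
  congr (_%:R)%R; congr nat_of_bool.
  by apply/idP/idP; rewrite inE.
rewrite /Q; case: (J ord0 i) B0x => B0x; last first.
  rewrite mul0e integral0_eq// => t _; rewrite [X in X * _]integral0_eq ?mul0e// => w _.
  by rewrite /= B0x mulr0.
rewrite mul1e; apply: eq_integral => t; rewrite inE /= in_itv /= => t01.
congr (_ * _); apply: ge0_ae_eq_integral => [||||w _|].
- exact: measurableT.
- apply/measurable_EFinP; apply: (measurableT_comp mg).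
  exact: (measurableT_comp (measurable_fun_pair2 t (measurable_tuple_mix i))
    (measurableT_comp (measurable_cell_masses mC) meta)).
- exact: mmix.
- by move=> w _; rewrite lee_fin.
- exact: (F0 (_, x)).
apply: filterS2 eta1 aeN => w w1 wN _.
rewrite /= B0x mulr1 gE; last 2 first.
- exact: prob_mixture.
- rewrite mixtureE// wN mule0 add0e indicE memNset ?mule0//.
  by apply; exists i.
by rewrite (cell_masses_mixture mC tC t01 w1 Cix).
Qed.

Lemma measurable_cylinder V : measures_cylinder V -> measurable V.
Proof.
move=> [m [B [A [mB mA ->]]]].
rewrite (_ : [set mu : measures X R | _] =
    \bigcap_(j in setT) ((fun mu : measures X R => mu (B j)) @^-1` A j)).
  apply: fin_bigcap_measurable => [|j _]; first exact: finite_finset.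
  by rewrite -[X in measurable X]setTI; exact: measurable_measures_ev.
by apply/seteqP; split => z /= zA j; [move=> _; exact: zA|exact: (zA j I)].
Qed.

Lemma measures_cylinderI : setI_closed measures_cylinder.
Proof.
move=> V V' [m [B [A [mB mA ->]]]] [m' [B' [A' [mB' mA' ->]]]].
exists (m + m')%N.
exists (fun j : 'I_(m + m') => match fintype.split j with inl j => B j | inr j => B' j end).
exists (fun j : 'I_(m + m') => match fintype.split j with inl j => A j | inr j => A' j end).
split => [j|j|]; [by case: fintype.split|by case: fintype.split|].
apply/seteqP; split => mu /=.
  by move=> [H H'] j; case: (fintype.split j).
move=> H; split => j.
  by have := H (lshift m' j); rewrite (unsplitK (inl _ j)).
by have := H (rshift m j); rewrite (unsplitK (inr _ j)).
Qed.

Let rectangles : set (set (measures X R * X)) :=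
  [set V `*` B | V in measures_cylinder & B in measurable].

(** It suffices that both projections are measurable for the generated sigma-algebra; for the first,
    cylinders given by one set are enough. *)
Let measurable_rectangles_generated :
  @measurable _ (measures X R * X)%type `<=` <<s rectangles >>.
Proof.
pose T := g_sigma_algebraType rectangles.
have cylT : measures_cylinder setT.
  exists 0%N, (fun=> set0), (fun=> set0); split => //.
  by apply/seteqP; split => // mu _ [].
have mid : measurable_fun setT (fun p : T => (p.1, p.2)).
  apply: measurable_fun_pair.
    apply: measurable_fun_measures => B mB _ A mA; rewrite setTI.
    apply: sub_sigma_algebra; exists [set mu : measures X R | A (mu B)].
      exists 1%N, (fun=> B), (fun=> A); split => //.
      by apply/seteqP; split => mu /=; [|move=> /(_ ord0)].
    exists setT => //.
    by apply/seteqP; split => p /=; [move=> []|].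
  move=> _ B mB; rewrite setTI; apply: sub_sigma_algebra.
  exists setT => //; exists B => //.
  by apply/seteqP; split => p /=; [move=> []|].
move=> A mA; have := mid measurableT A mA; rewrite setTI.
by rewrite (_ : _ @^-1` A = A)//; apply/seteqP; split => -[].
Qed.

(** The two measures on pairs agree on the rectangles by [cylinder_mixture]. Uniqueness applies
    because the rectangles include the whole space, whose Campbell mass is at most 1. *)
Lemma dirichlet_ferguson_mecke (f : measures X R * X -> \bar R) :
  sigma setT != 0 -> dirichlet_ferguson sigma eta ->
  measurable_fun setT f -> (forall p, 0 <= f p) ->
  \int[P]_w \int[prob_subkernel eta w]_x f (eta w, x) =
  mixture_integral P eta sigma beta f.
Proof.
move=> sT DF mf f0; have [eta1 _ _] := DF.
have [m1 m1E] := prob_subkernel_integral_measure eta P.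
have [m2 m2E] := mixture_integral_measure P eta sigma beta.
rewrite -m1E// -m2E//; apply: eq_measure_integral => U mU _.
have cylT : measures_cylinder setT.
  exists 0%N, (fun=> set0), (fun=> set0); split => //.
  by apply/seteqP; split => // mu _ [].
have indicE' (m : {measure set (measures X R * X) -> \bar R}) U' :
    measurable U' -> m U' = \int[m]_p (\1_U' p)%:E.
  by move=> mU'; rewrite integral_indic// setIT.
apply: (g_sigma_algebra_measure_unique rectangles _ (fun=> setT)).
- move=> _ [V cV [B mB <-]]; apply: measurableX => //.
  exact: measurable_cylinder.
- by move=> _; exists setT => //; exists setT => //; rewrite setXTT.
- by apply/seteqP; split => // x _; exists 0%N.
- move=> _ _ [V cV [B mB <-]] [V' cV' [B' mB' <-]]; rewrite -setXI.
  exists (V `&` V'); first exact: measures_cylinderI.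
  by exists (B `&` B') => //; exact: measurableI.
- move=> _ [V cV [B mB <-]].
  have mV := measurable_cylinder cV.
  have mVB : measurable (V `*` B) by exact: measurableX.
  rewrite !indicE'//.
  have mI : measurable_fun setT (fun p => (\1_(V `*` B) p)%:E : \bar R).
    by apply/measurable_EFinP; exact: measurable_indic.
  have I0 p : 0 <= (\1_(V `*` B) p)%:E :> \bar R by rewrite lee_fin.
  have indX p : (\1_(V `*` B) p = \1_V p.1 * \1_B p.2 :> R)%R.
    by rewrite !indicE -natrM mulnb; congr (nat_of_bool _)%:R; apply/idP/andP;
      rewrite !inE.
  rewrite (m1E _ mI I0) (m2E _ mI I0).
  have [m [B' [A [mB' mA VE]]]] := cV.
  have := cylinder_mixture sT DF mB' mA mB; rewrite -VE => /(_ mV).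
  rewrite (_ : (fun p => (\1_V p.1 * \1_B p.2)%:E) = (fun p => (\1_(V `*` B) p)%:E)).
    move=> <-; apply: ge0_ae_eq_integral => [||||w _|].
    - exact: measurableT.
    - exact: (measurable_prob_subkernel_integral eta mI I0).
    - apply: emeasurable_funM.
        exact: (measurableT_comp (measurable_measures_ev mB) meta).
      by apply/measurable_EFinP; apply: (measurableT_comp _ meta); exact: measurable_indic.
    - by move=> w _; apply: integral_ge0 => x _; rewrite lee_fin.
    - by rewrite mule_ge0// lee_fin.
    apply: filterS eta1 => w w1 _; rewrite prob_subkernelE//.
    under eq_integral do rewrite indX /= EFinM.
    have mB1 : measurable_fun setT (fun x => (\1_B x)%:E : \bar R).
      by apply/measurable_EFinP; exact: measurable_indic.
    rewrite ge0_integralZl//.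
    by rewrite integral_indic// setIT muleC.
  by apply/funext => p; rewrite indX.
- move=> _; have mI : measurable_fun setT
      (fun p : measures X R * X => (\1_[set: measures X R * X] p)%:E : \bar R).
    by apply/measurable_EFinP; exact: measurable_indic.
  have I0 p : 0 <= (\1_[set: measures X R * X] p)%:E :> \bar R by rewrite lee_fin.
  rewrite indicE'// (m1E _ mI I0).
  apply: (@le_lt_trans _ _ (\int[P]_w (cst 1) w)).
    apply: ge0_le_integral => [|w _| |//|w _].
    + exact: measurableT.
    + by apply: integral_ge0 => x _; rewrite lee_fin.
    + exact: (measurable_prob_subkernel_integral eta mI I0).
    rewrite (eq_integral (cst 1)); last by move=> x _; rewrite indicT.
    rewrite integral_cst// mul1e /prob_subkernel.
    by case: ifPn => [/eqP ->|_] //; rewrite /mzero lee_fin.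
  by rewrite integral_cst// mul1e [ltLHS](@probability_setT _ _ _ P) ltry.
- exact: measurable_rectangles_generated.
Qed.

End mecke_equation.

(** * The converse *)

Section mecke_converse.
Context (d dO : measure_display) (X : measurableType d) (R : realType)
  (Omega : measurableType dO) (P : probability Omega R)
  (eta : {RV P >-> measures X R})
  (sigma : {finite_measure set X -> \bar R}).
Local Notation RT := (measurableTypeR R).
Local Notation leb := (@lebesgue_measure R).
Local Notation beta := (fine (sigma setT)).
Local Open Scope ereal_scope.

Let meta : measurable_fun setT (eta : Omega -> measures X R) :=
  measurable_funPT eta.

Lemma measurable_eta_ev B : measurable B -> measurable_fun setT (fun w => eta w B).
Proof. by move=> mB; exact: (measurableT_comp (measurable_measures_ev mB) meta). Qed.

Lemma measurable_fine_ev (B : set X) : measurable B ->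
  measurable_fun setT (fun mu : measures X R => fine (mu B)).
Proof.
move=> mB; have mfine : measurable_fun setT (@fine R) by [].
exact: (measurableT_comp mfine (measurable_measures_ev mB)).
Qed.

Context (sigma_neq0 : sigma setT != 0)
  (mecke : forall G : measures X R -> R,
    measurable_fun setT G -> (forall mu, 0 <= G mu)%R ->
    \int[P]_w (eta w setT * (G (eta w))%:E) =
    mixture_integral P eta sigma beta (fun p => (G p.1)%:E)).

Let sigmaTE : sigma setT = beta%:E.
Proof. by rewrite fineK// fin_num_measure. Qed.

Let beta_gt0 : (0 < beta)%R.
Proof. by rewrite fine_gt0// lt0e sigma_neq0 measure_ge0/= ltey_eq fin_num_measure. Qed.

Let PT : P setT = 1. Proof. exact: probability_setT. Qed.

Let integral_cstP (c : \bar R) : 0 <= c -> \int[P]_w (cst c) w = c.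
Proof. by move=> c0; rewrite integral_cst//= PT mule1. Qed.

Let mixture_integral_cst (f : measures X R * X -> \bar R) (g : R -> R) (c : R) :
  (forall x t, (0 <= t <= 1)%R -> \int[P]_w f (mixture t (eta w) x, x) = (g t)%:E) ->
  \int[leb]_(t in `[0%R, 1%R]) (g t * (1 - t) `^ (beta - 1))%:E = c%:E ->
  mixture_integral P eta sigma beta f = (c * beta)%:E.
Proof.
move=> fE gE; rewrite /mixture_integral EFinM -sigmaTE -integral_cst//.
apply: eq_integral => x _; rewrite /= -gE; apply: eq_integral => t.
by rewrite inE/= in_itv/= => t01; rewrite fE// EFinM.
Qed.

Let integral_onem : \int[leb]_(t in `[0%R, 1%R])
  (1 * (1 - t) `^ (beta - 1))%:E = (beta^-1)%:E.
Proof.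
under eq_integral do rewrite mul1r.
by rewrite (integral_powR_onem beta_gt0 ler01) powR1 div1r.
Qed.

Let mean_total : \int[P]_w eta w setT = 1.
Proof.
have m1 : measurable_fun setT (cst 1%R : measures X R -> R) by [].
have := mecke m1 (fun=> ler01).
under [X in X = _ -> _]eq_integral do rewrite mule1.
move=> ->; rewrite (@mixture_integral_cst _ (fun=> 1%R) beta^-1)//.
  by rewrite mulVf// gt_eqF.
by move=> x t _; apply: (@integral_cstP 1%:E); rewrite lee_fin.
Qed.

(** The test functions G are real-valued, so masses enter through [fine], which sends infinity to 0.
    The finite mean makes this harmless almost surely. *)
Let total_fin_num : {ae P, forall w, eta w setT \is a fin_num}.
Proof.
have iZ : P.-integrable setT (fun w => eta w setT).
  apply/integrableP; split; first exact: measurable_eta_ev.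
  under eq_integral do rewrite gee0_abs//.
  by rewrite mean_total ltry.
by apply: filterS (integrable_ae measurableT iZ) => w; apply.
Qed.

Let mean_fine_total : \int[P]_w (fine (eta w setT))%:E = 1.
Proof.
rewrite -mean_total; apply: ge0_ae_eq_integral => [||||w _|].
- exact: measurableT.
- by apply/measurable_EFinP; exact: (measurableT_comp (measurable_fine_ev measurableT) meta).
- exact: measurable_eta_ev.
- by move=> w _; rewrite lee_fin fine_ge0.
- exact: measure_ge0.
by apply: filterS total_fin_num => w wfin _; rewrite fineK.
Qed.

(** For every t the total mass of the mixture has mean (1 - t) * 1 + t = 1, so the right-hand side
    is the same as for G = 1. *)
Let square_total : \int[P]_w ((fine (eta w setT)) ^+ 2)%:E = 1.
Proof.
have mf := measurableT_comp (measurable_fine_ev measurableT) meta.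
have := mecke (measurable_fine_ev measurableT) (fun mu => fine_ge0 (measure_ge0 mu _)).
rewrite (@mixture_integral_cst _ (fun=> 1%R) beta^-1)//; last first.
  move=> x t /andP[t0 t1].
  have t1' : (0 <= 1 - t)%R by rewrite subr_ge0.
  transitivity (\int[P]_w ((1 - t)%:E * (fine (eta w setT))%:E + (cst t%:E) w)).
    apply: ge0_ae_eq_integral => [||||w _|].
    - exact: measurableT.
    - apply/measurable_EFinP; apply: (measurableT_comp (measurable_fine_ev measurableT)).
      exact: (measurable_fun_pair2 (x, t) (measurable_mixture meta)).
    - apply: emeasurable_funD => //; apply: measurable_funeM.
      exact/measurable_EFinP.
    - by move=> w _; rewrite lee_fin fine_ge0.
    - by rewrite adde_ge0 ?lee_fin// mulr_ge0 ?fine_ge0.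
    apply: filterS total_fin_num => w wfin _ /=.
    rewrite mixtureE ?t0// indicT mule1 -{1}(fineK wfin).
    by rewrite -!EFinM -EFinD.
  have m1 : measurable_fun setT (fun w => (fine (eta w setT))%:E).
    exact/measurable_EFinP.
  have f0 w : 0 <= (fine (eta w setT))%:E by rewrite lee_fin fine_ge0.
  rewrite ge0_integralD//; last 2 first.
  - by move=> w _; rewrite mule_ge0 ?lee_fin.
  - exact: measurable_funeM.
  rewrite ge0_integralZl// mean_fine_total integral_cstP ?lee_fin// mule1.
  by rewrite -EFinD subrK.
rewrite mulVf ?gt_eqF// => <-; apply: ge0_ae_eq_integral => [||||w _|].
- exact: measurableT.
- by apply/measurable_EFinP; exact: measurable_funX.
- apply: emeasurable_funM; first exact: measurable_eta_ev.
  exact/measurable_EFinP.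
- by move=> w _; rewrite lee_fin sqr_ge0.
- by rewrite mule_ge0// lee_fin fine_ge0.
by apply: filterS total_fin_num => w wfin _; rewrite -{2}(fineK wfin) -EFinM.
Qed.

Let ae_eq0 (f : Omega -> R) : measurable_fun setT f -> (forall w, 0 <= f w)%R ->
  \int[P]_w (f w)%:E = 0 -> {ae P, forall w, f w = 0%R}.
Proof.
move=> mf f0 If.
have mF : measurable_fun setT (EFin \o f) by exact/measurable_EFinP.
have : \int[P]_w `|(EFin \o f) w| = 0.
  rewrite -[RHS]If; apply: eq_integral => w _ /=.
  by rewrite ger0_norm.
move/(ae_eq_integral_abs P measurableT mF).
by apply: filterS => w /= /(_ I) [].
Qed.

Let ae_prob : {ae P, forall w, prob_measures (eta w)}.
Proof.
have mf := measurableT_comp (measurable_fine_ev measurableT) meta.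
pose z w := fine (eta w setT).
have z0 w : (0 <= z w)%R by rewrite fine_ge0.
have var0 : \int[P]_w ((z w - 1) ^+ 2)%:E = 0.
  (* The expansion of the square, arranged so that every term is non-negative and no extended reals
     are subtracted. It reads v + 2 = 1 + 1. *)
  have : \int[P]_w ((z w - 1) ^+ 2)%:E + 2%:E * \int[P]_w (z w)%:E =
      \int[P]_w ((z w) ^+ 2)%:E + \int[P]_w (cst 1) w.
    have mz2 : measurable_fun setT (fun w => ((z w - 1) ^+ 2)%:E).
      apply/measurable_EFinP; apply: measurable_funX.
      exact: measurable_funB.
    have mz : measurable_fun setT (fun w => (z w)%:E) by exact/measurable_EFinP.
    have mzz : measurable_fun setT (fun w => ((z w) ^+ 2)%:E).
      by apply/measurable_EFinP; exact: measurable_funX.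
    rewrite -ge0_integralZl//; last by move=> w _; rewrite lee_fin.
    rewrite -ge0_integralD//; last 3 first.
    - by move=> w _; rewrite lee_fin sqr_ge0.
    - by move=> w _; rewrite mule_ge0 ?lee_fin.
    - exact: measurable_funeM.
    rewrite -ge0_integralD//; last by move=> w _; rewrite lee_fin sqr_ge0.
    apply: eq_integral => w _; rewrite -EFinM -!EFinD; congr EFin; ring.
  rewrite square_total mean_fine_total integral_cstP// mule1 -EFinD.
  case: (\int[P]_w _) => [r| |]//.
  by rewrite -EFinD => -[] r0; congr EFin; lra.
apply: filterS2 (ae_eq0 _ _ var0) total_fin_num.
- move=> w /eqP; rewrite sqrf_eq0 subr_eq0 => /eqP w1 wfin.
  by rewrite /prob_measures /= -(fineK wfin) -/(z w) w1.
- by apply: measurable_funX; exact: measurable_funB.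
- by move=> w; rewrite sqr_ge0.
Qed.

Let ae_null B : measurable B -> sigma B = 0 -> {ae P, forall w, eta w B = 0}.
Proof.
move=> mB sB.
have mf := measurableT_comp (measurable_fine_ev mB) meta.
have mF : measurable_fun setT (fun w => (fine (eta w B))%:E).
  exact/measurable_EFinP.
have F0 w : 0 <= (fine (eta w B))%:E by rewrite lee_fin fine_ge0.
pose e := \int[P]_w (fine (eta w B))%:E.
have e0 : 0 <= e by exact: integral_ge0.
have e1 : e <= 1.
  rewrite -[leRHS]integral_cstP//; apply: ae_ge0_le_integral => //.
  apply: filterS ae_prob => w w1 _; rewrite fineK ?prob_fin_num//.
  by rewrite /= -w1; apply: le_measure; rewrite ?inE.
have efin : e \is a fin_num by rewrite ge0_fin_numE// (le_lt_trans e1)// ltry.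
have := mecke (measurable_fine_ev mB) (fun mu => fine_ge0 (measure_ge0 mu _)).
have -> : \int[P]_w (eta w setT * (fine (eta w B))%:E) = e.
  apply: ge0_ae_eq_integral => [||||w _|].
  - exact: measurableT.
  - by apply: emeasurable_funM => //; exact: measurable_eta_ev.
  - exact: mF.
  - by move=> w _; rewrite mule_ge0.
  - exact: F0.
  by apply: filterS ae_prob => w -> _; rewrite mul1e.
have mfix : measurable_fun setT (fun p : measures X R * X => (fine (p.1 B))%:E).
  by apply/measurable_EFinP; exact: (measurableT_comp (measurable_fine_ev mB) measurable_fst).
have -> : mixture_integral P eta sigma beta (fun p => (fine (p.1 B))%:E) =
    (fine e * (beta + 1)^-1 * beta)%:E.
  rewrite [RHS]EFinM -sigmaTE -integral_cst//.
  apply: ge0_ae_eq_integral => [||||x _|].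
  - exact: measurableT.
  - apply: (measurable_mixture_integrand P eta beta mfix) => p.
    by rewrite lee_fin fine_ge0.
  - exact: measurable_cst.
  - move=> x _; apply: integral_ge0 => t _; rewrite mule_ge0 ?lee_fin ?powR_ge0//.
    by apply: integral_ge0 => w _; rewrite lee_fin fine_ge0.
  - by rewrite lee_fin mulr_ge0 ?fine_ge0// invr_ge0 addr_ge0// ltW.
  (* For x outside the null set B the Dirac part does not charge B, so the mixture gives B the mass
     (1 - t) eta B, and the integral over t is [integral_onem_mul]. *)
  exists B; split => // x /=; apply: contra_notP => nBx _.
  rewrite EFinM -integral_onem_mul// -ge0_integralZl//; last 3 first.
  - apply: measurable_funTS; apply/measurable_EFinP; apply: measurable_funM.
      exact: measurable_funB.
    exact: measurable_onem_powR.
  - move=> t; rewrite /= in_itv/= => /andP[_ t1].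
    by rewrite lee_fin mulr_ge0 ?powR_ge0// subr_ge0.
  - by rewrite lee_fin fine_ge0.
  apply: eq_integral => t; rewrite inE/= in_itv/= => t01.
  have [t0 t1] := andP t01.
  rewrite [in RHS]EFinM muleA; congr (_ * _).
  rewrite muleC fineK// -ge0_integralZl//; last by rewrite lee_fin subr_ge0.
  apply: eq_integral => w _; rewrite mixtureE// indicE memNset// mule0 adde0.
  rewrite -EFinM; congr EFin.
  (* The equality is needed for every w, including those with infinite mass: for t < 1 the product
     is then infinite too, and [fine] gives 0 on both sides. *)
  have [->|t1'] := eqVneq t 1%R; first by rewrite subrr mul0e mul0r.
  have t1'' : 0 < (1 - t)%:E by rewrite lte_fin subr_gt0 lt_neqAle t1'.
  by case: (eta w B) => [r| |]//=; rewrite ?gt0_muley ?gt0_muleNy ?mulr0.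
rewrite -(fineK efin) => -[] eE.
have fe0 : fine e = 0%R.
  have b1 : (0 < beta + 1)%R by rewrite addr_gt0.
  have : (fine e * (beta + 1) = fine e * beta)%R.
    by rewrite {1}eE; field; rewrite gt_eqF.
  by rewrite mulrDr mulr1; lra.
have := ae_eq0 mf (fun w => fine_ge0 (measure_ge0 (eta w) B)).
rewrite -/e -(fineK efin) fe0 => /(_ erefl).
apply: filterS2 ae_prob => w w1 /= wB.
by rewrite -(fineK (prob_fin_num w1 mB)) wB.
Qed.

Lemma mecke_dirichlet_ferguson : dirichlet_ferguson sigma eta.
Proof.
split => [|B mB sB|n C n1 mC neC tC UC C0 A mA]; [exact: ae_prob|exact: ae_null|].
have N0 : sigma (~` \bigcup_i C i) = 0 by rewrite UC setCT measure0.
have a0 i : (0 < fine (sigma (C i)))%R.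
  by rewrite fine_gt0// C0/= ltey_eq fin_num_measure.
have [m2 m2E] := dirichlet_measure a0.
have mY : measurable_fun setT (cell_masses C \o eta).
  exact: (measurableT_comp (measurable_cell_masses mC) meta).
pose push := (pushforward P (cell_masses C \o eta)
  : {measure set (n.+1.-tuple R) -> \bar R}).
pose m1 := push mY.
have mS := @measurable_simplex R n.
rewrite -m2E//; apply: (stick_breaking_unique (m1 := m1) a0) => //.
- by rewrite m2E// dirichlet_setT.
- have simY : {ae P, forall w, simplex (cell_masses C (eta w))}.
    apply: filterS ae_prob => w w1; apply: cell_masses_simplex => //.
    by rewrite UC setCT measure0.
  exists (~` @simplex R n); split => //; first exact: measurableC.
  rewrite -[LHS]/(P ((cell_masses C \o eta) @^-1` (~` @simplex R n))).
  apply/negligibleP => //.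
  rewrite -[X in measurable X]setTI.
  exact: (mY measurableT _ (measurableC mS)).
- exact: dirichlet_ae_simplex m2E.
- move=> f mf f0.
  have mF : measurable_fun setT (fun z => (f z)%:E) by exact/measurable_EFinP.
  have pushE (h : n.+1.-tuple R -> \bar R) : measurable_fun setT h ->
      (forall z, 0 <= h z) -> \int[m1]_z h z = \int[P]_w h (cell_masses C (eta w)).
    by move=> mh h0; rewrite ge0_integral_pushforward.
  rewrite pushE//.
  have mG : measurable_fun setT (f \o cell_masses C).
    exact: (measurableT_comp mf (measurable_cell_masses mC)).
  have := mecke mG (fun mu => f0 _).
  have -> : \int[P]_w (eta w setT * ((f \o cell_masses C) (eta w))%:E) =
      \int[P]_w (f (cell_masses C (eta w)))%:E.
    apply: ge0_ae_eq_integral => [||||w _|].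
    - exact: measurableT.
    - apply: emeasurable_funM; first exact: measurable_eta_ev.
      exact: (measurableT_comp mF mY).
    - exact: (measurableT_comp mF mY).
    - by move=> w _; rewrite mule_ge0// lee_fin f0.
    - by rewrite lee_fin.
    by apply: filterS ae_prob => w -> _; rewrite mul1e.
  move=> ->; rewrite (sum_cells_sigma mC tC N0).
  pose Q i := \int[leb]_(t in `[0%R, 1%R])
    ((\int[m1]_z (f (tuple_mix t i z))%:E) * ((1 - t) `^ (beta - 1))%:E).
  have Q0 i : 0 <= Q i.
    apply: integral_ge0 => t _; rewrite mule_ge0 ?lee_fin ?powR_ge0//.
    by apply: integral_ge0 => z _; rewrite lee_fin.
  have mind i : measurable_fun setT (fun x => (\1_(C i) x)%:E : \bar R).
    by apply/measurable_EFinP; exact: measurable_indic.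
  have mQ i : measurable_fun setT (fun x => Q i * (\1_(C i) x)%:E).
    exact: measurable_funeM.
  have Q1 i x : 0 <= Q i * (\1_(C i) x)%:E by rewrite mule_ge0// lee_fin.
  (* For x in C i the inner integral is [Q i], so integrating over x weights [Q i] by the mass of C
     i, as in [stick_breaking]. *)
  transitivity (\int[sigma]_x \sum_i (Q i * (\1_(C i) x)%:E)); last first.
    rewrite ge0_integral_sum//; apply: eq_bigr => i _.
    by rewrite ge0_integralZl// integral_indic// setIT fineK ?fin_num_measure// muleC.
  apply: eq_integral => x _.
  have [i _ Cix] : (\bigcup_i C i) x by rewrite UC.
  rewrite (sum_cells Q tC Cix); apply: eq_integral => t; rewrite inE/= in_itv/= => t01.
  have mfmix : measurable_fun setT (fun z => (f (tuple_mix t i z))%:E).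
    exact: (measurableT_comp mF (measurable_fun_pair2 t (measurable_tuple_mix i))).
  rewrite pushE//; last by move=> z; rewrite lee_fin.
  congr (_ * _); apply: ge0_ae_eq_integral => [||||w _|].
  - exact: measurableT.
  - apply: (measurableT_comp mF); apply: (measurableT_comp (measurable_cell_masses mC)).
    exact: (measurable_fun_pair2 (x, t) (measurable_mixture meta)).
  - exact: (measurableT_comp mfmix mY).
  - by move=> w _; rewrite lee_fin f0.
  - by rewrite lee_fin.
  apply: filterS ae_prob => w w1 _ /=.
  by rewrite (cell_masses_mixture mC tC t01 w1 Cix).
- exact: (dirichlet_stick_breaking a0 m2E).
Qed.

End mecke_converse.

(** * The Mecke equation for functions on probability measures *)

Section mecke_prob.
Context (d dO : measure_display) (X : measurableType d) (R : realType)
  (Omega : measurableType dO) (P : probability Omega R)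
  (eta : {RV P >-> measures X R})
  (sigma : {finite_measure set X -> \bar R}).
Local Notation RT := (measurableTypeR R).
Local Notation leb := (@lebesgue_measure R).
Local Notation beta := (fine (sigma setT)).
Local Notation D := (eta @^-1` prob_measures).
Local Open Scope ereal_scope.
Context (sigma_neq0 : sigma setT != 0) (DF : dirichlet_ferguson sigma eta).

Let meta : measurable_fun setT (eta : Omega -> measures X R) :=
  measurable_funPT eta.

Let mD : measurable D. Proof. exact: measurable_prob_measures_preimage. Qed.

Let mprobX : measurable (prob_measures `*` setT : set (measures X R * X)).
Proof. by apply: measurableX => //; exact: measurable_prob_measures. Qed.

Let PD : P D = 1.
Proof.
have [eta1 _ _] := DF.
have N0 : P (~` D) = 0 by apply/negligibleP => //; exact: measurableC.
by rewrite -[D]setCK probability_setC ?N0 ?sube0//; exact: measurableC.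
Qed.

Let PDoo : P D < +oo.
Proof. by rewrite [ltLHS]PD ltry. Qed.

Let measurable_mixture_on t x (F : measures X R * X -> R) : (0 <= t <= 1)%R ->
  measurable_fun (prob_measures `*` setT) F ->
  measurable_fun D (fun w => F (mixture t (eta w) x, x)).
Proof.
move=> t01 mF.
apply: (@measurable_comp _ _ _ _ _ _ (prob_measures `*` setT) F) => //.
  move=> _ [w w1 <-]; split => //; exact: prob_mixture.
apply: measurable_funTS.
exact: (measurable_fun_pair2 (x, t) (measurable_mixture_pair eta)).
Qed.

Section nonnegative.
Context (F : measures X R * X -> R)
  (mF : measurable_fun (prob_measures `*` setT) F)
  (F0 : forall mu x, prob_measures mu -> (0 <= F (mu, x))%R).

(** [F] is controlled only on probability measures; its extension by 0 is measurable and
    non-negative everywhere, as [dirichlet_ferguson_mecke] demands. *)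
Let E : measures X R * X -> \bar R := (EFin \o F) \_ (prob_measures `*` setT).

Let mE : measurable_fun setT E.
Proof.
by apply/(measurable_restrictT _ _).1 => //; exact/measurable_EFinP.
Qed.

Let EF mu x : prob_measures mu -> E (mu, x) = (F (mu, x))%:E.
Proof. by move=> mu1; rewrite /E patchE mem_set. Qed.

Let E0 p : 0 <= E p.
Proof.
rewrite /E patchE; case: ifPn => //; rewrite inE => -[p1 _].
by case: p p1 => mu x mu1; rewrite lee_fin F0.
Qed.

Let integral_subkernelE w : D w ->
  \int[prob_subkernel eta w]_x E (eta w, x) = \int[eta w]_x (F (eta w, x))%:E.
Proof.
by move=> w1; rewrite prob_subkernelE//; apply: eq_integral => x _; rewrite EF.
Qed.

Let integral_mixtureE t x : (0 <= t <= 1)%R ->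
  \int[P]_w E (mixture t (eta w) x, x) =
  \int[P]_(w in D) (F (mixture t (eta w) x, x))%:E.
Proof.
move=> t01; have [eta1 _ _] := DF.
rewrite [RHS]integral_mkcond; apply: ge0_ae_eq_integral => [||||w _|].
- exact: measurableT.
- exact: (measurableT_comp mE (measurable_fun_pair2 (x, t) (measurable_mixture_pair eta))).
- apply/(measurable_restrictT _ _).1 => //; apply/measurable_EFinP.
  exact: measurable_mixture_on.
- by move=> w _; exact: E0.
- rewrite patchE; case: ifPn => //; rewrite inE => w1.
  by rewrite lee_fin F0//; exact: prob_mixture.
apply: filterS eta1 => w w1 _; rewrite patchE mem_set// EF//.
exact: prob_mixture.
Qed.

Lemma mecke_ge0 :
  \int[P]_(w in D) \int[eta w]_x (F (eta w, x))%:E =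
  \int[sigma]_x \int[leb]_(t in `[0%R, 1%R])
    ((\int[P]_(w in D) (F (mixture t (eta w) x, x))%:E)
     * ((1 - t) `^ (beta - 1))%:E).
Proof.
rewrite [LHS]integral_mkcond.
transitivity (\int[P]_w \int[prob_subkernel eta w]_x E (eta w, x)).
  apply: eq_integral => w _; rewrite patchE; case: ifPn => wD.
    by rewrite integral_subkernelE//; move: wD; rewrite inE.
  (* Off D the subkernel is the zero measure, which matches the restriction of the left-hand side to
     D. *)
  rewrite /prob_subkernel ifF ?integral_measure_zero//.
  by apply/negP => /eqP w1; move/negP: wD; apply; rewrite inE.
rewrite (dirichlet_ferguson_mecke sigma_neq0 DF mE E0).
apply: eq_integral => x _.
apply: eq_integral => t; rewrite inE/= in_itv/= => t01; congr (_ * _).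
exact: integral_mixtureE.
Qed.

Context (K : R) (FK : forall mu x, prob_measures mu -> (F (mu, x) <= K)%R).

Let ge0_integrable d' (T : measurableType d') (m : {measure set T -> \bar R})
    (A : set T) (f g : T -> \bar R) : measurable A ->
  measurable_fun A f -> measurable_fun A g ->
  (forall x, A x -> 0 <= f x <= g x) -> \int[m]_(x in A) g x < +oo ->
  m.-integrable A f.
Proof.
move=> mA mf mg fg goo; apply/integrableP; split => //.
apply: le_lt_trans goo; apply: ge0_le_integral => //.
  exact: measurableT_comp.
by move=> x Ax; have /andP[f0 fgx] := fg x Ax; rewrite gee0_abs.
Qed.

Let integral_cst_lty d' (T : measurableType d') (m : {measure set T -> \bar R})
    (A : set T) (c : R) : measurable A -> m A < +oo ->
  \int[m]_(x in A) (cst c%:E) x < +oo.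
Proof.
move=> mA moo; rewrite integral_cst// ltey_eq fin_numM//.
by rewrite ge0_fin_numE.
Qed.

Let measurable_section mu : prob_measures mu ->
  measurable_fun setT (fun x => F (mu, x)).
Proof.
move=> mu1; apply: (@measurable_comp _ _ _ _ _ _ (prob_measures `*` setT) F) => //.
  by move=> _ [x _ <-].
Qed.

(** This and the next lemmas give integrability at each level of the iterated integrals when 0 <= F
    <= K, since [mecke_bounded] subtracts at every level. *)
Lemma integrable_section w : D w ->
  (eta w).-integrable setT (fun x => (F (eta w, x))%:E).
Proof.
move=> w1; apply: (ge0_integrable (g := cst K%:E)) => //.
- by apply/measurable_EFinP; exact: measurable_section.
- by move=> x _; rewrite !lee_fin F0// FK.
- by apply: integral_cst_lty => //; rewrite w1 ltry.
Qed.

Lemma integrable_integral_section :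
  P.-integrable D (fun w => \int[eta w]_x (F (eta w, x))%:E).
Proof.
apply: (ge0_integrable (g := cst K%:E)) => //.
- apply: (eq_measurable_fun (fun w => \int[prob_subkernel eta w]_x E (eta w, x))).
    by move=> w; rewrite inE; exact: integral_subkernelE.
  by apply: measurable_funTS; exact: measurable_prob_subkernel_integral.
- move=> w w1; apply/andP; split.
    by apply: integral_ge0 => x _; rewrite lee_fin F0.
  rewrite -[leRHS]mule1 -w1 -integral_cst//; apply: ge0_le_integral => //.
  + by move=> x _; rewrite lee_fin F0.
  + by apply/measurable_EFinP; exact: measurable_section.
  + by move=> x _; rewrite lee_fin FK.
- by apply: integral_cst_lty => //; exact: PDoo.
Qed.

Lemma integrable_mixture t x : (0 <= t <= 1)%R ->
  P.-integrable D (fun w => (F (mixture t (eta w) x, x))%:E).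
Proof.
move=> t01; apply: (ge0_integrable (g := cst K%:E)) => //.
- by apply/measurable_EFinP; exact: measurable_mixture_on.
- by move=> w w1; rewrite !lee_fin F0 ?FK//; exact: prob_mixture.
- by apply: integral_cst_lty => //; exact: PDoo.
Qed.

Let integral_mixture_bounds t x : (0 <= t <= 1)%R ->
  0 <= \int[P]_(w in D) (F (mixture t (eta w) x, x))%:E <= K%:E.
Proof.
move=> t01; apply/andP; split.
  by apply: integral_ge0 => w w1; rewrite lee_fin F0//; exact: prob_mixture.
rewrite -[leRHS]mule1 -PD -integral_cst//; apply: ge0_le_integral => //.
- by move=> w w1; rewrite lee_fin F0//; exact: prob_mixture.
- by apply/measurable_EFinP; exact: measurable_mixture_on.
- by move=> w w1; rewrite lee_fin FK//; exact: prob_mixture.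
Qed.

Let beta_gt0 : (0 < beta)%R.
Proof. by rewrite fine_gt0// lt0e sigma_neq0 measure_ge0/= ltey_eq fin_num_measure. Qed.

(** Some value of [F] lies between 0 and [K]: D is nonempty because it has probability 1, and X is
    nonempty because [sigma] is not zero. *)
Let K0 : (0 <= K)%R.
Proof.
have [w w1] : D !=set0.
  by apply/set0P; apply/eqP => D0; move: PD; rewrite D0 measure0 => /eqP;
    rewrite eqe eq_sym oner_eq0.
have [x _] : [set: X] !=set0.
  by apply/set0P; apply/eqP => X0; move: sigma_neq0; rewrite X0 measure0 eqxx.
by apply: le_trans (FK x w1); exact: F0.
Qed.

Let integral_weight : \int[leb]_(t in `[0%R, 1%R])
  (K * (1 - t) `^ (beta - 1))%:E = (K / beta)%:E.
Proof.
under eq_integral do rewrite EFinM.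
rewrite ge0_integralZl//; last 2 first.
- apply: measurable_funTS; apply/measurable_EFinP; exact: measurable_onem_powR.
- by move=> t _; rewrite lee_fin powR_ge0.
by rewrite (integral_powR_onem beta_gt0 ler01) powR1 div1r.
Qed.

Let weighted_bounds t x : (0 <= t <= 1)%R ->
  0 <= (\int[P]_(w in D) (F (mixture t (eta w) x, x))%:E)
     * ((1 - t) `^ (beta - 1))%:E <= (K * (1 - t) `^ (beta - 1))%:E.
Proof.
move=> t01; have /andP[h0 h1] := integral_mixture_bounds x t01.
rewrite mule_ge0 ?lee_fin ?powR_ge0//= EFinM.
by rewrite lee_wpmul2r// lee_fin powR_ge0.
Qed.

Let measurable_weighted x : measurable_fun (`[0%R, 1%R]%classic : set RT)
  (fun t => (\int[P]_(w in D) (F (mixture t (eta w) x, x))%:E)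
     * ((1 - t) `^ (beta - 1))%:E).
Proof.
apply: (eq_measurable_fun (fun t => (\int[P]_w E (mixture t (eta w) x, x))
     * ((1 - t) `^ (beta - 1))%:E)).
  by move=> t; rewrite inE/= in_itv/= => t01; rewrite integral_mixtureE.
apply: measurable_funTS; apply: emeasurable_funM; last first.
  by apply/measurable_EFinP; exact: measurable_onem_powR.
exact: (measurable_fun_pair2 x (measurable_integral_mixture P eta mE E0)).
Qed.

Let measurable_bound : measurable_fun (`[0%R, 1%R]%classic : set RT)
  (fun t => (K * (1 - t) `^ (beta - 1))%:E).
Proof.
apply: measurable_funTS; apply/measurable_EFinP; apply: measurable_funM => //.
exact: measurable_onem_powR.
Qed.

Lemma integrable_weighted x : leb.-integrable `[0%R, 1%R]
  (fun t => (\int[P]_(w in D) (F (mixture t (eta w) x, x))%:E)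
     * ((1 - t) `^ (beta - 1))%:E).
Proof.
have := ge0_integrable (m := leb) (measurable_itv _) (measurable_weighted x)
  measurable_bound; apply.
- by move=> t; rewrite /= in_itv/= => t01; exact: weighted_bounds.
- by rewrite integral_weight ltry.
Qed.

Lemma integrable_integral_weighted : sigma.-integrable setT (fun x =>
  \int[leb]_(t in `[0%R, 1%R])
    ((\int[P]_(w in D) (F (mixture t (eta w) x, x))%:E)
     * ((1 - t) `^ (beta - 1))%:E)).
Proof.
apply: (ge0_integrable (g := cst (K / beta)%:E)) => //.
- apply: (eq_measurable_fun (fun x => \int[leb]_(t in `[0%R, 1%R])
    ((\int[P]_w E (mixture t (eta w) x, x)) * ((1 - t) `^ (beta - 1))%:E))).
    move=> x _; apply: eq_integral => t; rewrite inE/= in_itv/= => t01.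
    by rewrite integral_mixtureE.
  exact: measurable_mixture_integrand.
- move=> x _; apply/andP; split.
    apply: integral_ge0 => t; rewrite /= in_itv/= => t01.
    by have /andP[] := weighted_bounds x t01.
  rewrite -integral_weight; apply: ge0_le_integral => //.
  + by move=> t; rewrite /= in_itv/= => t01; have /andP[] := weighted_bounds x t01.
  + by move=> t; rewrite /= in_itv/= => t01; have /andP[] := weighted_bounds x t01.
- by apply: integral_cst_lty => //; rewrite ltey_eq fin_num_measure.
Qed.

End nonnegative.

(** F is the difference of F + |c| and the constant |c|, both non-negative and bounded on
    probability measures, so [mecke_ge0] applies to each. *)
Lemma mecke_bounded (F : measures X R * X -> R) (c : R) :
  measurable_fun (prob_measures `*` setT) F ->
  (forall mu x, prob_measures mu -> `|F (mu, x)| <= c)%R ->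
  \int[P]_(w in D) \int[eta w]_x (F (eta w, x))%:E =
  \int[sigma]_x \int[leb]_(t in `[0%R, 1%R])
    ((\int[P]_(w in D) (F (mixture t (eta w) x, x))%:E)
     * ((1 - t) `^ (beta - 1))%:E).
Proof.
move=> mF Fc.
pose F1 p := (F p + `|c|)%R; pose F2 (p : measures X R * X) := `|c|%R.
have mF1 : measurable_fun (prob_measures `*` setT) F1.
  exact: measurable_funD.
have mF2 : measurable_fun (prob_measures `*` setT) F2 by exact: measurable_cst.
have Fbound mu x : prob_measures mu -> (- `|c| <= F (mu, x) <= `|c|)%R.
  by move=> mu1; rewrite -ler_norml (le_trans (Fc mu x mu1))// ler_norm.
have F10 mu x : prob_measures mu -> (0 <= F1 (mu, x))%R.
  by move=> mu1; have /andP[] := Fbound mu x mu1; rewrite /F1; lra.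
have F1K mu x : prob_measures mu -> (F1 (mu, x) <= `|c| + `|c|)%R.
  by move=> mu1; have /andP[] := Fbound mu x mu1; rewrite /F1; lra.
have F20 mu x : prob_measures mu -> (0 <= F2 (mu, x))%R by rewrite /F2.
have F2K mu x : prob_measures mu -> (F2 (mu, x) <= `|c|)%R by rewrite /F2.
have FE p : (F p)%:E = (F1 p)%:E - (F2 p)%:E.
  by rewrite -EFinB /F1 /F2 addrK.
transitivity (\int[P]_(w in D) (\int[eta w]_x (F1 (eta w, x))%:E -
    \int[eta w]_x (F2 (eta w, x))%:E)).
  apply: eq_integral => w; rewrite inE => w1.
  under eq_integral do rewrite FE.
  by rewrite integralB//; [exact: (integrable_section mF1 F10 F1K)|
    exact: (integrable_section mF2 F20 F2K)].
rewrite integralB//; [|exact: (integrable_integral_section mF1 F10 F1K)|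
  exact: (integrable_integral_section mF2 F20 F2K)].
rewrite (mecke_ge0 mF1 F10) (mecke_ge0 mF2 F20) -integralB//;
  [|exact: (integrable_integral_weighted mF1 F10 F1K)|
  exact: (integrable_integral_weighted mF2 F20 F2K)].
apply: eq_integral => x _; rewrite -integralB//;
  [|exact: (integrable_weighted mF1 F10 F1K)|exact: (integrable_weighted mF2 F20 F2K)].
apply: eq_integral => t; rewrite inE/= in_itv/= => t01.
have distr (u v z : \bar R) : u \is a fin_num -> z \is a fin_num ->
    u * z - v * z = (u - v) * z.
  by move=> ufin zfin; rewrite muleBl// fin_num_adde_defr.
have i1 := integrable_mixture mF1 F10 F1K x t01.
have i2 := integrable_mixture mF2 F20 F2K x t01.
under [in RHS]eq_integral do rewrite FE.
rewrite integralB//; apply: distr => //; exact: (integrable_fin_num mD i1).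
Qed.

End mecke_prob.

Section mecke_atoms.
Context (d dO : measure_display) (X : measurableType d) (R : realType)
  (Omega : measurableType dO) (P : probability Omega R)
  (eta : {RV P >-> measures X R})
  (sigma : {finite_measure set X -> \bar R}).
Local Notation beta := (fine (sigma setT)).
Local Notation D := (eta @^-1` prob_measures).

(** The null event on which eta charges x depends on x. Hence the atom of the mixture is replaced by
    t at fixed x and t, inside the outer integrals. *)
Lemma integral_mixture_atom (K : measures X R * X * R -> R) (t : R) (x : X) :
  measurable [set x] -> sigma [set x] = 0%E -> dirichlet_ferguson sigma eta ->
  0 <= t <= 1 ->
  measurable_fun ((prob_measures `*` setT) `*` (`[0, 1]%classic : set R)) K ->
  measurable_fun (prob_measures `*` setT)
    (fun p : measures X R * X => K (p.1, p.2, fine (p.1 [set p.2]))) ->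
  (\int[P]_(w in D)
     (K (mixture t (eta w) x, x, fine (mixture t (eta w) x [set x])))%:E =
   \int[P]_(w in D) (K (mixture t (eta w) x, x, t))%:E)%E.
Proof.
move=> mx sx DF t01 mK mKa; have [_ eta0 _] := DF.
have mD : measurable D by exact: measurable_prob_measures_preimage.
have mprobX : measurable (prob_measures `*` setT : set (measures X R * X)).
  by apply: measurableX => //; exact: measurable_prob_measures.
have mmix : measurable_fun setT (fun w => (mixture t (eta w) x, x)).
  exact: (measurable_fun_pair2 (x, t) (measurable_mixture_pair eta)).
apply: ae_eq_integral => //.
- apply/measurable_EFinP.
  apply: (measurable_comp (f := fun p : measures X R * X =>
    K (p.1, p.2, fine (p.1 [set p.2]))) mprobX _ mKa (measurable_funTS mmix)).
  by move=> _ [w w1 <-]; split => //; exact: prob_mixture.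
- apply/measurable_EFinP.
  apply: (@measurable_comp _ _ _ _ _ _
    ((prob_measures `*` setT) `*` (`[0, 1]%classic : set R)) K) => //.
  + by apply: measurableX.
  + move=> _ [w w1 <-]; split; last by rewrite /= in_itv.
    by split => //; exact: prob_mixture.
  + apply: measurable_funTS.
    exact: (measurable_fun_pair mmix (measurable_cst (t : measurableTypeR R))).
apply: filterS (eta0 _ mx sx) => w wx _.
by rewrite mixtureE// wx mule0 add0e indicE mem_set// mule1.
Qed.

End mecke_atoms.

(** In the last formula the measurability of (mu, x) |-> K (mu, x, mu{x}) is a separate hypothesis:
    composed with y |-> \d_y, the map (mu, x) |-> mu{x} is the indicator of the diagonal, which need
    not be measurable in the product even if all points are. Expectations of functions given on
    probability measures are taken over the event that eta is one, which has probability 1. *)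
Theorem theorem1p1 (R : realType) (d dO : measure_display)
  (X : measurableType d) (mX1 : forall x : X, measurable [set x])
  (sigma : {finite_measure set X -> \bar R})
  (sigma_neq0 : sigma setT != 0%E)
  (sigma_diffuse : forall x : X, sigma [set x] = 0%E)
  (Omega : measurableType dO) (P : probability Omega R)
  (eta : {RV P >-> measures X R}) :
  let beta := fine (sigma setT) in
  (dirichlet_ferguson sigma eta <->
   forall G : measures X R -> R,
     measurable_fun setT G -> (forall mu, 0 <= G mu) ->
     (\int[P]_w (eta w setT * (G (eta w))%:E) =
      \int[sigma]_x \int[lebesgue_measure]_(t in `[0%R, 1%R])
        ((\int[P]_w (G (mixture t (eta w) x))%:E)
         * ((1 - t) `^ (beta - 1))%:E))%E)
  /\
  (dirichlet_ferguson sigma eta ->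
   (forall F : measures X R * X -> R,
      measurable_fun (prob_measures `*` setT) F ->
      (forall mu x, prob_measures mu -> 0 <= F (mu, x)) \/
      (exists c : R, forall mu x, prob_measures mu -> `|F (mu, x)| <= c) ->
      (\int[P]_(w in eta @^-1` prob_measures) \int[eta w]_x (F (eta w, x))%:E =
       \int[sigma]_x \int[lebesgue_measure]_(t in `[0%R, 1%R])
         ((\int[P]_(w in eta @^-1` prob_measures)
             (F (mixture t (eta w) x, x))%:E)
          * ((1 - t) `^ (beta - 1))%:E))%E)
   /\
   (forall K : measures X R * X * R -> R,
      measurable_fun ((prob_measures `*` setT) `*` (`[0, 1]%classic : set R)) K ->
      (forall mu x (t : R), prob_measures mu -> t \in `[0, 1] -> 0 <= K (mu, x, t)) \/
      (exists c : R, forall mu x (t : R), prob_measures mu -> t \in `[0, 1] ->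
         `|K (mu, x, t)| <= c) ->
      measurable_fun (prob_measures `*` setT)
        (fun p : measures X R * X => K (p.1, p.2, fine (p.1 [set p.2]))) ->
      (\int[P]_(w in eta @^-1` prob_measures)
         \int[eta w]_x (K (eta w, x, fine (eta w [set x])))%:E =
       \int[sigma]_x \int[lebesgue_measure]_(t in `[0%R, 1%R])
         ((\int[P]_(w in eta @^-1` prob_measures)
             (K (mixture t (eta w) x, x, t))%:E)
          * ((1 - t) `^ (beta - 1))%:E))%E)).
Proof.
move=> beta; split; first split => [DF G mG G0|H].
- have mF : measurable_fun (prob_measures `*` setT)
      (fun p : measures X R * X => G p.1).
    exact: measurable_funTS (measurableT_comp mG measurable_fst).
  have mF' : measurable_fun setT (fun p : measures X R * X => (G p.1)%:E).
    by apply/measurable_EFinP; exact: (measurableT_comp mG measurable_fst).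
  have F0 (p : measures X R * X) : (0 <= (G p.1)%:E)%E by rewrite lee_fin.
  have [eta1 _ _] := DF.
  (* For f (mu, x) = G mu the integral of f against eta w is G (eta w) times the total mass, almost
     surely. *)
  rewrite -[RHS](dirichlet_ferguson_mecke sigma_neq0 DF mF' F0).
  have meta := measurable_funPT eta.
  apply: ge0_ae_eq_integral => [||||w _|].
  + exact: measurableT.
  + apply: emeasurable_funM; first exact: measurable_eta_ev.
    by apply/measurable_EFinP; exact: (measurableT_comp mG meta).
  + exact: (measurable_prob_subkernel_integral eta mF' F0).
  + by move=> w _; rewrite mule_ge0// lee_fin.
  + by apply: integral_ge0 => x _; rewrite lee_fin.
  apply: filterS eta1 => w w1 _.
  by rewrite prob_subkernelE//= integral_cst ?lee_fin// muleC.
- exact: mecke_dirichlet_ferguson.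
move=> DF; have FE (F : measures X R * X -> R) :
    measurable_fun (prob_measures `*` setT) F ->
    (forall mu x, prob_measures mu -> 0 <= F (mu, x)) \/
    (exists c : R, forall mu x, prob_measures mu -> `|F (mu, x)| <= c) ->
    (\int[P]_(w in eta @^-1` prob_measures) \int[eta w]_x (F (eta w, x))%:E =
     \int[sigma]_x \int[lebesgue_measure]_(t in `[0%R, 1%R])
       ((\int[P]_(w in eta @^-1` prob_measures)
           (F (mixture t (eta w) x, x))%:E)
        * ((1 - t) `^ (beta - 1))%:E))%E.
  by move=> mF [F0|[c Fc]]; [exact: mecke_ge0|exact: (mecke_bounded _ _ mF Fc)].
split=> // K mK Kb mKa.
have mass01 (mu : measures X R) x : prob_measures mu ->
    fine (mu [set x]) \in `[0, 1].
  move=> mu1; rewrite in_itv/= fine_ge0//= -lee_fin fineK ?prob_fin_num//.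
  by rewrite -mu1; apply: le_measure; rewrite ?inE.
pose F (p : measures X R * X) := K (p.1, p.2, fine (p.1 [set p.2])).
rewrite (FE F mKa); last first.
  case: Kb => [K0|[c Kc]]; [left|right; exists c] => mu x mu1.
    by apply: K0 => //; exact: mass01.
  by apply: Kc => //; exact: mass01.
apply: eq_integral => x _; apply: eq_integral => t; rewrite inE/= in_itv/= => t01.
by congr (_ * _)%E; exact: (integral_mixture_atom _ _ DF).
Qed.
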